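(* Let $\ell\ge1$ and let $\dot{\mathfrak g}=\{X\in M_{4\ell+2}(\mathbb C)\mid X^T=-X\}$, the simple Lie algebra of type $D_{2\ell+1}$. Put $$\sigma_0=\mathrm{Ad}\Big(\sum_{i=1}^{2\ell+1}\big(E_{i,i}-E_{2\ell+1+i,2\ell+1+i}\big)\Big),\quad\sigma_1=\mathrm{Ad}\Big(\sum_{i=1}^{4\ell+2}(-1)^iE_{i,4\ell+3-i}\Big).$$ Then $\dot{\mathfrak g}_{(\overline0,\overline0)}$ is the simple Lie algebra of type $B_\ell$ (with $B_1=A_1$); as modules over it, $\dot{\mathfrak g}_{(\overline0,\overline1)}$ and $\dot{\mathfrak g}_{(\overline1,\overline1)}$ are both the adjoint representation, and $\dot{\mathfrak g}_{(\overline1,\overline0)}$ is the direct sum of a $(2\ell^2+3\ell)$-dimensional irreducible representation and a one-dimensional one; and the set $R$ of non-isotropic roots of the twisted 2-toroidal Lie algebra $\mathfrak g(\sigma_0,\sigma_1)$ is the extended affine root system $BC_\ell^{(2,2)}(1)$: $$R=\{\alpha+m\delta_0+n\delta_1\mid\alpha\in R(B_\ell),\ m,n\in\mathbb Z\}\cup\{\alpha+(2m+1)\delta_0+2n\delta_1\mid\alpha\in R(C_\ell)\text{ long},\ m,n\in\mathbb Z\}.$$ Here $R(B_\ell)$ is the root system of $\dot{\mathfrak g}_{(\overline0,\overline0)}$ with respect to its Cartan subalgebra $\dot{\mathfrak h}_{\overline0}$, and the long roots of $R(C_\ell)$ are the elements $2\alpha$ with $\alpha\in R(B_\ell)$ 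short.
   Context: For $\ell=1$ all roots of $B_1=A_1$ are regarded as short. $E_{ij}$ are matrix units and $\mathrm{Ad}(A)(X)=AXA^{-1}$. Work over $\mathbb C$. Let $\dot{\mathfrak g}$ be a simple finite-dimensional Lie algebra with Killing form $(\cdot,\cdot)$, and $\sigma_0,\sigma_1$ commuting automorphisms of finite orders $n_0,n_1$ (order 1 allowed). Put $\epsilon_j=\exp(2\pi i/n_j)$ and, for $p,q\in\mathbb Z$, $\dot{\mathfrak g}_{(\overline p,\overline q)}=\{g\in\dot{\mathfrak g}\mid\sigma_0(g)=\epsilon_0^p g,\ \sigma_1(g)=\epsilon_1^q g\}$, where $\overline p=p \bmod n_0$, $\overline q=q\bmod n_1$. Let $\mathcal R=\mathbb C[t_0^{\pm1},t_1^{\pm1}]$, $\mathcal K=\Omega^1_{\mathcal R}/d\mathcal R$, $k_i=t_i^{-1}dt_i$, and let $\mathcal K(\Sigma)\subset\mathcal K$ be spanned by the elements $t_0^{n_0a}t_1^{n_1b}k_i$ ($a,b\in\mathbb Z$, $i=0,1$). The twisted 2-toroidal Lie algebra is $$\mathfrak g(\sigma_0,\sigma_1)=\bigoplus_{m,n\in\mathbb Z}\dot{\mathfrak g}_{(\overline m,\overline n)}\otimes t_0^mt_1^n\ \oplus\ \mathcal K(\Sigma)\ \oplus\ \mathbb Cd_0\oplus\mathbb Cd_1,$$ with bracket $[g_1\otimes f_1,g_2\otimes f_2]=[g_1,g_2]\otimes f_1f_2+(g_1,g_2)f_2\,df_1$; $\mathcal K(\Sigma)$ commutes with itself and with all $g\otimes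 f$; $d_j=t_j\partial/\partial t_j$ acts by $[d_j,g\otimes t_0^{r_0}t_1^{r_1}]=r_j\,g\otimes t_0^{r_0}t_1^{r_1}$, $[d_j,t_0^{r_0}t_1^{r_1}k_i]=r_j\,t_0^{r_0}t_1^{r_1}k_i$; and $[d_0,d_1]=0$. Let $\dot{\mathfrak h}_{\overline 0}$ be a Cartan subalgebra of the reductive algebra $\dot{\mathfrak g}_{(\overline 0,\overline 0)}$ and $\mathfrak h=\dot{\mathfrak h}_{\overline 0}\oplus\mathbb Cd_0\oplus\mathbb Cd_1\oplus\mathbb Ck_0\oplus\mathbb Ck_1$. Elements of $\dot{\mathfrak h}_{\overline 0}^*$ are extended to $\mathfrak h$ by $0$ on all $d_i,k_i$; $\delta_i\in\mathfrak h^*$ is defined by $\delta_i(d_j)=\delta_{ij}$ and zero on $\dot{\mathfrak h}_{\overline 0}$ and all $k_j$. Let $V=\dot{\mathfrak h}_{\overline 0}^*\oplus\mathbb C\delta_0\oplus\mathbb C\delta_1$ with the bilinear form $(\cdot,\cdot)_V$ which on $\dot{\mathfrak h}_{\overline 0}^*$ is dual to the restriction of the Killing form to $\dot{\mathfrak h}_{\overline 0}$ and has $\delta_0,\delta_1$ in its radical. Then $R$ is the set of $\beta\in V$ with $(\beta,\beta)_V\ne0$ whose weight space in $\mathfrak g(\sigma_0,\sigma_1)$ under the adjoint action of $\mathfrak h$ is nonzero. *)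

(* Defs.v *)
From HB Require Import structures.
From mathcomp Require Import all_boot all_order all_algebra.
From mathcomp Require Import generic_quotient ring_quotient complex.
From mathcomp Require Import all_classical all_reals all_analysis.

Set Implicit Arguments.
Unset Strict Implicit.
Unset Printing Implicit Defensive.

Import Order.TTheory GRing.Theory Num.Theory.
Local Open Scope classical_set_scope.
Local Open Scope quotient_scope.
Local Open Scope ring_scope.

(** A Lie algebra is a subspace [a : {vspace 'M[F]_N}] closed under the
    commutator; a module over it is a subspace stable under [lie x], [x \in a]. *)

Definition lie (F : fieldType) N (x y : 'M[F]_N) : 'M[F]_N := x *m y - y *m x.

Definition lie_prod (F : fieldType) N (U W : {vspace 'M[F]_N}) :
    {vspace 'M[F]_N} :=
  <<[seq lie x y | x <- vbasis U, y <- vbasis W]>>%VS.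

Definition lie_simple (F : fieldType) N (a : {vspace 'M[F]_N}) : Prop :=
  [/\ (lie_prod a a <= a)%VS, lie_prod a a != 0%VS &
      forall I : {vspace 'M[F]_N}, (I <= a)%VS -> (lie_prod a I <= I)%VS ->
        I = 0%VS \/ I = a].

(** The trace of [ad x \o ad y] on [a], computed in a basis of [a]. *)
Definition killing (F : fieldType) N (a : {vspace 'M[F]_N}) (x y : 'M[F]_N) : F :=
  \sum_(i < \dim a) coord (vbasis a) i (lie x (lie y (vbasis a)`_i)).

Definition lie_nilpotent (F : fieldType) N (h : {vspace 'M[F]_N}) : Prop :=
  exists k, iter k (lie_prod h) h = 0%VS.

Definition cartan (F : fieldType) N (a h : {vspace 'M[F]_N}) : Prop :=
  [/\ (h <= a)%VS, (lie_prod h h <= h)%VS, lie_nilpotent h &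
      forall x, x \in a -> (forall y, y \in h -> lie x y \in h) -> x \in h].

Definition lmod_iso (F : fieldType) N (a U W : {vspace 'M[F]_N}) : Prop :=
  exists f : 'End('M[F]_N),
    [/\ {in a & U, forall x u, f (lie x u) = lie x (f u)},
        (U :&: lker f)%VS = 0%VS & (f @: U)%VS = W].

Definition lmod_irreducible (F : fieldType) N (a U : {vspace 'M[F]_N}) : Prop :=
  [/\ (lie_prod a U <= U)%VS, U != 0%VS &
      forall W : {vspace 'M[F]_N}, (W <= U)%VS -> (lie_prod a W <= W)%VS ->
        W = 0%VS \/ W = U].

Definition dual (F : fieldType) N (h : {vspace 'M[F]_N}) : vectType F :=
  'Hom(subvs_of h, F^o).

Definition lie_roots (F : fieldType) N (a h : {vspace 'M[F]_N}) :
    set (dual h) :=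
  [set al | al != 0 /\ exists x, [/\ x \in a, x != 0 &
     forall y : subvs_of h, lie (vsval y) x = (al y : F) *: x]].

(** The bilinear form on [h^*] dual to the restriction to [h] of the Killing
    form of [g]: [form_rep g al] is the vector of [h] that represents [al]. *)
Definition form_rep (F : fieldType) N (g h : {vspace 'M[F]_N}) (al : dual h) :
    subvs_of h :=
  xget 0 [set t | forall y : subvs_of h,
                    (al y : F) = killing g (vsval t) (vsval y)].

Definition dual_form (F : fieldType) N (g h : {vspace 'M[F]_N})
    (al be : dual h) : F :=
  killing g (vsval (form_rep g al)) (vsval (form_rep g be)).

Arguments lie_roots {F N} a h.
Arguments dual_form {F N} g h al be.

(** Standard model of [B_l]: the vectors [± e_i] and [± e_i ± e_j] for [i < j],
    where [e] is a basis.  A linear isomorphism carrying one root system onto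
    another automatically preserves Cartan integers. *)
Definition root_type_B (F : fieldType) (V : vectType F) l (Phi : set V) : Prop :=
  exists e : l.-tuple V, basis_of fullv e /\
    Phi = [set al | (exists (i : 'I_l) (b : bool), al = (-1) ^+ b *: tnth e i) \/
                    (exists (i j : 'I_l) (b c : bool), (i < j)%N /\
                       al = (-1) ^+ b *: tnth e i + (-1) ^+ c *: tnth e j)].

Definition lie_type_B (F : fieldType) N l (a : {vspace 'M[F]_N}) : Prop :=
  [/\ lie_simple a, (exists h, cartan a h) &
      forall h, cartan a h -> root_type_B l (lie_roots a h)].

(** Short = of minimal length; if all the roots have the same length, as in
    [B_1 = A_1], then they are all short.  The lengths are real numbers, on which
    the partial order of [F] restricts to the usual one. *)
Definition short_roots (F : numFieldType) N (g a h : {vspace 'M[F]_N}) :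
    set (dual h) :=
  [set al | lie_roots a h al /\
     forall be, lie_roots a h be ->
       dual_form g h al al <= dual_form g h be be].

Arguments short_roots {F N} g a h.

(** The long roots of [R(C_l)] attached to the root system [R(B_l)] of [a]. *)
Definition long_roots_C (F : numFieldType) N (g a h : {vspace 'M[F]_N}) :
    set (dual h) :=
  [set 2%:R *: al | al in short_roots g a h].

Arguments long_roots_C {F N} g a h.

(** [laurent V] is [V \otimes F[t_0^{±1}, t_1^{±1}]], its elements being
    the families of coefficients [(m, n) |-> v_{m,n}] of finite support. *)

Notation Z2 := (int * int)%type.

Definition fin_supp (F : fieldType) (V : lmodType F) : {pred (Z2 -> V)} :=
  fun f => `[< finite_set [set r | f r != 0] >].

Lemma fin_suppP (F : fieldType) (V : lmodType F) (f : Z2 -> V) :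
  reflect (finite_set [set r | f r != 0]) (f \in @fin_supp F V).
Proof. exact: asboolP. Qed.

Lemma fin_supp_submod (F : fieldType) (V : lmodType F) :
  submod_closed (@fin_supp F V).
Proof.
split=> [|a f g /fin_suppP f0 /fin_suppP g0]; apply/fin_suppP.
  by apply: (@sub_finite_set _ _ set0) => //= r /=; rewrite eqxx.
apply: (@sub_finite_set _ _ ([set r | f r != 0] `|` [set r | g r != 0])).
  move=> r /=; have [fr nz|] := eqVneq (f r) 0; last by left.
  by right; apply: contraNneq nz => gr; rewrite !fctE fr gr scaler0 addr0.
by rewrite finite_setU.
Qed.

HB.instance Definition _ (F : fieldType) (V : lmodType F) :=
  GRing.isSubmodClosed.Build F (Z2 -> V) (@fin_supp F V) (@fin_supp_submod F V).

Record laurent (F : fieldType) (V : lmodType F) :=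
  Laurent { coefL :> Z2 -> V ; _ : coefL \in @fin_supp F V }.

HB.instance Definition _ (F : fieldType) (V : lmodType F) :=
  [isSub for @coefL F V].
HB.instance Definition _ (F : fieldType) (V : lmodType F) :=
  [Choice of laurent V by <:].
HB.instance Definition _ (F : fieldType) (V : lmodType F) :=
  [SubChoice_isSubLmodule of laurent V by <:].

Lemma fin_supp_sub (F : fieldType) (V W : lmodType F) (f : laurent V)
    (g : Z2 -> W) :
  (forall r, f r = 0 -> g r = 0) -> g \in @fin_supp F W.
Proof.
case: f => f /= /fin_suppP ff fg; apply/fin_suppP.
by apply: sub_finite_set ff => r /=; apply: contra_neq; exact: fg.
Qed.

Lemma monoL_subproof (F : fieldType) (V : lmodType F) (r : Z2) (v : V) :
  (fun s => if s == r then v else 0) \in @fin_supp F V.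
Proof.
apply/fin_suppP/(@sub_finite_set _ _ [set r]) => // s /=.
by case: (s =P r) => //; rewrite eqxx.
Qed.

(** [monoL (m, n) v] is [v \otimes t_0^m t_1^n]. *)
Definition monoL (F : fieldType) (V : lmodType F) (r : Z2) (v : V) : laurent V :=
  Laurent (monoL_subproof r v).

(** The derivations [t_0 d/dt_0] ([j = false]) and [t_1 d/dt_1] ([j = true]). *)
Definition expo (r : Z2) (j : bool) : int := if j then r.2 else r.1.

Lemma degL_subproof (F : fieldType) (V : lmodType F) (j : bool)
    (f : laurent V) :
  (fun r => (expo r j)%:~R *: f r) \in @fin_supp F V.
Proof. by apply: (@fin_supp_sub F V V f) => r ->; rewrite scaler0. Qed.

Definition degL (F : fieldType) (V : lmodType F) (j : bool) (f : laurent V) :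
    laurent V :=
  Laurent (degL_subproof j f).

(** [Omega^1] of the Laurent polynomial ring is free on [k_i = t_i^{-1} dt_i],
    [i = 0, 1]: the coefficient [(a, b)] at [r] stands for
    [t^r (a k_0 + b k_1)].  In these terms [d(t^r) = t^r (r_0 k_0 + r_1 k_1)]. *)

Notation F2 F := (F^o * F^o)%type.

(** [t^{-r} d(t^r)]. *)
Definition dlog (F : fieldType) (r : Z2) : F2 F := (r.1%:~R, r.2%:~R).

Notation Omega F := (laurent (F2 F)).

Lemma dL_subproof (F : fieldType) (f : laurent F^o) :
  (fun r => (f r : F) *: dlog F r) \in @fin_supp F (F2 F).
Proof. by apply: (@fin_supp_sub F F^o (F2 F) f) => r ->; rewrite scale0r. Qed.

Definition dL (F : fieldType) (f : laurent F^o) : Omega F :=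
  Laurent (dL_subproof f).

Definition exact_form (F : fieldType) : {pred (Omega F)} :=
  fun w => `[< exists f : laurent F^o, w = dL f >].

Lemma exact_form_submod (F : fieldType) : submod_closed (@exact_form F).
Proof.
split=> [|a _ _ /asboolP[f ->] /asboolP[g ->]]; apply/asboolP.
  by exists 0; apply/val_inj/funext => r /=; rewrite scale0r.
exists (a *: f + g); apply/val_inj/funext => r /=.
by rewrite !fctE /= scalerDl scalerA.
Qed.

HB.instance Definition _ (F : fieldType) :=
  GRing.isSubmodClosed.Build F (Omega F) (@exact_form F)
    (exact_form_submod F).

Definition Kahler (F : fieldType) := Quotient.quot (@exact_form F).

HB.instance Definition _ (F : fieldType) := GRing.Zmodule.on (Kahler F).

Definition class (F : fieldType) (w : Omega F) : Kahler F :=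
  \pi_(Quotient.quot (@exact_form F)) w.

Lemma classP (F : fieldType) (v w : Omega F) :
  reflect (class v = class w) (v - w \in @exact_form F).
Proof. by rewrite Quotient.idealrBE; exact: eqP. Qed.

Lemma class_repr (F : fieldType) (c : Kahler F) : class (repr c) = c.
Proof. exact: reprK. Qed.

Lemma classD (F : fieldType) (v w : Omega F) :
  class (v + w) = class v + class w.
Proof. by rewrite /class Quotient.pi_add. Qed.

Definition scaleK (F : fieldType) (a : F) (c : Kahler F) : Kahler F :=
  class (a *: repr c).

Lemma scaleK_class (F : fieldType) (a : F) (w : Omega F) :
  scaleK a (class w) = class (a *: w).
Proof. by apply/classP; rewrite -scalerBr rpredZ //; apply/classP/class_repr. Qed.

Lemma scaleKA (F : fieldType) (a b : F) (c : Kahler F) :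
  scaleK a (scaleK b c) = scaleK (a * b) c.
Proof. by rewrite -[c]class_repr !scaleK_class scalerA. Qed.

Lemma scale1K (F : fieldType) : left_id 1 (@scaleK F).
Proof. by move=> c; rewrite -[c]class_repr scaleK_class scale1r. Qed.

Lemma scaleKDr (F : fieldType) : right_distributive (@scaleK F) +%R.
Proof.
move=> a c c'; rewrite -[c]class_repr -[c']class_repr -classD !scaleK_class.
by rewrite scalerDr classD.
Qed.

Lemma scaleKDl (F : fieldType) (c : Kahler F) :
  {morph (@scaleK F)^~ c : a b / a + b}.
Proof.
by move=> a b; rewrite -[c]class_repr !scaleK_class scalerDl classD.
Qed.

HB.instance Definition _ (F : fieldType) :=
  GRing.Zmodule_isLmodule.Build F (Kahler F)
    (@scaleKA F) (@scale1K F) (@scaleKDr F) (@scaleKDl F).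

(** Since [t_j d/dt_j] maps exact forms to exact forms, it acts on [Kahler]. *)
Definition degK (F : fieldType) (j : bool) (c : Kahler F) : Kahler F :=
  class (degL j (repr c)).

Lemma degK_class (F : fieldType) (j : bool) (w : Omega F) :
  degK j (class w) = class (degL j w).
Proof.
apply/classP; set v := repr _.
have /classP/asboolP[f vwE] : class v = class w by exact: class_repr.
apply/asboolP; exists (degL j f); apply/val_inj/funext => r /=.
have /(congr1 (fun u : Omega F => u r)) /= vwr := vwE.
rewrite !fctE /= in vwr *.
by rewrite -scalerBr vwr scalerA.
Qed.

(** [\dot g \otimes R \oplus K \oplus (C d_0 \oplus C d_1)], for the full matrix
    space in place of [\dot g]. *)
Definition toroidal (F : fieldType) (N : nat) : Type :=
  (laurent 'M[F]_N * Kahler F * F2 F)%type.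

(** The bracket, where [(.,.)] is the Killing form of [g]. *)
Definition tbracket (F : fieldType) (N : nat) (g : {vspace 'M[F]_N})
    (x y : toroidal F N) : toroidal F N :=
  let: (x1, xk, (x_d0, x_d1)) := x in let: (y1, yk, (y_d0, y_d1)) := y in
  (\sum_(p \in [set: Z2]) \sum_(q \in [set: Z2])
       monoL (p + q) (lie (x1 p) (y1 q))
     + ((x_d0 : F) *: degL false y1 + (x_d1 : F) *: degL true y1)
     - ((y_d0 : F) *: degL false x1 + (y_d1 : F) *: degL true x1),
   \sum_(p \in [set: Z2]) \sum_(q \in [set: Z2])
       killing g (x1 p) (y1 q) *: class (monoL (p + q) (dlog F p))
     + ((x_d0 : F) *: degK false yk + (x_d1 : F) *: degK true yk)
     - ((y_d0 : F) *: degK false xk + (y_d1 : F) *: degK true xk),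
   0).

Section AutomorphismPair.
Variables (R : realType) (N : nat) (g : {vspace 'M[R[i]]_N}).

Definition is_aut_order (s : 'End('M[R[i]]_N)) (n : nat) : Prop :=
  [/\ (0 < n)%N, {in g, forall x, iter n s x = x} &
      forall m, (0 < m)%N -> {in g, forall x, iter m s x = x} -> (n <= m)%N].

(** The order of [s] as an automorphism of [g] (0 if it is infinite). *)
Definition aut_order (s : 'End('M[R[i]]_N)) : nat := xget 0 (is_aut_order s).

(** [exp(2 pi i / n)] *)
Definition eps (n : nat) : R[i] :=
  Complex (cos (2 * pi / n%:R)) (sin (2 * pi / n%:R)).

Variables s0 s1 : 'End('M[R[i]]_N).

(** [\dot g_{(p, q)}], for integers [p] and [q] that matter only modulo the
    orders of [s0] and [s1]. *)
Definition component (p q : int) : {vspace 'M[R[i]]_N} :=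
  (g :&: passmx.leigenspace s0 (eps (aut_order s0) ^ p)
     :&: passmx.leigenspace s1 (eps (aut_order s1) ^ q))%VS.

Definition in_span (V : lmodType R[i]) (S : set V) (v : V) : Prop :=
  exists (n : nat) (a : 'I_n -> R[i]) (w : 'I_n -> V),
    (forall i, S (w i)) /\ v = \sum_(i < n) a i *: w i.

(** The generators [t_0^{n_0 a} t_1^{n_1 b} k_i] of [K(Sigma)], where [k_0] and
    [k_1] are encoded by [(1, 0)] and [(0, 1)]. *)
Definition KSigma_gen : set (Kahler R[i]) :=
  [set c | exists a b : int,
     let r := ((aut_order s0)%:Z * a, (aut_order s1)%:Z * b) in
     c = class (monoL r ((1, 0) : F2 R[i])) \/
     c = class (monoL r ((0, 1) : F2 R[i]))].

(** The subspace [g(s0, s1)] of the full toroidal Lie algebra. *)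
Definition twisted_toroidal : set (toroidal R[i] N) :=
  [set x : toroidal R[i] N | (forall m n : int, x.1.1 (m, n) \in component m n) /\
           in_span KSigma_gen x.1.2].

Variable h : {vspace 'M[R[i]]_N}.

(** [(y, (a, b), (c, d))] stands for [y + a k_0 + b k_1 + c d_0 + d d_1] in
    [h \oplus C k_0 \oplus C k_1 \oplus C d_0 \oplus C d_1]. *)
Definition full_cartan : Type :=
  (subvs_of h * F2 R[i] * F2 R[i])%type.

Definition full_cartan_val (y : full_cartan) : toroidal R[i] N :=
  (monoL 0 (vsval y.1.1), class (monoL 0 y.1.2), y.2).

(** [(al, (a, b))] stands for [al + a delta_0 + b delta_1]. *)
Definition Vspace : Type := (dual h * F2 R[i])%type.

Definition Vemb (al : dual h) : Vspace := (al, 0).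
Definition delta0 : Vspace := (0, (1, 0)).
Definition delta1 : Vspace := (0, (0, 1)).

Definition Veval (be : Vspace) (y : full_cartan) : R[i] :=
  (be.1 y.1.1 : R[i]) + be.2.1 * y.2.1 + be.2.2 * y.2.2.

Definition Vform (be ga : Vspace) : R[i] := dual_form g h be.1 ga.1.

Definition nonisotropic_roots : set Vspace :=
  [set be | Vform be be != 0 /\
     exists x, [/\ twisted_toroidal x, x != 0 &
       forall y, tbracket g (full_cartan_val y) x = Veval be y *: x]].

(** The extended affine root system [BC_l^{(2,2)}(1)], where [a] is a Lie algebra
    of type [B_l] with Cartan subalgebra [h]. *)
Definition BC22_1 (a : {vspace 'M[R[i]]_N}) : set Vspace :=
  [set be | exists (al : dual h) (m n : int), lie_roots a h al /\
     be = Vemb al + m%:~R *: delta0 + n%:~R *: delta1] `|`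
  [set be | exists (al : dual h) (m n : int), long_roots_C g a h al /\
     be = Vemb al + (2 * m + 1)%:~R *: delta0 + (2 * n)%:~R *: delta1].

End AutomorphismPair.

Arguments component {R N} g s0 s1 p q.
Arguments nonisotropic_roots {R N} g s0 s1 h.
Arguments BC22_1 {R N} g h a.

Definition skew_matrices (F : fieldType) (N : nat) : {vspace 'M[F]_N} :=
  lker (linfun (@trmx F N N) + \1)%VF.

Lemma skew_matricesP (F : fieldType) (N : nat) (X : 'M[F]_N) :
  reflect (X^T = - X) (X \in skew_matrices F N).
Proof.
rewrite memv_ker add_lfunE id_lfunE lfunE /= addr_eq0.
exact: eqP.
Qed.

Definition Ad (F : fieldType) (N : nat) (A : 'M[F]_N) : 'End('M[F]_N) :=
  linfun (mulmxr (invmx A) \o mulmx A).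

Lemma AdE (F : fieldType) (N : nat) (A X : 'M[F]_N) :
  Ad A X = A *m X *m invmx A.
Proof. by rewrite lfunE. Qed.

(** [munit i j] is [E_{i,j}], where rows and columns are numbered from 1. *)
Definition munit (F : fieldType) (N i j : nat) : 'M[F]_N :=
  \matrix_(r < N, c < N) ((r.+1 == i) && (c.+1 == j))%:R.

Definition sigma0 (F : fieldType) (l : nat) : 'End('M[F]_(4 * l + 2)) :=
  Ad (\sum_(1 <= i < (2 * l + 1).+1)
        (munit F (4 * l + 2) i i
         - munit F (4 * l + 2) (2 * l + 1 + i) (2 * l + 1 + i))).

Definition sigma1 (F : fieldType) (l : nat) : 'End('M[F]_(4 * l + 2)) :=
  Ad (\sum_(1 <= i < (4 * l + 2).+1)
        (-1) ^+ i *: munit F (4 * l + 2) i (4 * l + 3 - i)).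

(* Main.v *)
(** Conjugation by the two matrices identifies [so(4l+2)], with its two commuting
    involutions, with [so(n) (+) so(n)' (+) so(n)'' (+) Sym_n], [n = 2l+1]: every
    joint eigenvector is [iota S * K], where [iota S = diag(S, Q S Q)] for the
    antidiagonal [Q], [K] commutes with [iota], and [S] is skew except in degree
    [(1, 0)], where it is symmetric.  The weights of skew and symmetric matrices
    are the [w_i + w_j], with [i <> j] in the skew case, so [2 e_k] occurs only in
    degree [(odd, even)].

    For an arbitrary Cartan subalgebra [h] of [so(n)], the Jordan-Chevalley parts of
    the elements of [h] stay in [h], and Engel's theorem shows that [h] is the
    centralizer of its set [T] of diagonalizable elements.  Let [u_i] be a basis of
    common eigenvectors of [T].  The elements [u^T v - v^T u] of this centralizer
    satisfy [x^3 = c x], hence are again in [T] if [c <> 0]; this forces the weights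
    of the [u_i] to be distinct, and [h] is conjugate to [diag(0, d, -d)].

    Submodules of [n] x [n] matrices, [n] odd, are stable under conjugation by
    diagonal sign matrices, because that is a polynomial in the [(ad F_ij)^2]; this
    isolates single entries and gives simplicity and irreducibility. *)

From HB Require Import structures.
Require Import Defs.
From mathcomp Require Import all_boot all_order all_algebra.
From mathcomp Require Import fingroup perm ring zify.
From mathcomp Require Import all_classical all_reals all_analysis.
From mathcomp Require Import complex.
Set Implicit Arguments.
Unset Strict Implicit.
Unset Printing Implicit Defensive.
Import Order.TTheory GRing.Theory Num.Theory.
Local Open Scope ring_scope.

(** * Lie algebras of matrices *)

(** The statement quantifies over every nilpotent self-normalizing [h], so computing with one chosen
    torus would not suffice. What is proved of [h] is the existence of an invertible [P] whose rows
    are common eigenvectors with eigenvalues 0, d, -d. This [P] is not normalized to be orthogonal,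
    so [P S P^-1] need not keep the symmetry type of [S]. [P S P^T] does, and if [A] is skew with
    [P A = D P], then [P [A, S] P^T = D z + z D] for [z = P S P^T]. This is why weights are sums of
    two eigenvalues, and why the diagonal of [z], zero for skew [S], is what carries the weights 2
    e_k and -2 e_k. The indexing by 1 + (l + l) follows the eigenvalues 0, d, -d. In the toroidal
    algebra, [K] and the span of d_0, d_1 have finite weight zero. The form sees only the finite
    part of a weight, so a non-isotropic root has nonzero finite part, its root vectors have no
    component there, and it reduces to a weight of one graded component. *)

Section Lie.
Variables (F : fieldType) (N : nat).
Implicit Types (x y z : 'M[F]_N) (U W : {vspace 'M[F]_N}).

Lemma lie_is_linear x : linear (lie x).
Proof.
move=> c y z; rewrite /lie mulmxDr mulmxDl -scalemxAl -scalemxAr.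
by rewrite scalerBr opprD addrACA.
Qed.

HB.instance Definition _ x := GRing.isLinear.Build F _ _ _ (lie x) (lie_is_linear x).

Lemma lieC x y : lie x y = - lie y x.
Proof. by rewrite /lie opprB. Qed.

Lemma lieDl x y z : lie (x + y) z = lie x z + lie y z.
Proof. by rewrite /lie mulmxDr mulmxDl opprD addrACA. Qed.

Lemma lieZl c x z : lie (c *: x) z = c *: lie x z.
Proof. by rewrite /lie -scalemxAl -scalemxAr -scalerBr. Qed.

Lemma lie_suml I (r : seq I) (P : pred I) (f : I -> 'M[F]_N) z :
  lie (\sum_(i <- r | P i) f i) z = \sum_(i <- r | P i) lie (f i) z.
Proof.
rewrite lieC raddf_sum /= -sumrN.
by apply: eq_bigr => i _; rewrite -lieC.
Qed.

Lemma lie_jacobi x y z : lie x (lie y z) = lie (lie x y) z + lie y (lie x z).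
Proof.
rewrite /lie !mulmxBl !mulmxBr !mulmxA.
move: (x *m y *m z) (x *m z *m y) (y *m z *m x) => a b c.
move: (z *m y *m x) (y *m x *m z) (z *m x *m y) => d e f.
by apply/matrixP => i j; rewrite !mxE; ring.
Qed.

Lemma lie_prodP U W (Z : {vspace 'M[F]_N}) :
  (lie_prod U W <= Z)%VS <-> (forall x y, x \in U -> y \in W -> lie x y \in Z).
Proof.
split=> [/subvP sub x y xU yW|H].
  rewrite (coord_vbasis xU) (coord_vbasis yW) lie_suml memv_suml // => i _.
  rewrite raddf_sum memv_suml //= => j _; rewrite lieZl linearZ /=.
  do 2 apply: memvZ; apply/sub/memv_span/allpairsP.
  by exists ((vbasis U)`_i, (vbasis W)`_j); split; rewrite // mem_nth ?size_tuple.
apply/span_subvP => _ /allpairsP[[x y] /= [xU yW ->]].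
by apply: H; rewrite vbasis_mem.
Qed.

Lemma mem_lie_prod U W x y : x \in U -> y \in W -> lie x y \in lie_prod U W.
Proof. by move: x y; apply/lie_prodP; rewrite subvv. Qed.

Lemma mem_iter_lie_prod U x y k :
  x \in U -> y \in U -> iter k (lie x) y \in iter k (lie_prod U) U.
Proof. by move=> xU yU; elim: k => //= k IH; apply: mem_lie_prod. Qed.

End Lie.

Lemma iter_additive0 (V : zmodType) (f : {additive V -> V}) k : iter k f 0 = 0.
Proof. by elim: k => //= k ->; rewrite raddf0. Qed.

Lemma iter_additiveB (V : zmodType) (f : {additive V -> V}) k x y :
  iter k f (x - y) = iter k f x - iter k f y.
Proof. by elim: k => //= k ->; rewrite raddfB. Qed.

(** Induction on [a + b]: one application of [h = f - g] leads to [f y] and [g y], for which [a] or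
    [b] is smaller by one. It serves both for ad as a difference of left and right multiplication
    and for the ad of a difference of commuting matrices. *)
Lemma iter_sub_nilp (V : zmodType) (f g h : {additive V -> V}) a b y :
  (forall z, h z = f z - g z) -> (forall z, f (g z) = g (f z)) ->
  iter a f y = 0 -> iter b g y = 0 -> iter (a + b) h y = 0.
Proof.
move=> hE fg; have fgn c z : iter c g (f z) = f (iter c g z).
  by elim: c => //= c ->; rewrite fg.
have gfn c z : iter c f (g z) = g (iter c f z).
  by elim: c => //= c ->; rewrite fg.
have [m] := ubnP (a + b); elim: m a b y => // m IH [|a] [|b] y ltm /=.
- by move=> ->.
- by move=> -> _; rewrite -iterS iter_additive0.
- by move=> _ ->; rewrite -iterS iter_additive0.
move=> fy gy; rewrite -iterS iterSr hE iter_additiveB.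
have -> : iter (a + b.+1) h (f y) = 0.
  apply: IH; rewrite -?iterSr //.
  by rewrite fgn /= gy raddf0.
have -> : iter (a + b.+1) h (g y) = 0.
  rewrite -addSnnS; apply: IH; rewrite -?iterSr //.
    by rewrite addSnnS.
  by rewrite gfn /= fy raddf0.
by rewrite subrr.
Qed.

(** * The Jordan-Chevalley decomposition *)

(** Chinese remainder theorem. The semisimple part of a matrix will be [p] evaluated at it, so [p]
    must agree to high order with the constant [r] at each eigenvalue [r]. *)
Lemma poly_interpolation_pow (F : fieldType) (rs : seq F) m : uniq rs ->
  exists p : {poly F}, {in rs, forall r, ('X - r%:P) ^+ m %| p - r%:P}.
Proof.
elim: rs => [|r rs IH] /=; first by exists 0.
case/andP=> rNrs /IH[p pP].
pose q : {poly F} := \prod_(x <- rs) ('X - x%:P) ^+ m.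
have qcop : coprimep q (('X - r%:P) ^+ m).
  rewrite /q big_seq; elim/big_ind: _ => [|u v cu cv|x xrs].
  - exact: coprime1p.
  - by rewrite coprimepMl cu.
  apply: coprimep_expl; apply: coprimep_expr; apply: coprimep_XsubC2.
  by rewrite subr_eq0; apply: contraNneq rNrs => ->.
have /Bezout_eq1_coprimepP[[u v] /= uvE] := qcop.
(* By Bezout [u * q] is 1 modulo the new factor and 0 modulo the old ones, so the correction turns
   [p] into [r] at the new root alone. *)
exists (p + u * q * (r%:P - p)) => s; rewrite inE => /predU1P[->|srs].
  have -> : p + u * q * (r%:P - p) - r%:P = (p - r%:P) * v * ('X - r%:P) ^+ m.
    have -> : u * q = 1 - v * ('X - r%:P) ^+ m by rewrite -uvE addrK.
    by ring.
  exact: dvdp_mulIr.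
rewrite addrAC dvdp_add ?pP // mulrAC; apply: dvdp_mull.
by rewrite /q (big_rem s) //= dvdp_mulIl.
Qed.

Lemma diagonalizable_for_rowP (F : fieldType) n (P A : 'M[F]_n) : P \in unitmx ->
  reflect (exists d, P *m A = diag_mx d *m P) (diagonalizable_for P A).
Proof.
move=> Pu; apply: (iffP (diagonalizable_forP A Pu)) => [H|[d dE] i j ij].
  exists (\row_i (P *m A *m invmx P) i i).
  apply: (canRL (mulmxKV Pu)); apply/matrixP => i j; rewrite [RHS]mxE [X in X *+ _]mxE.
  by case: eqVneq => [->|/H->].
rewrite dE mulmxK // mxE (_ : (i == j) = false) ?mulr0n //; exact: negbTE.
Qed.

(** The characteristic polynomial has [m] linear factors, each dividing the squarefree [q], hence
    [q ^+ m] kills [A]. It divides the product of the [p - x], which makes [p(A)] diagonalizable,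
    and [q] divides ['X - p], which makes [A - p(A)] nilpotent. *)
Lemma jordan_chevalley (F : closedFieldType) n (A : 'M[F]_n.+1) :
  exists p : {poly F}, diagonalizable (horner_mx A p) /\
    exists m, (A - horner_mx A p) ^+ m = 0.
Proof.
have [rs] := closed_field_poly_normal (char_poly A).
rewrite (monicP (char_poly_monic A)) scale1r => charE.
pose m := size rs; pose us := undup rs.
pose q : {poly F} := \prod_(x <- us) ('X - x%:P).
have qmA : horner_mx A (q ^+ m) = 0.
  apply/mxminpoly_minP; apply: dvdp_trans (mxminpoly_dvd_char A) _.
  rewrite charE /m.
  have: {subset rs <= us} by move=> x; rewrite mem_undup.
  elim: (rs) => [|x s IH] sub; first by rewrite big_nil expr0.
  rewrite big_cons exprS dvdp_mul //; last first.
    by apply: IH => y ys; apply: sub; rewrite inE ys orbT.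
  by rewrite /q (big_rem x) ?dvdp_mulIl //; apply: sub; rewrite inE eqxx.
(* The exponent [m.+1] yields both the power [m] and the first power of each factor without a case
   distinction on [m]. *)
have [p pP] := poly_interpolation_pow m.+1 (undup_uniq rs).
exists p; split.
  apply/diagonalizableP; exists us; rewrite ?undup_uniq //.
  apply/mxminpoly_minP; rewrite -/q /q.
  have : q ^+ m %| \prod_(x <- us) (p - x%:P).
    rewrite /q big_seq [X in _ %| X]big_seq -prodrXl.
    elim/big_rec2: _ => [|x u v xus IH]; first exact: dvdpp.
    apply: dvdp_mul => //; apply: dvdp_trans (pP x xus).
    by rewrite exprS dvdp_mulIr.
  case/dvdpP=> w wE.
  have : horner_mx A (\prod_(x <- us) (p - x%:P)) = 0.
    by rewrite wE rmorphM /= qmA mulr0.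
  rewrite !rmorph_prod /= => E; rewrite -[RHS]E.
  by apply: eq_bigr => x _; rewrite !rmorphB /= horner_mx_X !horner_mx_C.
have qXp : q %| 'X - p.
  apply: uniq_roots_dvdp; last by rewrite uniq_rootsE undup_uniq.
  apply/allP => x xus; rewrite -dvdp_XsubCl.
  have -> : 'X - p = ('X - x%:P) - (p - x%:P) by ring.
  rewrite dvdp_sub //; apply: dvdp_trans (pP x xus).
  by rewrite exprS dvdp_mulIl.
exists m; have -> : A - horner_mx A p = horner_mx A ('X - p).
  by rewrite rmorphB /= horner_mx_X.
rewrite -rmorphXn /=; have /dvdpP[w ->] := dvdp_exp2r m qXp.
by rewrite rmorphM /= qmA mulr0.
Qed.

Lemma lie_diagE (F : fieldType) n (d : 'rV[F]_n) z i j :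
  lie (diag_mx d) z i j = (d 0 i - d 0 j) * z i j.
Proof. by rewrite /lie mul_diag_mx mul_mx_diag !mxE mulrBl [d 0 j * _]mulrC. Qed.

Lemma lie_conj (F : fieldType) n (P x y x' : 'M[F]_n) : P \in unitmx ->
  P *m x = x' *m P -> P *m lie x y *m invmx P = lie x' (P *m y *m invmx P).
Proof.
move=> Pu xE; rewrite /lie mulmxBr mulmxBl !mulmxA xE; congr (_ - _).
rewrite -[RHS]mulmxA; have -> : invmx P *m x' = x *m invmx P.
  by apply/esym/(canLR (mulmxK Pu)); rewrite -mulmxA -xE mulKmx.
by rewrite !mulmxA.
Qed.

(** In an eigenbasis [ad s] multiplies the entry (i, j) by [d_i - d_j], and a scalar with a
    vanishing power vanishes. *)
Lemma diagonalizable_ad_nilp (F : fieldType) n (s y : 'M[F]_n) k :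
  diagonalizable s -> iter k (lie s) y = 0 -> lie s y = 0.
Proof.
case=> P Pu /(diagonalizable_for_rowP _ Pu)[d dE] sy0.
pose z := P *m y *m invmx P.
have itE i j m : (P *m iter m (lie s) y *m invmx P) i j = (d 0 i - d 0 j) ^+ m * z i j.
  elim: m => [|m IH]; first by rewrite expr0 mul1r.
  by rewrite iterS (lie_conj _ Pu dE) lie_diagE IH exprS mulrA.
apply: (can_inj (mulKmx Pu)); apply: (can_inj (mulmxK (_ : invmx P \in _))).
  by rewrite unitmx_inv.
rewrite (lie_conj _ Pu dE) mulmx0 mul0mx; apply/matrixP => i j.
rewrite -/z lie_diagE [RHS]mxE; apply/eqP; rewrite mulf_eq0.
have := itE i j k; rewrite sy0 mulmx0 mul0mx [in LHS]mxE => /esym/eqP.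
rewrite mulf_eq0.
by rewrite expf_eq0 => /orP[/andP[_ ->]|->]; rewrite ?orbT.
Qed.

Lemma iter_mulmx (F : fieldType) n (a y : 'M[F]_n.+1) k :
  iter k (mulmx a) y = a ^+ k *m y.
Proof. by elim: k => [|k IH] /=; rewrite ?mul1mx // IH exprS mulmxA. Qed.

Lemma iter_mulmxr (F : fieldType) n (a y : 'M[F]_n.+1) k :
  iter k (mulmxr a) y = y *m a ^+ k.
Proof. by elim: k => [|k IH] /=; rewrite ?mulmx1 // IH exprSr mulmxA. Qed.

Lemma nilpotent_ad (F : fieldType) n (a y : 'M[F]_n.+1) k :
  a ^+ k = 0 -> iter (k + k) (lie a) y = 0.
Proof.
move=> ak; apply: (@iter_sub_nilp _ (mulmx a) (mulmxr a) (lie a)) => //.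
- by move=> z /=; rewrite mulmxA.
- by rewrite iter_mulmx ak mul0mx.
- by rewrite iter_mulmxr ak mulmx0.
Qed.

Lemma nilpotentB (F : fieldType) n (a b : 'M[F]_n.+1) k m :
  comm_mx a b -> a ^+ k = 0 -> b ^+ m = 0 -> (a - b) ^+ (k + m) = 0.
Proof.
move=> ab ak bm; rewrite -[LHS]mulmx1 -iter_mulmx.
apply: (@iter_sub_nilp _ (mulmx a) (mulmx b) (mulmx (a - b))).
- by move=> z /=; rewrite mulmxBl.
- by move=> z /=; rewrite !mulmxA ab.
- by rewrite iter_mulmx ak mul0mx.
- by rewrite iter_mulmx bm mul0mx.
Qed.

Lemma diagonalizable_tr (F : fieldType) n (a : 'M[F]_n) :
  diagonalizable a -> diagonalizable a^T.
Proof.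
case=> P Pu /(diagonalizable_for_rowP _ Pu)[d dE].
have Qu : invmx P^T \in unitmx by rewrite unitmx_inv unitmx_tr.
exists (invmx P^T) => //; apply/(diagonalizable_for_rowP _ Qu); exists d.
apply: (canLR (mulKmx _)); first by rewrite unitmx_tr.
rewrite mulmxA; apply: (canRL (mulmxK _)); first by rewrite unitmx_tr.
by rewrite -trmx_mul dE trmx_mul tr_diag_mx.
Qed.

Lemma diagonalizable_lin (F : fieldType) n (a b : 'M[F]_n) c : comm_mx a b ->
  diagonalizable a -> diagonalizable b -> diagonalizable (c *: a + b).
Proof.
move=> ab da db.
have /codiagonalizableP[P Pu /= /and3P[aP bP _]] :
    {in [:: a; b] &, forall f g, comm_mx f g} /\
    forall f, f \in [:: a; b] -> diagonalizable f.
  split=> [f g|f]; last by rewrite !inE => /orP[]/eqP->.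
  rewrite !inE => /orP[]/eqP-> /orP[]/eqP-> //.
exists P => //; apply/(diagonalizable_forP _ Pu) => i j ij.
rewrite mulmxDr mulmxDl -scalemxAr -scalemxAl mxE [X in X + _]mxE.
move/(diagonalizable_forP _ Pu): aP => /(_ i j ij) ->.
by move/(diagonalizable_forP _ Pu): bP => /(_ i j ij) ->; rewrite mulr0 addr0.
Qed.

Lemma lie_eq0 (F : fieldType) n (x y : 'M[F]_n) : lie x y = 0 <-> comm_mx x y.
Proof. by split=> [/eqP|xy]; rewrite /lie ?subr_eq0 ?xy ?subrr // => /eqP. Qed.

Lemma trmx_horner_mx (F : fieldType) n (x : 'M[F]_n.+1) p :
  (horner_mx x p)^T = horner_mx x^T p.
Proof.
elim/poly_ind: p => [|p c IH]; first by rewrite !rmorph0 trmx0.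
rewrite !rmorphD !rmorphM /= !horner_mx_X !horner_mx_C linearD /= tr_scalar_mx.
by rewrite trmx_mul IH; congr (_ + _); apply/esym/comm_horner_mx.
Qed.

(** The semisimple part [s = p(x)] need not be skew, so it is replaced by [(s - s^T) / 2]. As
    [x^T = -x], the transpose [s^T = p(-x)] is again a polynomial in [x]; everything commutes, so
    diagonalizability and nilpotency of the difference survive. *)
Lemma skew_jordan (F : closedFieldType) n (x : 'M[F]_n.+1) :
  (2%:R : F) != 0 -> x \in skew_matrices F n.+1 ->
  exists s, [/\ s \in skew_matrices F n.+1, diagonalizable s,
    exists m, (x - s) ^+ m = 0, (forall y, lie x y = 0 -> lie s y = 0) &
    forall k y, iter k (lie x) y = 0 -> lie s y = 0].
Proof.
move=> nz2 /skew_matricesP xT; have [p [sd [m nm]]] := jordan_chevalley x.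
set s := horner_mx x p in sd nm.
have sTE : s^T = horner_mx (- x) p by rewrite -xT trmx_horner_mx.
have xs y : comm_mx x y -> comm_mx s y by exact: comm_horner_mx.
have xsT y : comm_mx x y -> comm_mx s^T y.
  move=> xy; rewrite sTE; apply: comm_horner_mx.
  by rewrite /comm_mx mulNmx mulmxN xy.
have xx : comm_mx x x by [].
have xsTx := xsT _ xx; have xsx := xs _ xx.
have ssT : comm_mx s s^T by apply/xs/comm_mx_sym.
pose s' := 2%:R^-1 *: (s - s^T).
have xE : x - s' = 2%:R^-1 *: ((x - s) - (x - s)^T).
  apply/matrixP => i j; have /matrixP/(_ i j) := xT.
  rewrite /s'; move: (s) => u; rewrite !mxE => ->.
  by field.
have s'd : diagonalizable s'.
  have -> : s' = 2%:R^-1 *: s + (- 2%:R^-1 *: s^T + 0).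
    by rewrite addr0 scaleNr /s' scalerBr.
  apply: diagonalizable_lin => //; last first.
    apply: diagonalizable_lin; [|exact: diagonalizable_tr|exact: diagonalizable0].
    by rewrite /comm_mx mul0mx mulmx0.
  by rewrite addr0 /comm_mx -scalemxAr -scalemxAl ssT.
have s'c y : lie x y = 0 -> lie s' y = 0.
  move=> /lie_eq0 xy; rewrite /s' lieZl lieDl -scaleN1r lieZl.
  by rewrite !(lie_eq0 _ _).2 ?scaler0 ?addr0 ?scaler0 //; [apply: xsT|apply: xs].
have s'nil : exists k, (x - s') ^+ k = 0.
  exists (m + m)%N; rewrite xE exprZn nilpotentB ?scaler0 //; last first.
    have trX k (a : 'M[F]_n.+1) : (a ^+ k)^T = a^T ^+ k.
      elim: k => [|k IH]; first by rewrite !expr0 trmx1.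
      by rewrite exprS exprSr -IH; apply: trmx_mul.
    by rewrite -trX nm trmx0.
  rewrite [(x - s)^T]linearB /= xT; apply: comm_mxB.
    by apply/comm_mxN/comm_mx_sym; apply: comm_mxB => //; apply: comm_mx_sym.
  by apply: comm_mx_sym; apply: comm_mxB; apply: comm_mx_sym => //; exact: comm_mx_sym.
exists s'; split=> //.
  apply/skew_matricesP; rewrite /s' linearZ /= linearB /= trmxK -scalerN opprB //.
move=> k y xky; have [j xj] := s'nil.
(* On [y], [ad s'] is the difference of the commuting [ad x] and [ad (x - s')], both nilpotent
   there; being diagonalizable as well, it kills [y]. *)
apply: (@diagonalizable_ad_nilp _ _ _ _ (k + (j + j)) s'd).
apply: (@iter_sub_nilp _ (lie x) (lie (x - s')) (lie s')) xky _.
- by move=> z /=; rewrite lieDl -[- s']scaleN1r (lieZl (-1) s') scaleN1r subKr.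
- move=> z /=; rewrite lie_jacobi; suff -> : lie x (x - s') = 0.
    by rewrite /lie mul0mx mulmx0 subrr add0r.
  rewrite raddfB /= /lie subrr sub0r -/(lie _ _) lieC s'c ?oppr0 //.
  by rewrite /lie subrr.
- exact: nilpotent_ad.
Qed.

(** * Engel's theorem *)

(** A list adapted to a central series: [ad h] moves each entry into the span of the later ones. It
    turns the usual induction over ideals in Engel's theorem into an induction over a list. *)
Fixpoint ad_chain (F : fieldType) n (h : {vspace 'M[F]_n}) (s : seq 'M[F]_n) :=
  if s is z :: s' then
    [/\ z \in h, forall y, y \in h -> lie y z \in << s' >>%VS & ad_chain h s']
  else True.

Lemma nilpotent_ad_chain (F : fieldType) n (h : {vspace 'M[F]_n}) :
  (lie_prod h h <= h)%VS -> lie_nilpotent h ->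
  exists2 s, ad_chain h s & << s >>%VS = h.
Proof.
move=> hh [k hk0].
have hsub j : (iter j (lie_prod h) h <= h)%VS.
  elim: j => [|j IH] /=; first exact: subvv.
  by apply: subv_trans hh; apply/lie_prodP => x y xh /(subvP IH); apply: mem_lie_prod.
(* The list grows from the bottom of the lower central series: at stage [j] it spans the term of
   index [k - j]. *)
suff /(_ k (leqnn k)) [s cs] : forall j, (j <= k)%N ->
    exists2 s, ad_chain h s & << s >>%VS = iter (k - j) (lie_prod h) h.
  by rewrite subnn; exists s.
elim=> [_|j IH ltjk]; first by exists [::]; rewrite // subn0 hk0 span_nil.
have [s cs sE] := IH (ltnW ltjk).
set U := iter (k - j.+1) (lie_prod h) h.
have sU : (<< s >> <= U)%VS.
  rewrite sE -[X in (_ <= X)%VS]/(iter (k - j.+1) _ _) -(subnSK ltjk) /=.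
  elim: (k - j.+1)%N => [|i IHi] //=.
  apply/lie_prodP => x y xh yh; apply: mem_lie_prod => //.
  exact: (subvP IHi).
have sub z y : z \in U -> y \in h -> lie y z \in << s >>%VS.
  by move=> zU yh; rewrite sE -(subnSK ltjk) /=; apply: mem_lie_prod.
have vU : {subset (vbasis U : seq _) <= U} by move=> x /vbasis_mem.
exists (vbasis U ++ s); last first.
  rewrite span_cat (span_basis (vbasisP U)).
  exact/addv_idPl.
elim: (vbasis U : seq _) vU => //= z t IHt vU; split.
- by apply: (subvP (hsub (k - j.+1)%N)); apply: vU; rewrite inE eqxx.
- move=> y yh; apply: (subvP (_ : (<< s >> <= _)%VS)).
    by rewrite span_cat addvSr.
  by apply: sub => //; apply: vU; rewrite inE eqxx.
- by apply: IHt => y yt; apply: vU; rewrite inE yt orbT.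
Qed.

(* Engel's theorem for the action of [h] on [(C + h)/h]. *)
Lemma engel_normalizer (F : fieldType) n (h : {vspace 'M[F]_n})
    (C : 'M[F]_n -> Prop) :
  (lie_prod h h <= h)%VS -> lie_nilpotent h ->
  (forall y x, y \in h -> C x -> C (lie y x)) ->
  (forall y x, y \in h -> C x -> exists k, iter k (lie y) x \in h) ->
  (exists2 x, C x & x \notin h) ->
  exists x, [/\ C x, x \notin h & forall y, y \in h -> lie y x \in h].
Proof.
move=> hh hn hC Cn [x0 Cx0 x0h].
have [s cs sE] := nilpotent_ad_chain hh hn.
have hl x y : x \in h -> y \in h -> lie x y \in h by move/lie_prodP: hh; apply.
(* [M t] is the part of [C] that the entries of [t] bring into [h]. By the chain condition and the
   Jacobi identity it is stable under [h]. *)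
pose M (t : seq 'M[F]_n) x := C x /\ forall z, z \in t -> lie z x \in h.
suff [x [Cx xs] xh] : exists2 x, M s x & x \notin h.
  exists x; split=> // y; rewrite -[in y \in _]sE => /(@coord_span _ _ _ (in_tuple s))->.
  rewrite lie_suml memv_suml // => i _; rewrite lieZl memvZ //.
  by apply: xs; rewrite mem_nth.
have Mstab t : ad_chain h t -> forall y x, y \in h -> M t x -> M t (lie y x).
  elim: t => [_ y x yh [Cx _]|z t IH [zh zt ct] y x yh [Cx xt]].
    by split=> //; apply: hC.
  have [|Cyx yxt] := IH ct y x yh; first by split=> // w wt; rewrite xt // inE wt orbT.
  split=> // w; rewrite inE => /predU1P[->|]; last exact: yxt.
  rewrite lie_jacobi memvD //; last by rewrite hl // xt // inE eqxx.
  rewrite (lieC z y) -scaleN1r lieZl scaleN1r memvN.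
  have /(@coord_span _ _ _ (in_tuple t))-> := zt y yh.
  rewrite lie_suml memv_suml //= => i _.
  by rewrite lieZl memvZ //= xt // inE mem_nth ?orbT.
elim: s cs {sE} => [_|z t IH /= czt]; first by exists x0.
have [zh zt ct] := czt; have [x Mx xh] := IH ct.
have [k kP] : exists k, iter k (lie z) x \in h by apply: Cn => //; case: Mx.
have ex : exists k, iter k (lie z) x \in h by exists k.
(* The last iterate of [ad z] that is still outside [h] is brought into [h] by [z] too. *)
case: (ex_minnP ex) => -[|m] mh mmin; first by rewrite mh in xh.
have Mi j : M t (iter j (lie z) x) by elim: j => //= j; apply: Mstab.
exists (iter m (lie z) x); last by apply/negP => /mmin; rewrite ltnn.
have [Cm Mm] := Mi m; split=> // w; rewrite inE => /predU1P[->//|]; exact: Mm.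
Qed.

(** [T] may be infinite. A list is enlarged as long as an element of [T] lies outside its span,
    which bounds the length by the dimension; simultaneous diagonalization of all toral elements
    thereby reduces to a finite list. *)
Lemma spanning_seq (F : fieldType) (V : vectType F) (T : V -> Prop) :
  exists s : seq V, (forall x, x \in s -> T x) /\ forall x, T x -> x \in << s >>%VS.
Proof.
suff H k (s : seq V) : (\dim {:V} - \dim << s >> < k)%N -> (forall x, x \in s -> T x) ->
    exists s : seq V, (forall x, x \in s -> T x) /\ forall x, T x -> x \in << s >>%VS.
  by apply: (H _ [::] (ltnSn _)).
elim: k s => // k IH s lek sT.
have [all|/existsNP[x /not_implyP[Tx /negP xs]]] := EM (forall x, T x -> x \in << s >>%VS).
  by exists s.
apply: (IH (x :: s)); last by move=> y; rewrite inE => /predU1P[->|/sT].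
suff lt : (\dim << s >> < \dim <<x :: s>>)%N.
  rewrite -ltnS; apply: leq_trans lek; rewrite ltnS ltn_sub2l //.
  by apply: leq_trans lt (dimvS (subvf _)).
rewrite ltn_neqAle dimvS ?andbT; last first.
  by apply: sub_span => y ys; rewrite inE ys orbT.
apply: contra xs => /eqP dE.
have sub : (<< s >> <= <<x :: s>>)%VS by apply: sub_span => y ys; rewrite inE ys orbT.
have /eqP-> : (<< s >> == <<x :: s>>)%VS by rewrite eqEdim sub dE /=.
by rewrite memv_span // inE eqxx.
Qed.

(** * Cartan subalgebras of the skew matrices *)

Section Wedge.
Variables (F : fieldType) (n : nat).
Implicit Types u v w : 'rV[F]_n.

(** The bilinear form, without complex conjugation: nonzero vectors can be isotropic. *)
Definition dot u v : F := (u *m v^T) 0 0.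
(** The image of the bivector of [u] and [v] under the identification of the exterior square with
    the skew matrices. *)
Definition wedge u v : 'M[F]_n := u^T *m v - v^T *m u.

Lemma dotE u v : u *m v^T = (dot u v)%:M.
Proof. exact: mx11_scalar. Qed.

Lemma dotC u v : dot u v = dot v u.
Proof. by rewrite /dot -[u *m v^T]trmxK trmx_mul trmxK mxE. Qed.

Lemma dotDl u v w : dot (u + v) w = dot u w + dot v w.
Proof. by rewrite /dot mulmxDl mxE. Qed.

Lemma dotZl c u w : dot (c *: u) w = c * dot u w.
Proof. by rewrite /dot -scalemxAl mxE. Qed.

Lemma dotZr c u w : dot w (c *: u) = c * dot w u.
Proof. by rewrite dotC dotZl dotC. Qed.

Lemma dotBl u v w : dot (u - v) w = dot u w - dot v w.
Proof. by rewrite dotDl -scaleN1r dotZl mulN1r. Qed.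

Lemma dot_skew u v s : s \in skew_matrices F n -> dot (u *m s) v = - dot u (v *m s).
Proof. by move=> /skew_matricesP sT; rewrite /dot trmx_mul sT mulNmx mulmxN mulmxA [X in _
    = - X]mxE opprK. Qed.

Lemma wedge_skew u v : wedge u v \in skew_matrices F n.
Proof.
apply/skew_matricesP; rewrite /wedge [LHS]linearB /= !trmx_mul !trmxK opprB //.
Qed.

Lemma mul_wedge w u v : w *m wedge u v = dot w u *: v - dot w v *: u.
Proof. by rewrite /wedge mulmxBr !mulmxA !dotE !mul_scalar_mx. Qed.

Lemma lie_wedge s u v a b : s \in skew_matrices F n ->
  u *m s = a *: u -> v *m s = b *: v -> lie s (wedge u v) = - (a + b) *: wedge u v.
Proof.
move=> /skew_matricesP sT us vs.
have su w : s *m w^T = - (w *m s)^T by rewrite trmx_mul sT mulNmx opprK.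
rewrite /lie /wedge mulmxBr mulmxBl !mulmxA !su us vs -!mulmxA us vs.
rewrite -!scalemxAr !linearZ /= -?scalemxAl ?mulNmx -?scalemxAl.
move: (u^T *m v) (v^T *m u) => x y.
by apply/matrixP => i j; rewrite !mxE; ring.
Qed.

(** The image of the wedge lies in the span of [u] and [v], where it acts with trace zero; by
    Cayley-Hamilton its square there is minus the determinant, which is the scalar on the right. *)
Lemma wedge_cube u v :
  wedge u v *m wedge u v *m wedge u v =
    (dot u v ^+ 2 - dot u u * dot v v) *: wedge u v.
Proof.
apply/row_matrixP => i; rewrite !rowE -scalemxAr !mulmxA.
move: (delta_mx 0 i) => w; rewrite !mul_wedge !(dotBl, dotZl) (dotC v u).
by apply/matrixP => j k; rewrite !mxE; ring.
Qed.

End Wedge.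

(** For [c != 0] the polynomial [X^3 - c X] has the distinct roots 0, [r], [-r]. *)
Lemma wedge_diagonalizable (F : numClosedFieldType) n (u v : 'rV[F]_n.+1) :
  dot u v ^+ 2 != dot u u * dot v v -> diagonalizable (wedge u v).
Proof.
rewrite -subr_eq0; have := wedge_cube u v.
move: (wedge u v) (_ - _) => x c xE nzc.
pose r := sqrtC c; have rr : r ^+ 2 = c by rewrite sqrtCK.
have nzr : r != 0 by rewrite sqrtC_eq0.
apply/diagonalizableP; exists [:: 0; r; - r].
  rewrite /= !inE negb_or andbT [0 == r]eq_sym nzr [0 == - r]eq_sym oppr_eq0 nzr /=.
  by rewrite -subr_eq0 opprK -mulr2n mulrn_eq0 /=.
apply/mxminpoly_minP; rewrite !big_cons big_nil.
have -> : ('X - 0%:P) * (('X - r%:P) * (('X - (- r)%:P) * 1)) = 'X * 'X * 'X - c%:P * 'X.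
  by rewrite -rr rmorphXn rmorphN /=; ring.
rewrite rmorphB !rmorphM /= horner_mx_X horner_mx_C.
have -> : x * x * x = x *m x *m x by [].
by rewrite xE -mul_scalar_mx subrr.
Qed.

Lemma lie_skew (F : fieldType) n (x y : 'M[F]_n) :
  x \in skew_matrices F n -> y \in skew_matrices F n -> lie x y \in skew_matrices F n.
Proof.
move=> /skew_matricesP xT /skew_matricesP yT; apply/skew_matricesP.
by rewrite /lie [LHS]linearB /= !trmx_mul xT yT !mulNmx !mulmxN !opprK opprB.
Qed.

Section CartanSkew.
Variables (F : numClosedFieldType) (n : nat) (h : {vspace 'M[F]_n.+1}).
Let skew := skew_matrices F n.+1.
Hypothesis hC : cartan skew h.

Let hskew : (h <= skew)%VS. Proof. by case: hC. Qed.
Let hh : (lie_prod h h <= h)%VS. Proof. by case: hC. Qed.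
Let hnorm x : x \in skew -> (forall y, y \in h -> lie x y \in h) -> x \in h.
Proof. by case: hC => _ _ _; apply. Qed.

Definition toral s := s \in h /\ diagonalizable s.

Lemma cartan_ad_nilp x y : x \in h -> y \in h -> exists k, iter k (lie x) y = 0.
Proof.
case: hC => _ _ [k hk] _ xh yh; exists k; apply/eqP.
by rewrite -memv0 -hk mem_iter_lie_prod.
Qed.

Lemma toral_central s y : toral s -> y \in h -> lie s y = 0.
Proof.
case=> sh sd yh; have [k] := cartan_ad_nilp sh yh.
exact: diagonalizable_ad_nilp.
Qed.

(** For [y] in [h] some power of [ad x] kills [y], hence so does [ad s]. Thus [s] normalizes [h] and
    belongs to it. *)
Lemma cartan_jordan x : x \in h -> exists2 s, toral s & exists m, (x - s) ^+ m = 0.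
Proof.
move=> xh; have xs := subvP hskew _ xh.
have [|s [sS sd sm _ sn]] := skew_jordan _ xs; first by rewrite pnatr_eq0.
exists s => //; split=> //; apply: hnorm => // y yh.
have [k /sn->] := cartan_ad_nilp xh yh; exact: mem0v.
Qed.

(** If the centralizer of the toral elements were larger than [h], Engel's theorem would provide an
    element outside [h] that normalizes [h]. *)
Lemma cartan_centralizer x :
  x \in skew -> (forall s, toral s -> lie s x = 0) -> x \in h.
Proof.
pose C x := x \in skew /\ forall s, toral s -> lie s x = 0.
move=> xs xT; apply: contrapT => /negP xh.
have Cst y z : y \in h -> C z -> C (lie y z).
  move=> yh [zs zT]; split=> [|s sT]; first by apply: lie_skew => //; exact: (subvP hskew).
  by rewrite lie_jacobi (toral_central sT yh) (zT s) // /lie !mul0mx !mulmx0 !subr0 addr0.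
have Cn y z : y \in h -> C z -> exists k, iter k (lie y) z \in h.
  move=> yh Cz; have [s sT [m sm]] := cartan_jordan yh.
  (* The toral part [s] of [y] kills the centralizer, so [ad y] acts there as the nilpotent
     [ad (y - s)]. *)
  exists (m + m)%N; suff [_ ->] : C (iter (m + m) (lie y) z) /\
      iter (m + m) (lie y) z = iter (m + m) (lie (y - s)) z.
    by rewrite (nilpotent_ad _ sm) mem0v.
  elim: (m + m)%N => [|k [Ck Ek]] //=; split; first exact: Cst.
  rewrite -Ek lieDl -scaleN1r lieZl; case: Ck => _ /(_ s sT)->.
  by rewrite scaler0 addr0.
have hn : lie_nilpotent h by case: hC.
have [|z [[zs _] /negP zh zn]] := engel_normalizer hh hn Cst Cn; first by exists x.
by apply: zh; apply: hnorm => // y yh; rewrite lieC memvN zn.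
Qed.

Lemma toral_codiag : exists2 P : 'M[F]_n.+1, P \in unitmx &
  forall s, toral s -> exists d, P *m s = diag_mx d *m P.
Proof.
have [ss [ssT sspan]] := spanning_seq toral.
have /codiagonalizableP[P Pu /allP/= Pd] : {in ss &, forall f g, comm_mx f g} /\
    forall f, f \in ss -> diagonalizable f.
  split=> [f g /ssT fT /ssT [gh _]|f /ssT[]//].
  by apply/lie_eq0; exact: toral_central.
exists P => // s /sspan/(@coord_span _ _ _ (in_tuple ss))->.
apply/(diagonalizable_for_rowP _ Pu)/(diagonalizable_forP _ Pu) => i j ij.
rewrite mulmx_sumr mulmx_suml summxE big1 // => k _.
rewrite -scalemxAr -scalemxAl mxE.
have /Pd/(diagonalizable_forP _ Pu)-> // : ss`_k \in ss by rewrite mem_nth.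
by rewrite mulr0.
Qed.

Lemma wedge_in_cartan (u v : 'rV[F]_n.+1) :
  (forall s, toral s -> exists a, u *m s = a *: u /\ v *m s = - a *: v) ->
  wedge u v \in h.
Proof.
move=> uv; apply: cartan_centralizer => [|s sT]; first exact: wedge_skew.
have [a [ua va]] := uv s sT; case: sT => /(subvP hskew) ss _.
by rewrite (lie_wedge ss ua va) subrr oppr0 scale0r.
Qed.

(** The wedge of two zero-weight vectors lies in [h]. If the identity failed, the wedge would be
    diagonalizable, hence toral, and would have to kill [u]; pairing its value at [u] with [v] gives
    the identity after all. *)
Lemma dot_zero_weight (u v : 'rV[F]_n.+1) :
  (forall s, toral s -> u *m s = 0) -> (forall s, toral s -> v *m s = 0) ->
  dot u v ^+ 2 = dot u u * dot v v.
Proof.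
move=> u0 v0; apply: contrapT => /eqP nz.
have wT : toral (wedge u v).
  split; last exact: wedge_diagonalizable.
  by apply: wedge_in_cartan => s sT; exists 0; rewrite u0 ?v0 // oppr0 !scale0r.
have := u0 _ wT; rewrite mul_wedge => E.
case/eqP: nz; apply/esym/eqP; rewrite -subr_eq0.
have := congr1 (fun w => dot w v) E.
by rewrite dotBl !dotZl [dot 0 v]/dot mul0mx mxE expr2 => ->.
Qed.

End CartanSkew.

Section CartanSkewWeights.
Variables (F : numClosedFieldType) (n : nat) (h : {vspace 'M[F]_n.+1}).
Let skew := skew_matrices F n.+1.
Hypothesis hC : cartan skew h.
Variable P : 'M[F]_n.+1.
Hypothesis Pu : P \in unitmx.
Hypothesis Pd : forall s, toral h s -> exists d, P *m s = diag_mx d *m P.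

Let u i : 'rV[F]_n.+1 := row i P.
Let ev s i := (P *m s *m invmx P) i i.

Let hskew s : s \in h -> s \in skew.
Proof. by case: hC => sub _ _ _ /(subvP sub). Qed.

Lemma toral_diagE s : toral h s -> P *m s = diag_mx (\row_i ev s i) *m P.
Proof.
move=> sT; have [d dE] := Pd sT; rewrite {1}dE; congr (diag_mx _ *m P).
by apply/rowP => i; rewrite !mxE /ev dE mulmxK // mxE eqxx.
Qed.

Lemma toral_row s i : toral h s -> u i *m s = ev s i *: u i.
Proof.
move=> /toral_diagE E; rewrite -row_mul E; apply/rowP => j.
by rewrite mul_diag_mx !mxE.
Qed.

Lemma dot_rows i j : dot (u i) (u j) = (P *m P^T) i j.
Proof. by rewrite /dot tr_row -row_mul -?colE !mxE; apply: eq_bigr => k _; rewrite !mxE. Qed.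

Lemma dot_row_weight s i j : toral h s -> dot (u i) (u j) != 0 -> ev s j = - ev s i.
Proof.
move=> sT nz; have := dot_skew (u i) (u j) (hskew sT.1).
by rewrite !toral_row // dotZl dotZr -mulNr => /(mulIf nz) ->; rewrite opprK.
Qed.

Lemma dot_rows_nondegenerate w : (forall i, dot w (u i) = 0) -> w = 0.
Proof.
move=> w0; have PTu : P^T \in unitmx by rewrite unitmx_tr.
apply: (can_inj (mulmxK PTu)); rewrite mul0mx; apply/rowP => i.
by rewrite [RHS]mxE -(w0 i) /dot [RHS]mxE [LHS]mxE; apply: eq_bigr => k _; rewrite !mxE.
Qed.

Lemma row_scaler_inj i k a b : a *: u i = b *: u k -> a != 0 -> i = k /\ a = b.
Proof.
move=> /(congr1 (mulmx^~ (invmx P))); rewrite /u !rowE -!scalemxAl !mulmxK //.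
move=> /rowP/(_ i); rewrite !mxE !eqxx mulr1 => -> /=.
have [->|ik] := eqVneq i k; first by rewrite mulr1.
by rewrite mulr0 eqxx.
Qed.

Lemma row_unit_neq0 i : u i != 0.
Proof.
apply/eqP => ui; have : 1 *: u i = 0 *: u i by rewrite ui !scaler0.
by move/row_scaler_inj; rewrite oner_eq0 => /(_ isT)[_ /eqP]; rewrite oner_eq0.
Qed.

Lemma dot_row_exists w : w != 0 -> exists j, dot w (u j) != 0.
Proof.
move=> wn; apply: contrapT => /forallNP H; case/eqP: wn.
by apply: dot_rows_nondegenerate => j; apply/eqP/negPn/negP/H.
Qed.

(** Choose [j] with [u i], [u j] not orthogonal. Their weights are opposite and both vectors are
    isotropic, so their wedge is toral. It acts on [u i] by a nonzero scalar and sends [u k] to a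
    multiple of [u i]; equal weights make [u k] proportional to [u i]. *)
Lemma nonzero_weight_inj i k s0 : toral h s0 -> ev s0 i != 0 ->
  (forall s, toral h s -> ev s i = ev s k) -> i = k.
Proof.
move=> s0T nz0 ik.
have [j nzij] := dot_row_exists (row_unit_neq0 i).
have iso a b : ev s0 a + ev s0 b != 0 -> dot (u a) (u b) = 0.
  move=> ab; apply/eqP; apply: contraNT ab => /(dot_row_weight s0T) ->.
  by rewrite subrr.
have evj := dot_row_weight s0T nzij.
have dbl x : x != 0 :> F -> x + x != 0.
  by move=> xn; rewrite -mulr2n mulrn_eq0.
have ii0 : dot (u i) (u i) = 0 by apply/iso/dbl.
have ki0 : dot (u k) (u i) = 0 by apply: iso; rewrite -ik // dbl.
have wT : toral h (wedge (u i) (u j)).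
  split.
    apply: (wedge_in_cartan hC) => s sT; exists (ev s i).
    by rewrite !toral_row // (dot_row_weight sT nzij).
  by apply: wedge_diagonalizable; rewrite ii0 mul0r expf_eq0.
have := toral_row i wT; have := toral_row k wT.
rewrite -ik // !mul_wedge ii0 ki0 !scale0r !sub0r -!scaleNr => E1 E2.
have [|_ E3] := row_scaler_inj E2; first by rewrite oppr_eq0.
have [|-> //] := row_scaler_inj (esym E1).
by rewrite -E3 oppr_eq0.
Qed.

(** On zero-weight vectors the form is nondegenerate and satisfies the equality case of
    Cauchy-Schwarz. So every nonzero such vector is anisotropic, and two independent ones cannot
    exist. *)
Lemma zero_weight_inj i k : (forall s, toral h s -> ev s i = 0) ->
  (forall s, toral h s -> ev s k = 0) -> i = k.
Proof.
move=> i0 k0.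
have w0 a b s : toral h s -> (a *: u i + b *: u k) *m s = 0.
  by move=> sT; rewrite mulmxDl -!scalemxAl !toral_row // i0 // k0 // !scale0r !scaler0 addr0.
have aniso a b : a *: u i + b *: u k != 0 ->
    dot (a *: u i + b *: u k) (a *: u i + b *: u k) != 0.
  move=> nz; have [m nzm] := dot_row_exists nz.
  have m0 s : toral h s -> u m *m s = 0.
    move=> sT; rewrite toral_row //.
    have := dot_skew (a *: u i + b *: u k) (u m) (hskew sT.1).
    rewrite w0 // toral_row // {1}/dot mul0mx mxE dotZr => /eqP.
    rewrite eq_sym oppr_eq0 mulf_eq0 (negPf nzm) orbF => /eqP->.
    by rewrite scale0r.
  have := dot_zero_weight hC (w0 a b) m0.
  by apply: contra_eq_neq => ->; rewrite mul0r expf_eq0.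
have ii : dot (u i) (u i) != 0.
  by have := aniso 1 0; rewrite scale1r scale0r addr0 => /(_ (row_unit_neq0 i)).
have [//|ik] := eqVneq i k.
(* Gram-Schmidt: [a *: u i + b *: u k] is orthogonal to [u i], so the equality of squares forces an
   anisotropic vector to have norm zero. *)
set a := - dot (u i) (u k); set b := dot (u i) (u i).
have nz : a *: u i + b *: u k != 0.
  rewrite addr_eq0 -scaleNr eq_sym; apply: contraNneq ik => /row_scaler_inj.
  by rewrite oppr_eq0 => /(_ ii)[->].
have /eqP := dot_zero_weight hC (w0 a b) (w0 1 0).
rewrite scale1r scale0r addr0.
have -> : dot (a *: u i + b *: u k) (u i) = 0.
  by rewrite dotDl !dotZl /a /b [dot (u k) _]dotC; ring.
by rewrite expr0n eq_sym mulf_eq0 (negPf ii) orbF (negPf (aniso _ _ nz)).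
Qed.

Lemma weight_inj i k : (forall s, toral h s -> ev s i = ev s k) -> i = k.
Proof.
move=> ik; have [[s [sT nz]]|/forallNP H] := EM (exists s, toral h s /\ ev s i != 0).
  exact: nonzero_weight_inj sT nz ik.
have i0 s : toral h s -> ev s i = 0.
  by move=> sT; apply/eqP/negPn/negP => nz; apply: (H s).
by apply: zero_weight_inj => // s sT; rewrite -ik ?i0.
Qed.

(** [sg] sends a row to the only row that is not orthogonal to it, the one of opposite weight; a
    fixed row has weight zero. Distinct weights make the centralizer diagonal in the basis of rows,
    and skewness says that the eigenvalues are odd under [sg]. *)
Lemma cartan_diag : exists sg : 'I_n.+1 -> 'I_n.+1,
  [/\ involutive sg, forall i j, sg i = i -> sg j = j -> i = j &
    forall y, y \in h <->
      exists c : 'rV_n.+1, (forall i, c 0 (sg i) = - c 0 i) /\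
        P *m y = diag_mx c *m P].
Proof.
have ex i := dot_row_exists (row_unit_neq0 i).
pose sg i := xchoose (ex i); have sgP i : dot (u i) (u (sg i)) != 0.
  exact: (xchooseP (ex i)).
have uniq i j : dot (u i) (u j) != 0 -> j = sg i.
  by move=> nz; apply: weight_inj => s sT; rewrite (dot_row_weight sT nz) (dot_row_weight
      sT (sgP i)).
exists sg; split.
- by move=> i; apply/esym/uniq; rewrite dotC.
- move=> i j fi fj; apply: zero_weight_inj => s sT; apply/eqP.
    have := dot_row_weight sT (sgP i); rewrite fi => /eqP.
    by rewrite -subr_eq0 opprK -mulr2n mulrn_eq0.
  have := dot_row_weight sT (sgP j); rewrite fj => /eqP.
  by rewrite -subr_eq0 opprK -mulr2n mulrn_eq0.
move=> y; split=> [yh|[c [cs cE]]].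
  pose Y := P *m y *m invmx P.
  have Yd i j : i != j -> Y i j = 0.
    move=> ij; apply/eqP/negPn/negP => nz; case/eqP: ij; apply: weight_inj => s sT.
    have := lie_conj y Pu (toral_diagE sT).
    rewrite (toral_central hC sT yh) mulmx0 mul0mx -/Y => /matrixP/(_ i j)/eqP.
    by rewrite lie_diagE mxE eq_sym mulf_eq0 (negPf nz) orbF !mxE subr_eq0 => /eqP.
  have yE : P *m y = diag_mx (\row_i Y i i) *m P.
    apply: (canRL (mulmxKV Pu)); rewrite -/Y; apply/matrixP => i j.
    rewrite [RHS]mxE [X in X *+ _]mxE; case: eqVneq => [->|/Yd->] //.
  exists (\row_i Y i i); split=> // i.
  have yrow k : u k *m y = Y k k *: u k.
    by rewrite -row_mul yE; apply/rowP => j; rewrite mul_diag_mx [LHS]mxE !mxE.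
  have := dot_skew (u i) (u (sg i)) (hskew yh).
  by rewrite !yrow dotZl dotZr -mulNr => /(mulIf (sgP i)) E; rewrite [LHS]mxE [X in - X]mxE
      E opprK.
apply: (cartan_centralizer hC).
  apply/skew_matricesP; apply: (can_inj (mulKmx Pu)).
  apply: (can_inj (mulmxK (_ : P^T \in unitmx))); first by rewrite unitmx_tr.
  rewrite mulmxN mulNmx cE -[LHS]mulmxA -trmx_mul cE trmx_mul tr_diag_mx mulmxA.
  rewrite -[in RHS]mulmxA; apply/matrixP => i j.
  rewrite mul_mx_diag mxE [RHS]mxE mul_diag_mx [in RHS]mxE -dot_rows.
  have [->|/uniq->] := eqVneq (dot (u i) (u j)) 0; first by rewrite mulr0 mul0r oppr0.
  by rewrite cs; ring.
move=> s sT; apply: (can_inj (mulKmx Pu)).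
apply: (can_inj (mulmxK (_ : invmx P \in unitmx))); first by rewrite unitmx_inv.
rewrite (lie_conj y Pu (toral_diagE sT)) cE mulmxK // mulmx0 mul0mx.
apply/matrixP => i j; rewrite lie_diagE [RHS]mxE.
have [->|ij] := eqVneq i j; first by rewrite subrr mul0r.
by rewrite [X in _ * X]mxE (negPf ij) mulr0n mulr0.
Qed.

End CartanSkewWeights.

(** * Diagonal form of an arbitrary Cartan subalgebra *)

(** The total 1 + 2l is odd, so the involution has a fixed point, and by assumption only one. Each
    remaining orbit is represented by its element [i] with [i < sg i]. *)
Lemma involution_labelling l (sg : 'I_(1 + (l + l)) -> 'I_(1 + (l + l))) :
  involutive sg -> (forall i j, sg i = i -> sg j = j -> i = j) ->
  exists f : {perm 'I_(1 + (l + l))}, sg (f (lshift (l + l) 0)) = f (lshift (l + l) 0) /\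
    forall k : 'I_l, sg (f (rshift 1 (lshift l k))) = f (rshift 1 (rshift l k)).
Proof.
move=> sgK fixU.
pose A := [set i : 'I_(1 + (l + l)) | (i < sg i)%N]; pose B := [set i : 'I_(1 + (l + l)) |
    (sg i < i)%N].
pose Z := [set i : 'I_(1 + (l + l)) | sg i == i].
have cB : #|B| = #|A|.
  rewrite -(card_imset _ (can_inj sgK)); congr #|pred_of_set _|.
  apply/setP => i; rewrite inE; apply/imsetP/idP => [[j]|lti].
    by rewrite inE => ltj ->; rewrite sgK.
  by exists (sg i); rewrite ?inE sgK.
have cZ : (#|Z| <= 1)%N.
  by apply/card_le1_eqP => i j; rewrite !inE => /eqP fi /eqP fj; apply: fixU.
have cT : (#|Z| + (#|A| + #|B|) = 1 + (l + l))%N.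
  rewrite -[RHS]card_ord -(cardC (mem Z)) -(cardID (mem A) (mem [predC Z])).
  congr (_ + (_ + _))%N; apply: eq_card => i; rewrite !inE -(inj_eq val_inj) /=.
    by case: ltngtP.
  by case: ltngtP.
have [cZ1 cA] : #|Z| = 1%N /\ #|A| = l.
  move: cZ cT; rewrite cB; case: #|Z| => [|[|//]] _ cT.
    by have := congr1 odd cT; rewrite !oddD !addbb.
  by split=> //; apply: double_inj; rewrite -!addnn; move/addnI: cT.
have /cards1P[z zE] : #|Z| == 1%N by rewrite cZ1.
pose a (k : 'I_l) : 'I_(1 + (l + l)) := enum_val (cast_ord (esym cA) k).
have aA k : a k \in A by exact: enum_valP.
have ainj : injective a by move=> k m /enum_val_inj/cast_ord_inj.
pose g (i : 'I_(1 + (l + l))) : 'I_(1 + (l + l)) := match fintype.split i with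
  | inl _ => z
  | inr j => match fintype.split j with inl k => a k | inr k => sg (a k) end end.
have zZ : sg z = z.
  apply/eqP; have : z \in Z by rewrite zE set11.
  by rewrite inE.
have az k : a k != z.
  by have := aA k; rewrite inE; apply: contraTneq => ->; rewrite zZ ltnn.
have sz k : sg (a k) != z by rewrite -zZ (inj_eq (can_inj sgK)).
have as_ k m : a k != sg (a m).
  have := aA k; apply: contraTneq => ->; rewrite inE sgK -leqNgt.
  by have := aA m; rewrite inE => /ltnW.
have splitL m n (k : 'I_m) : fintype.split (lshift n k) = inl k by exact: (unsplitK (inl k)).
have splitR m n (k : 'I_n) : fintype.split (rshift m k) = inr k by exact: (unsplitK (inr k)).
have gz j : g (lshift _ j) = z by rewrite /g splitL.
have gl k : g (rshift 1 (lshift l k)) = a k by rewrite /g splitR splitL.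
have gr k : g (rshift 1 (rshift l k)) = sg (a k) by rewrite /g !splitR.
have gNz j : g (rshift 1 j) != z.
  by case: (split_ordP j) => k ->; rewrite ?gl ?gr.
have ginj : injective g.
  move=> i j; case: (split_ordP i) => i' ->; case: (split_ordP j) => j' ->.
  - by rewrite !ord1.
  - by rewrite gz => /esym/eqP; rewrite (negPf (gNz _)).
  - by rewrite gz => /eqP; rewrite (negPf (gNz _)).
  - case: (split_ordP i') => i2 ->; case: (split_ordP j') => j2 ->; rewrite ?gl ?gr.
    + by move/ainj->.
    + by move/eqP; rewrite (negPf (as_ _ _)).
    + by move/esym/eqP; rewrite (negPf (as_ _ _)).
    + by move/(can_inj sgK)/ainj->.
exists (perm ginj); rewrite !permE gz; split=> // k.
by rewrite !permE gl gr.
Qed.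

Definition weight_row (F : fieldType) l (d : 'rV[F]_l) : 'rV[F]_(1 + (l + l)) :=
  row_mx 0 (row_mx d (- d)).

(** This plays the part of the conjugacy of Cartan subalgebras; nothing is asked of [P] besides
    invertibility. *)
Lemma skew_cartan_diag (F : numClosedFieldType) l
    (h : {vspace 'M[F]_(1 + (l + l))}) :
  cartan (skew_matrices F (1 + (l + l))) h ->
  exists2 P, P \in unitmx &
    forall y, y \in h <-> exists d, P *m y = diag_mx (weight_row d) *m P.
Proof.
move=> hC; have [P Pu Pd] := toral_codiag hC.
have [sg [sgK fixU hE]] := cartan_diag hC Pu Pd.
have [f [f0 fs]] := involution_labelling sgK fixU.
exists (row_perm f P); first by rewrite row_permE unitmx_mul unitmx_perm.
have rp y c : row_perm f P *m y = diag_mx (col_perm f c) *m row_perm f P <->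
    P *m y = diag_mx c *m P.
  have -> : diag_mx (col_perm f c) *m row_perm f P = row_perm f (diag_mx c *m P).
    by apply/matrixP => i j; rewrite mul_diag_mx [RHS]mxE mul_diag_mx !mxE.
  have -> : row_perm f P *m y = row_perm f (P *m y) by rewrite !row_permE mulmxA.
  by split=> [|-> //]; rewrite !row_permE => /(can_inj (mulKmx (unitmx_perm _ _))).
move=> y; rewrite hE; split=> [[c [cs /rp yE]]|[d yE]].
  exists (\row_k c 0 (f (rshift 1 (lshift l k)))).
  rewrite yE; congr (diag_mx _ *m _); apply/rowP => i; rewrite mxE /weight_row.
  case: (split_ordP i) => [k|k] ->; rewrite ?row_mxEl ?row_mxEr.
    rewrite ord1 mxE; apply/eqP; have := cs (f (lshift (l + l) 0)); rewrite f0 => /eqP.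
    by rewrite -subr_eq0 opprK -mulr2n mulrn_eq0.
  case: (split_ordP k) => [m|m] ->; rewrite ?row_mxEl ?row_mxEr !mxE //.
  by rewrite -fs cs.
exists (col_perm f^-1 (weight_row d)); split; last first.
  apply/rp; rewrite yE; congr (diag_mx _ *m _).
  by apply/rowP => i; rewrite !mxE permK.
move=> i; rewrite [LHS]mxE [X in - X]mxE -{1}(permKV f i) /weight_row; case: (split_ordP
    (f^-1%g i)) => k ->.
  by rewrite ord1 f0 permK !row_mxEl mxE oppr0.
case: (split_ordP k) => m ->.
  by rewrite fs permK !row_mxEr row_mxEl mxE.
by rewrite -fs sgK permK !row_mxEr row_mxEl mxE opprK.
Qed.

(** * Submodules for the skew matrices *)

Lemma mul_delta_mxE (R : comPzRingType) m n p (a : 'I_m) (b : 'I_n) (z : 'M[R]_(n, p)) c d :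
  (delta_mx a b *m z) c d = (c == a)%:R * z b d.
Proof.
rewrite mxE (bigD1 b) //= mxE eqxx andbT big1 ?addr0 // => k kb.
by rewrite mxE (negPf kb) andbF mul0r.
Qed.

Lemma mul_mx_deltaE (R : comPzRingType) m n p (a : 'I_n) (b : 'I_p) (z : 'M[R]_(m, n)) c d :
  (z *m delta_mx a b) c d = z c a * (d == b)%:R.
Proof.
rewrite mxE (bigD1 a) //= mxE eqxx big1 ?addr0 // => k ka.
by rewrite mxE (negPf ka) mulr0.
Qed.

Section SkewModules.
Variables (F : numFieldType) (n : nat).
Implicit Types (i j k m : 'I_n) (z : 'M[F]_n).

Definition skew_delta i j : 'M[F]_n := delta_mx i j - delta_mx j i.

Lemma skew_delta_skew i j : skew_delta i j \in skew_matrices F n.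
Proof.
by apply/skew_matricesP; rewrite /skew_delta [LHS]linearB /= !trmx_delta opprB.
Qed.

(* On the eigenspaces of [(ad A)^2], whose eigenvalues are 0, -1 and -4, the
   polynomial takes the values 1, -1 and 1. *)
Lemma conj_sign_ad (A z : 'M[F]_n) : A *m A *m A = - A ->
  let X y := lie A (lie A y) in
  (1%:M + 2%:R *: (A *m A)) *m z *m (1%:M + 2%:R *: (A *m A)) =
  z + (8%:R / 3%:R) *: X z + (2%:R / 3%:R) *: X (X z).
Proof.
move=> A3 X.
have A3l (y : 'M[F]_n) : y *m A *m A *m A = - (y *m A).
  by rewrite -!mulmxA [A *m (A *m A)]mulmxA A3 mulmxN.
have -> : 2%:R *: (A *m A) = A *m A + A *m A by rewrite scaler_nat mulr2n.
rewrite /X /lie.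
repeat first [rewrite mulmxBr | rewrite mulmxBl | rewrite mulmxDr | rewrite mulmxDl |
  rewrite mul1mx | rewrite mulmx1 | rewrite mulmxA | rewrite A3l | rewrite A3 |
  rewrite mulNmx | rewrite mulmxN].
move: (A *m A *m z *m A *m A) (A *m A *m z) (z *m A *m A) (A *m z *m A) => a b c d.
by apply/matrixP => i j; rewrite !mxE; field.
Qed.

Definition sign_row (S : pred 'I_n) : 'rV[F]_n := \row_k (-1) ^+ S k.

Definition sign_conj (S : pred 'I_n) z : 'M[F]_n :=
  \matrix_(k, m) ((-1) ^+ S k * (-1) ^+ S m * z k m).

Variable M : {vspace 'M[F]_n}.
Hypothesis MM : forall A z, A \in skew_matrices F n -> z \in M -> lie A z \in M.

(** With [A = skew_delta i j], the square [A *m A] is minus the projector on the coordinates [i],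
    [j]. Hence [1 + 2 A^2] is the diagonal sign matrix with -1 at these two places. *)
Lemma sign_conj2_stable i j z : i != j -> z \in M ->
  sign_conj (pred2 i j) z \in M.
Proof.
move=> ij zM; set A := skew_delta i j; have ji : j != i by rewrite eq_sym.
have A2 : A *m A = - delta_mx i i - delta_mx j j.
  rewrite /A /skew_delta mulmxBl !mulmxBr !mul_delta_mx.
  by rewrite (mul_delta_mx_0 _ _ _ ij) (mul_delta_mx_0 _ _ _ ji) sub0r subr0.
have A3 : A *m A *m A = - A.
  rewrite A2 /A /skew_delta mulmxBl mulNmx !mulmxBr !mul_delta_mx.
  by rewrite (mul_delta_mx_0 _ _ _ ij) (mul_delta_mx_0 _ _ _ ji) sub0r subr0 opprK opprB addrC.
have AS := skew_delta_skew i j.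
suff -> : sign_conj (pred2 i j) z =
    (1%:M + 2%:R *: (A *m A)) *m z *m (1%:M + 2%:R *: (A *m A)).
  by rewrite conj_sign_ad // !memvD // memvZ //; do !apply: MM.
have -> : 1%:M + 2%:R *: (A *m A) = diag_mx (sign_row (pred2 i j)).
  rewrite A2; apply/matrixP => k m; rewrite !mxE /=.
  have [->|km] := eqVneq k m.
    have [->|mi] := eqVneq m i; first by rewrite (negPf ij) /=; ring.
    by case: (m == j) => /=; ring.
  have -> : (k == i) && (m == i) = false by apply: contraNF km => /andP[/eqP-> /eqP->].
  have -> : (k == j) && (m == j) = false by apply: contraNF km => /andP[/eqP-> /eqP->].
  by rewrite /=; ring.
apply/matrixP => k m; rewrite mul_mx_diag mxE [RHS]mxE mul_diag_mx [in RHS]mxE !mxE.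
by rewrite mulrAC.
Qed.

Hypothesis n_odd : odd n.

(** Compose the flips of the pairs [i], [j] over all [j != i]. As [n] is odd, [i] is flipped an even
    number of times and every other index once: this is minus the flip of [i] alone, and conjugation
    ignores the overall sign. *)
Lemma sign_conj1_stable i z : z \in M -> sign_conj (pred1 i) z \in M.
Proof.
move=> zM.
pose f r := foldr (fun j y => sign_conj (pred2 i j) y) z r.
have fM r : all (fun j => j != i) r -> f r \in M.
  elim: r => //= j r IH /andP[ji /IH]; apply: sign_conj2_stable.
  by rewrite eq_sym.
have fE r k m : f r k m = (\prod_(j <- r) (-1) ^+ pred2 i j k) *
    (\prod_(j <- r) (-1) ^+ pred2 i j m) * z k m.
  elim: r => [|j r IH]; first by rewrite !big_nil !mul1r.
  by rewrite !big_cons [LHS]mxE IH; ring.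
pose r := enum (predC1 i).
have pE k : \prod_(j <- r) (-1) ^+ pred2 i j k = - (-1) ^+ (k == i) :> F.
  rewrite /r big_enum.
  have [->|ki] := eqVneq k i.
    under eq_bigr do rewrite /= eqxx /=.
    rewrite prodr_const cardC1 card_ord.
    have ev : odd n.-1 = false by move: n_odd; case: (n) => //= p /negbTE.
    by rewrite expr1 -signr_odd ev expr0 opprK.
  rewrite (bigD1 k) ?inE //= (negPf ki) eqxx /= expr1 big1 ?mulr1 ?expr0 //.
  by move=> j /andP[_ jk]; rewrite eq_sym (negPf jk).
suff -> : sign_conj (pred1 i) z = f r.
  by apply: fM; apply/allP => j; rewrite mem_enum.
by apply/matrixP => k m; rewrite fE !pE mxE /=; ring.
Qed.

(** Subtracting the conjugate by the flip of [i] doubles the entries with exactly one index equal to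
    [i] and kills the others. Doing the same with [j] leaves four times the entries (i, j) and (j,
    i). *)
Lemma isolate_entry i j z : i != j -> z \in M ->
  z i j *: delta_mx i j + z j i *: delta_mx j i \in M.
Proof.
move=> ij zM; pose y := z - sign_conj (pred1 i) z.
have yM : y \in M by rewrite memvB // sign_conj1_stable.
have wM : y - sign_conj (pred1 j) y \in M by rewrite memvB // sign_conj1_stable.
suff -> : z i j *: delta_mx i j + z j i *: delta_mx j i =
    4%:R^-1 *: (y - sign_conj (pred1 j) y) by rewrite memvZ.
have ji : j != i by rewrite eq_sym.
apply/matrixP => k m; rewrite !mxE /=.
have [->|ki] := eqVneq k i; have [->|mi] := eqVneq m i;
  rewrite ?eqxx ?(negPf ij) ?(negPf ji) ?andbF ?andbT /=.
- by field.
- by have [->|mj] := eqVneq m j; rewrite /=; field.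
- by have [->|kj] := eqVneq k j; rewrite /=; field.
- by have [->|kj] := eqVneq k j; have [->|mj] := eqVneq m j; rewrite /=; field.
Qed.

(** The sign [e] treats skew (-1) and symmetric (1) matrices at once. The bracket with
    [skew_delta k i'] renames the index [i'] to [k], and [e * e = 1] allows exchanging the two
    indices. *)
Lemma spread_entry (e : F) i j : e * e = 1 -> i != j ->
  delta_mx i j + e *: delta_mx j i \in M ->
  forall k m, k != m -> delta_mx k m + e *: delta_mx m k \in M.
Proof.
move=> ee; have step i' j' k : i' != j' -> k != j' ->
    delta_mx i' j' + e *: delta_mx j' i' \in M -> delta_mx k j' + e *: delta_mx j' k \in M.
  move=> ij kj SM; have [->//|ki] := eqVneq k i'.
  suff -> : delta_mx k j' + e *: delta_mx j' k =
      lie (skew_delta k i') (delta_mx i' j' + e *: delta_mx j' i').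
    by apply: MM => //; exact: skew_delta_skew.
  rewrite /lie /skew_delta mulmxBl mulmxBr !mulmxDr !mulmxDl -!scalemxAr -!scalemxAl.
  rewrite !mul_delta_mx_cond ![i' == k]eq_sym ![j' == k]eq_sym ![j' == i']eq_sym.
  rewrite !eqxx (negPf ij) (negPf kj) (negPf ki) !mulr0n !mulr1n.
  by apply/matrixP => a b; rewrite !mxE; ring.
have flip i' j' : delta_mx i' j' + e *: delta_mx j' i' \in M ->
    delta_mx j' i' + e *: delta_mx i' j' \in M.
  move=> /(memvZ e); rewrite scalerDr scalerA ee scale1r addrC //.
move=> ij SM k m km.
have [kj|kj] := eqVneq k j; last first.
  have Skj := step _ _ _ ij kj SM.
  by apply/flip/(step _ _ _ _ _ (flip _ _ Skj)); rewrite // 1?eq_sym.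
rewrite kj in km *; apply/flip; apply: (step _ _ _ ij) => //.
by rewrite eq_sym.
Qed.

Lemma skew_in_module z : z != 0 -> z \in skew_matrices F n -> z \in M ->
  (skew_matrices F n <= M)%VS.
Proof.
move=> nz /skew_matricesP zT zM.
have skE (y : 'M[F]_n) i j : y^T = - y -> y j i = - y i j.
  by move/matrixP/(_ i j); rewrite !mxE.
have [i [j zij]] : exists i j, z i j != 0.
  apply: contrapT => H; case/eqP: nz; apply/matrixP => i j; rewrite mxE.
  by apply/eqP/negPn/negP => zij; apply: H; exists i, j.
have ij : i != j.
  apply: contraNneq zij => ->; have /eqP := skE _ j j zT.
  by rewrite -subr_eq0 opprK -mulr2n mulrn_eq0.
have SM : delta_mx i j + -1 *: delta_mx j i \in M.
  have := memvZ (z i j)^-1 (isolate_entry ij zM).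
  rewrite (skE _ i j zT) scalerDr !scalerA mulVf // mulrN mulVf //.
  by rewrite scale1r.
have all_ : forall k m, k != m -> delta_mx k m + -1 *: delta_mx m k \in M.
  by apply: spread_entry ij SM; rewrite mulrNN mulr1.
apply/subvP => y /skew_matricesP yT.
have -> : y = 2%:R^-1 *: \sum_k \sum_m y k m *: (delta_mx k m - delta_mx m k).
  under eq_bigr do under eq_bigr do rewrite scalerBr.
  under eq_bigr do rewrite sumrB.
  rewrite sumrB -matrix_sum_delta exchange_big /=.
  under [X in _ - X]eq_bigr do under eq_bigr do rewrite (skE _ _ _ yT) scaleNr.
  under [X in _ - X]eq_bigr do rewrite sumrN.
  by rewrite sumrN -matrix_sum_delta opprK -mulr2n -scaler_nat scalerA mulVf ?scale1r
      ?pnatr_eq0.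
apply: memvZ; apply: memv_suml => k _; apply: memv_suml => m _; apply: memvZ.
have [->|km] := eqVneq k m; first by rewrite subrr mem0v.
by rewrite -scaleN1r all_.
Qed.

(** A diagonal [z] that is traceless and nonzero is not scalar, so its bracket with a suitable
    [skew_delta i j] has a nonzero off-diagonal entry. Conversely, brackets of off-diagonal units
    give the differences of diagonal units. *)
Lemma sym_in_module z : z != 0 -> z^T = z -> \tr z = 0 -> z \in M ->
  forall y : 'M[F]_n, y^T = y -> \tr y = 0 -> y \in M.
Proof.
move=> nz zT ztr zM y yT ytr.
have syE (x : 'M[F]_n) i j : x^T = x -> x j i = x i j.
  by move/matrixP/(_ i j); rewrite mxE.
have [x [xT xM [i [j [ij xij]]]]] : exists x : 'M[F]_n, [/\ x^T = x, x \in M &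
    exists i j, i != j /\ x i j != 0].
  have [[i [j [ij zij]]]|diag] := EM (exists i j, i != j /\ z i j != 0).
    by exists z; split=> //; exists i, j.
  have zij i j : i != j -> z i j = 0.
    by move=> ij; apply/eqP/negPn/negP => H; apply: diag; exists i, j.
  have [i [j zii]] : exists i j, z i i != z j j.
    apply: contrapT => H; case/eqP: nz; apply/matrixP => i j; rewrite mxE.
    have [<-|/zij//] := eqVneq i j.
    have zE k : z k k = z i i.
      by apply/eqP/negPn/negP => zki; apply: H; exists k, i.
    have n_gt0 : (0 < n)%N by move: n_odd; case: (n).
    move: ztr; rewrite /mxtrace; under eq_bigr do rewrite zE.
    rewrite sumr_const card_ord => /eqP; rewrite mulrn_eq0.
    by rewrite eqn0Ngt n_gt0 => /eqP.
  have ij : i != j by apply: contraNneq zii => ->.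
  have AS := skew_delta_skew i j; set A := skew_delta i j in AS.
  exists (lie A z); split; last exists i, j; first 2 last.
  - split=> //; have entB (u v : 'M[F]_n) a b : (u - v) a b = u a b - v a b by rewrite !mxE.
    rewrite /lie /A /skew_delta mulmxBl mulmxBr !entB.
    rewrite !mul_delta_mxE !mul_mx_deltaE !eqxx (negPf ij) [j == i]eq_sym (negPf ij).
    by rewrite mul1r mul0r mulr1 mulr0 !subr0 subr_eq0 eq_sym.
  - rewrite /lie [LHS]linearB /= !trmx_mul zT (skew_matricesP _ AS).
    by rewrite mulmxN mulNmx opprK addrC.
  - exact: MM.
have SM : delta_mx i j + 1 *: delta_mx j i \in M.
  have := memvZ (x i j)^-1 (isolate_entry ij xM).
  by rewrite (syE _ i j xT) scalerDr !scalerA mulVf // !scale1r.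
have all_ : forall k m, k != m -> delta_mx k m + delta_mx m k \in M.
  move=> k m km; have := spread_entry (mulr1 1) ij SM km.
  by rewrite scale1r.
have dg k m : delta_mx k k - delta_mx m m \in M.
  have [->|km] := eqVneq k m; first by rewrite subrr mem0v.
  have mk : m != k by rewrite eq_sym.
  have := MM (skew_delta_skew k m) (all_ k m km) => /(memvZ 2%:R^-1).
  rewrite /lie /skew_delta mulmxBl !mulmxBr !mulmxDr !mulmxDl.
  rewrite !mul_delta_mx_cond !eqxx (negPf km) (negPf mk) !mulr0n !mulr1n.
  rewrite !addr0 !add0r; congr (_ \in M).
  by apply/matrixP => a b; rewrite !mxE; field.
have n_gt0 : (0 < n)%N by move: n_odd; case: (n).
pose o := Ordinal n_gt0.
(* The subtracted terms add up to [\tr y] times the unit at [o], that is to zero; they make each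
   diagonal summand a difference of diagonal units. *)
have -> : y = \sum_k \sum_m y k m *:
    (2%:R^-1 *: (delta_mx k m + delta_mx m k) - (k == m)%:R *: delta_mx o o).
  under eq_bigr do under eq_bigr do rewrite scalerBr.
  under eq_bigr do rewrite sumrB.
  rewrite sumrB [X in _ - X](_ : _ = 0) ?subr0; last first.
    transitivity (\sum_k y k k *: delta_mx o o : 'M[F]_n).
      apply: eq_bigr => k _; rewrite (bigD1 k) //= eqxx scale1r big1 ?addr0 //.
      by move=> m mk; rewrite eq_sym (negPf mk) scale0r scaler0.
    by rewrite -scaler_suml -/(mxtrace y) ytr scale0r.
  under eq_bigr do under eq_bigr do rewrite scalerA mulrC -scalerA scalerDr scalerDr.
  under eq_bigr do rewrite big_split /= -!scaler_sumr.
  rewrite big_split /= -!scaler_sumr -matrix_sum_delta exchange_big /=.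
  under [X in _ + _ *: X]eq_bigr do under eq_bigr do rewrite (syE _ _ _ yT).
  by rewrite -matrix_sum_delta -scalerDr -mulr2n -scaler_nat scalerA mulVf ?scale1r ?pnatr_eq0.
apply: memv_suml => k _; apply: memv_suml => m _; apply: memvZ.
have [->|km] := eqVneq k m.
  rewrite scale1r; suff -> : 2%:R^-1 *: (delta_mx m m + delta_mx m m) = delta_mx m m :>
      'M[F]_n by [].
  by apply/matrixP => a b; rewrite !mxE; field.
by rewrite scale0r subr0 memvZ // all_.
Qed.

End SkewModules.

(** * The Killing form and dimensions *)

(* Both sides are the trace of [f], whose image lies in [W]. *)
Lemma sum_coord_trace (F : fieldType) n (W : {vspace 'M[F]_n})
    (f : {linear 'M[F]_n -> 'M[F]_n}) : (forall x, f x \in W) ->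
  \sum_(i < \dim W) coord (vbasis W) i (f (vbasis W)`_i) =
  \sum_j \sum_k f (delta_mx j k) j k.
Proof.
move=> fW; set b := vbasis W.
transitivity (\sum_(i < \dim W) \sum_j \sum_k b`_i j k * coord b i (f (delta_mx j k))).
  apply: eq_bigr => i _; rewrite [in LHS](matrix_sum_delta b`_i) !raddf_sum /=.
  by apply: eq_bigr => j _; rewrite !raddf_sum /=; apply: eq_bigr => k _; rewrite !linearZ.
rewrite exchange_big /=; apply: eq_bigr => j _; rewrite exchange_big /=.
apply: eq_bigr => k _; rewrite [in RHS](coord_vbasis (fW (delta_mx j k))) summxE.
by apply: eq_bigr => i _; rewrite mxE mulrC.
Qed.

Lemma lieBr (F : fieldType) n (x y z : 'M[F]_n) : lie x (y - z) = lie x y - lie x z.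
Proof. exact: raddfB. Qed.

Lemma tr_mul_skew (F : fieldType) n (x y : 'M[F]_n) : x \in skew_matrices F n ->
  \sum_j \sum_k x j k * y j k = - \tr (x *m y).
Proof.
move=> /skew_matricesP xT; rewrite exchange_big /= -mxtrace_tr trmx_mul.
rewrite xT mulmxN linearN opprK /mxtrace; apply: eq_bigr => k _.
by rewrite mxE; apply: eq_bigr => j _; rewrite mxE mulrC.
Qed.

Lemma skew_diag0 (F : numFieldType) n (x : 'M[F]_n) j :
  x \in skew_matrices F n -> x j j = 0.
Proof.
move=> /skew_matricesP /matrixP/(_ j j)/eqP; rewrite !mxE.
by rewrite -subr_eq0 opprK -mulr2n mulrn_eq0 => /eqP.
Qed.

(** Precomposing [ad x \o ad y] with the antisymmetrization [pr] gives an endomorphism of the full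
    matrix space with the same trace, which can be read off on matrix units. *)
Lemma killing_skew (F : numFieldType) n (x y : 'M[F]_n) :
  x \in skew_matrices F n -> y \in skew_matrices F n ->
  killing (skew_matrices F n) x y = (n%:R - 2%:R) * \tr (x *m y).
Proof.
move=> xS yS; pose pr (z : 'M[F]_n) := 2%:R^-1 *: (z - z^T).
have prL : linear pr.
  move=> c u v; rewrite /pr linearP /=; apply/matrixP => i j; rewrite !mxE.
  by ring.
pose prM := GRing.isLinear.Build _ _ _ _ _ prL.
pose prl : {linear 'M[F]_n -> 'M[F]_n} := HB.pack pr prM.
have prS z : pr z \in skew_matrices F n.
  apply/skew_matricesP; rewrite /pr linearZ /= [(z - _)^T]linearB /= trmxK.
  by rewrite -scalerN opprB.
have prK z : z \in skew_matrices F n -> pr z = z.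
  move=> /skew_matricesP zT; rewrite /pr zT opprK -mulr2n -scaler_nat scalerA.
  by rewrite mulVf ?scale1r // pnatr_eq0.
have := @sum_coord_trace _ _ (skew_matrices F n) (lie x \o lie y \o prl).
rewrite /killing => E; transitivity (\sum_j \sum_k lie x (lie y (pr (delta_mx j k))) j k).
  rewrite -E => [|z]; last by rewrite !lie_skew.
  apply: eq_bigr => i _ /=; rewrite prK //.
  by apply: vbasis_mem; rewrite mem_nth ?size_tuple.
pose t := \tr (x *m y).
have entE (z : 'M[F]_n) j k : lie x (lie y z) j k =
    (x *m y *m z) j k - (x *m z *m y) j k - (y *m z *m x) j k + (z *m (y *m x)) j k.
  rewrite /lie !mulmxBl !mulmxBr !mulmxA; move: (x *m y *m z) => a.
  move: (x *m z *m y) (y *m z *m x) (z *m y *m x) => b c d.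
  by rewrite !mxE; ring.
(* Summed over [j] and [k], with [t] the trace of [x *m y], the five terms contribute [n t], [n t],
   [-2 t], [-t] and [-t]; half the total is [(n - 2) t]. *)
have dlt j k : lie x (lie y (pr (delta_mx j k))) j k = 2%:R^-1 *
  ((x *m y) j j + (y *m x) k k - (j == k)%:R * ((x *m y) j j + (y *m x) j j)
   + x j k * y j k + y j k * x j k).
  rewrite /pr trmx_delta !linearZ /= mxE; congr (_ * _).
  have lB : lie x (lie y (delta_mx j k - delta_mx k j)) =
     lie x (lie y (delta_mx j k)) - lie x (lie y (delta_mx k j)).
    by rewrite (lieBr y) (lieBr x).
  have entB (u v : 'M[F]_n) a b : (u - v) a b = u a b - v a b by rewrite !mxE.
  rewrite lB entB !entE.
  rewrite -![x *m delta_mx _ _ *m y]mulmxA -![y *m delta_mx _ _ *m x]mulmxA.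
  have mid (u v : 'M[F]_n) (a b c d : 'I_n) :
      (u *m (delta_mx a b *m v)) c d = u c a * v b d.
    rewrite mxE (bigD1 a) //= mul_delta_mxE eqxx mul1r big1 ?addr0 // => e ea.
    by rewrite mul_delta_mxE (negPf ea) mul0r mulr0.
  rewrite !mid !mul_mx_deltaE !mul_delta_mxE !eqxx !(skew_diag0 _ xS) !(skew_diag0 _ yS).
  have [->|jk] := eqVneq j k.
    by rewrite !(skew_diag0 _ xS) !(skew_diag0 _ yS) /=; ring.
  by rewrite /=; ring.
under eq_bigr do under eq_bigr do rewrite dlt.
have trC : \tr (y *m x) = t by rewrite mxtrace_mulC.
under eq_bigr do rewrite -mulr_sumr !big_split /=.
rewrite -mulr_sumr !big_split /= tr_mul_skew // tr_mul_skew // trC -/t.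
under eq_bigr do rewrite sumr_const card_ord.
rewrite sumrMnl -/(mxtrace (x *m y)) -/t sumr_const card_ord -/(mxtrace (y *m x)) trC.
rewrite (_ : \sum_i \sum_i0 _ = - (t + t)); last first.
  rewrite -[X in - (t + X)]trC /t /mxtrace -big_split /= -sumrN; apply: eq_bigr => j _.
  rewrite (bigD1 j) //= eqxx mul1r big1 ?addr0 // => k kj.
  by rewrite eq_sym (negPf kj) mul0r oppr0.
by rewrite -mulr_natl; field.
Qed.

Lemma mxtrace_delta (R : pzSemiRingType) n (j k : 'I_n) :
  \tr (delta_mx j k : 'M[R]_n) = (j == k)%:R.
Proof.
rewrite /mxtrace (bigD1 j) //= mxE eqxx big1 ?addr0 // => i ij.
by rewrite mxE (negPf ij).
Qed.

Definition sym0_matrices (F : fieldType) n : {vspace 'M[F]_n} :=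
  (lker (linfun (@trmx F n n) - \1)%VF :&: lker (linfun (@mxtrace F n : _ -> F^o)))%VS.

Lemma sym0_matricesP (F : fieldType) n (z : 'M[F]_n) :
  reflect (z^T = z /\ \tr z = 0) (z \in sym0_matrices F n).
Proof.
rewrite memv_cap !memv_ker add_lfunE opp_lfunE id_lfunE !lfunE /= subr_eq0.
by apply: (iffP andP) => [[/eqP zT /eqP ztr]|[-> ->]].
Qed.

(** The dimension is the trace of the projection [pr], computed on matrix units. The formula is
    doubled to avoid dividing natural numbers. *)
Lemma dim_sym0 (F : numFieldType) n :
  (\dim (sym0_matrices F n.+1)).*2 = (n.+1 * n.+2 - 2)%N.
Proof.
pose m : F := n.+1%:R; have nzm : m != 0 by rewrite pnatr_eq0.
pose pr (z : 'M[F]_n.+1) := 2%:R^-1 *: (z + z^T) - (\tr z / m)%:M.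
have prL : linear pr.
  move=> c u v; rewrite /pr !linearP /=; apply/matrixP => i j; rewrite !mxE.
  by case: (i == j); rewrite ?mulr1n ?mulr0n; ring.
pose prM := GRing.isLinear.Build _ _ _ _ _ prL.
pose prl : {linear 'M[F]_n.+1 -> 'M[F]_n.+1} := HB.pack pr prM.
have prS z : pr z \in sym0_matrices F n.+1.
  apply/sym0_matricesP; rewrite /pr; split.
    by apply/matrixP => i j; rewrite !mxE eq_sym; ring.
  rewrite linearB linearZ linearD /= mxtrace_tr mxtrace_scalar -(mulr_natr (\tr z / m)) -/m.
  by move: (m) nzm => c nzc; field.
have prK z : z \in sym0_matrices F n.+1 -> pr z = z.
  move=> /sym0_matricesP[zT ztr]; rewrite /pr zT ztr mul0r raddf0 subr0.
  by rewrite -mulr2n -scaler_nat scalerA mulVf ?scale1r // pnatr_eq0.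
have := @sum_coord_trace _ _ _ prl prS.
under eq_bigr => i _.
  rewrite /= prK ?coord_free ?eqxx ?(basis_free (vbasisP _)) //; last first.
    by apply: vbasis_mem; rewrite mem_nth ?size_tuple.
  over.
rewrite sumr_const card_ord => dE.
have dE2 : (\dim (sym0_matrices F n.+1))%:R = 2%:R^-1 * (m * m + m) - 1 :> F.
  rewrite dE /=; transitivity (\sum_j \sum_k (2%:R^-1 * (1 + (j == k :> 'I_n.+1)%:R) -
      (j == k)%:R / m : F)).
    apply: eq_bigr => j _; apply: eq_bigr => k _.
    rewrite /pr trmx_delta mxtrace_delta !mxE !eqxx /= andbC.
    by case: (eqVneq j k) => _ /=; ring.
  have one j : \sum_(k < n.+1) (j == k)%:R = 1 :> F.
    rewrite (bigD1 j) //= eqxx big1 ?addr0 // => k kj.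
    by rewrite eq_sym (negPf kj).
  under eq_bigr do rewrite sumrB -mulr_sumr -mulr_suml big_split /= one
    sumr_const card_ord -/m.
  rewrite sumr_const card_ord -(mulr_natl (_ - _)) -/m.
  by move: (m) nzm => c nzc; field.
apply/eqP; rewrite -(eqr_nat F) natrB ?natrM; last by rewrite mulSn.
rewrite -addnn natrD dE2 -[n.+2%:R]natr1 -/m.
by apply/eqP; field.
Qed.

(** * The block model of the graded components *)

Section BlockModel.
Variables (F : numFieldType) (n : nat) (Q : 'M[F]_n).
Hypothesis QQ : Q *m Q = 1%:M.
Hypothesis QT : Q^T = Q.

Definition blockD : 'M[F]_(n + n) := block_mx 1%:M 0 0 (- 1%:M).
Definition blockJ : 'M[F]_(n + n) := block_mx 0 Q (- Q) 0.
Definition iota_mx (S : 'M[F]_n) : 'M[F]_(n + n) := block_mx S 0 0 (Q *m S *m Q).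

(* Simultaneous eigenvectors of [Ad blockD] and [Ad blockJ], with eigenvalues
   [(-1)^p] and [(-1)^q], that commute with the matrices [iota_mx S]. *)
Definition twist_mx (p q : bool) : 'M[F]_(n + n) :=
  match p, q with
  | false, false => 1%:M
  | false, true => blockD
  | true, false => blockJ
  | true, true => block_mx 0 Q Q 0
  end.

Definition kap (p q : bool) (S : 'M[F]_n) := iota_mx S *m twist_mx p q.

Lemma QQK m (x : 'M[F]_(n, m)) : Q *m (Q *m x) = x.
Proof. by rewrite mulmxA QQ mul1mx. Qed.

Lemma mulQQK m (x : 'M[F]_(m, n)) : x *m Q *m Q = x.
Proof. by rewrite -mulmxA QQ mulmx1. Qed.

Lemma kapE p q S : kap p q S =
  match p, q with
  | false, false => block_mx S 0 0 (Q *m S *m Q)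
  | false, true => block_mx S 0 0 (- (Q *m S *m Q))
  | true, false => block_mx 0 (S *m Q) (- (Q *m S)) 0
  | true, true => block_mx 0 (S *m Q) (Q *m S) 0
  end.
Proof.
rewrite /kap /iota_mx; case: p q => [] [] /=; rewrite ?mulmx1 // mulmx_block;
  by rewrite ?mulmx0 ?mul0mx ?addr0 ?add0r ?mulmxN ?mulmx1 // mulQQK.
Qed.

Lemma iota_mx_is_linear : linear iota_mx.
Proof.
move=> c x y; rewrite /iota_mx mulmxDr mulmxDl -scalemxAr -scalemxAl.
by rewrite scale_block_mx add_block_mx !scaler0 !addr0.
Qed.
HB.instance Definition _ := GRing.isLinear.Build F _ _ _ iota_mx iota_mx_is_linear.

Lemma kap_is_linear p q : linear (kap p q).
Proof. by move=> c x y; rewrite /kap linearP mulmxDl -scalemxAl. Qed.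
HB.instance Definition _ p q := GRing.isLinear.Build F _ _ _ (kap p q) (kap_is_linear p q).

Lemma iota_mxM x y : iota_mx (x *m y) = iota_mx x *m iota_mx y.
Proof.
rewrite /iota_mx mulmx_block !mulmx0 !mul0mx !addr0 !add0r; congr block_mx.
by rewrite !mulmxA mulQQK.
Qed.

Lemma twist_comm p q S : twist_mx p q *m iota_mx S = iota_mx S *m twist_mx p q.
Proof.
rewrite -/(kap p q S) kapE /iota_mx.
case: p q => [] [] /=; rewrite ?mul1mx // mulmx_block;
  by rewrite ?mulmx0 ?mul0mx ?addr0 ?add0r ?mulNmx ?mul1mx // ?mulmxA ?QQ ?mul1mx.
Qed.

Lemma lie_iota_kap p q x y : lie (iota_mx x) (kap p q y) = kap p q (lie x y).
Proof.
rewrite /lie /kap linearB /= !iota_mxM mulmxBl !mulmxA; congr (_ - _).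
by rewrite -!mulmxA twist_comm.
Qed.

Lemma kap00 S : kap false false S = iota_mx S.
Proof. by rewrite /kap mulmx1. Qed.

Lemma kap_inj p q : injective (kap p q).
Proof.
move=> x y; rewrite !kapE; case: p q => [] [] /eq_block_mx[E1 E2 E3 E4] //.
  by rewrite -[x]mulQQK E2 mulQQK.
by rewrite -[x]mulQQK E2 mulQQK.
Qed.

Lemma iota_inj : injective iota_mx.
Proof. by move=> x y; rewrite -!kap00 => /kap_inj. Qed.

(** Of the four twists only [blockJ], in degree (1, 0), is skew. Since the twists commute with
    [iota_mx S], skewness of the product forces [S] to be symmetric there and skew elsewhere. *)
Definition sym_sign (p q : bool) : F := if p && ~~ q then 1 else -1.

Lemma component_kap (p q : bool) (X : 'M[F]_(n + n)) :
  [/\ X^T = - X, blockD *m X *m blockD = (-1) ^+ p *: X &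
      blockJ *m X *m - blockJ = (-1) ^+ q *: X] <->
  exists S, S^T = sym_sign p q *: S /\ X = kap p q S.
Proof.
have nz2 (m : nat) (x : 'M[F]_(n, m)) : x = - x -> x = 0.
  move=> /eqP; rewrite -addr_eq0 -mulr2n -scaler_nat scaler_eq0 pnatr_eq0 /=.
  by move/eqP.
have trN (x : 'M[F]_n) : (- x)^T = - x^T by apply/matrixP => i j; rewrite !mxE.
have DE (x1 x2 x3 x4 : 'M[F]_n) : blockD *m block_mx x1 x2 x3 x4 *m blockD =
    block_mx x1 (- x2) (- x3) x4.
  rewrite /blockD !mulmx_block !mul0mx !mul1mx !mulmx0 !mulmx1 !addr0 !add0r.
  by rewrite !mulNmx !mulmxN !mul1mx !mulmx1 !opprK.
have JE (x1 x2 x3 x4 : 'M[F]_n) : blockJ *m block_mx x1 x2 x3 x4 *m - blockJ =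
    block_mx (Q *m x4 *m Q) (- (Q *m x3 *m Q)) (- (Q *m x2 *m Q)) (Q *m x1 *m Q).
  rewrite /blockJ opp_block_mx !mulmx_block !oppr0 !mul0mx !mulmx0 !addr0 !add0r.
  by rewrite !opprK !mulNmx !mulmxN !opprK.
rewrite -[X]submxK; move: (ulsubmx X) (ursubmx X) (dlsubmx X) (drsubmx X).
move=> x1 x2 x3 x4; rewrite DE JE tr_block_mx !opp_block_mx !scale_block_mx.
split=> [[/eq_block_mx[T1 T3 T2 T4] /eq_block_mx[D1 D2 D3 D4] /eq_block_mx[J1 J2 J3 J4]]|].
  case: p D1 D2 D3 D4 => D1 D2 D3 D4; rewrite ?expr1 ?expr0 ?scaleN1r ?scale1r in D1 D2 D3 D4.
    have x10 := nz2 _ _ D1; have x40 := nz2 _ _ D4.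
    (* In odd degree the matrix is block-antidiagonal with upper right block [S *m Q], and [Q] is
       its own inverse. *)
    exists (x2 *m Q); rewrite kapE x10 x40 mulQQK trmx_mul QT.
    have x2T : x2^T = - x3 by [].
    rewrite x2T; case: q J1 J2 J3 J4 => J1 J2 J3 J4; rewrite /sym_sign /=.
      have -> : x3 = Q *m x2 *m Q by apply: oppr_inj; rewrite J3 expr1 scaleN1r.
      by rewrite scaleN1r mulmxN -mulmxA QQK mulmxA.
    have -> : x3 = - (Q *m x2 *m Q) by rewrite J3 expr0 scale1r.
    by rewrite scale1r opprK -mulmxA QQK.
  have x20 := nz2 _ _ (esym D2); have x30 := nz2 _ _ (esym D3).
  exists x1; rewrite kapE x20 x30 /sym_sign /=; split; first by rewrite scaleN1r.
  case: q J1 J2 J3 J4 => J1 J2 J3 J4.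
    by rewrite expr1 scaleN1r in J4; rewrite J4 opprK.
  by rewrite expr0 scale1r in J4; rewrite J4.
case=> S [ST]; rewrite kapE.
case: p q ST => [] []; rewrite /sym_sign /= => ST /eq_block_mx[-> -> -> ->].
all: rewrite ?trN ?trmx_mul ?QT ?ST ?trmx0 ?expr1 ?expr0 ?scaleN1r ?scale1r.
all: rewrite ?oppr0 ?mulmx0 ?mul0mx ?mulmxN ?mulNmx ?opprK ?oppr0 ?mulmxA ?mulQQK ?QQ ?mul1mx.
all: by rewrite ?mulmxN ?opprK ?mulmxA; split.
Qed.

Lemma mxtrace_iota x y : \tr (iota_mx x *m iota_mx y) = \tr (x *m y) *+ 2.
Proof.
rewrite -iota_mxM /iota_mx mxtrace_block [\tr (Q *m _ *m Q)]mxtrace_mulC.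
by rewrite QQK mulr2n.
Qed.

Lemma iota_skew x : x \in skew_matrices F n -> iota_mx x \in skew_matrices F (n + n).
Proof.
move=> /skew_matricesP xT; apply/skew_matricesP.
rewrite /iota_mx tr_block_mx opp_block_mx !trmx_mul QT xT !trmx0 !oppr0.
by rewrite mulNmx mulmxN mulmxA.
Qed.

End BlockModel.

(** * Transport along injective morphisms *)

Section Transport.
Variables (F : fieldType) (n N : nat) (f : 'Hom('M[F]_n, 'M[F]_N)).
Hypothesis finj : injective f.
Hypothesis flie : forall x y, f (lie x y) = lie (f x) (f y).
Implicit Types (A U h : {vspace 'M[F]_n}).

Lemma mem_img_inj (g : 'Hom('M[F]_n, 'M[F]_N)) U x :
  injective g -> (g x \in (g @: U)%VS) = (x \in U).
Proof.
move=> ginj; apply/idP/idP => [/memv_imgP[y yU /ginj->] //|]; exact: memv_img.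
Qed.

(** The algebra is carried by [f] and the module by a separate intertwiner [g]: [g = f] gives the
    adjoint representation, another [g] the component of degree (1, 0). *)
Lemma lmod_irreducible_img (g : 'Hom('M[F]_n, 'M[F]_N)) A U : injective g ->
  (forall x y, lie (f x) (g y) = g (lie x y)) ->
  lmod_irreducible A U -> lmod_irreducible (f @: A) (g @: U).
Proof.
move=> ginj fg [AU U0 irr]; split.
- apply/lie_prodP => _ _ /memv_imgP[x xA ->] /memv_imgP[y yU ->].
  by rewrite fg mem_img_inj //; move: x y xA yU; apply/lie_prodP.
- apply: contraNneq U0 => gU; rewrite -subv0; apply/subvP => x xU.
  have : g x \in (g @: U)%VS by rewrite mem_img_inj.
  by rewrite gU !memv0 -(linear0 g) => /eqP/ginj->.
move=> W WgU AW; pose W' := (g @^-1: W)%VS.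
have WE : W = (g @: W')%VS.
  apply/vspaceP => y; apply/idP/memv_imgP => [yW|[x]]; last by rewrite -memv_preim => xW ->.
  have /memv_imgP[x _ yE] := subvP WgU _ yW.
  by exists x => //; rewrite -memv_preim -yE.
have [||E|E] := irr W'.
- by apply/subvP => x; rewrite -memv_preim => /(subvP WgU); rewrite mem_img_inj.
- apply/lie_prodP => x y xA; rewrite -!memv_preim -fg => yW.
  by move/lie_prodP: AW; apply => //; apply: memv_img.
- by left; rewrite WE E limg0.
- by right; rewrite WE E.
Qed.

Lemma lie_simple_img A : lie_simple A -> lie_simple (f @: A).
Proof.
case=> AA A0 irr.
have [] := @lmod_irreducible_img f A A finj (fun x y => esym (flie x y)).
  split=> //; apply: contraNneq A0 => A0; rewrite A0; rewrite -subv0.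
  by apply/lie_prodP => x y; rewrite !memv0 => /eqP-> _; rewrite /lie mul0mx mulmx0 subr0.
move=> fAA _ firr; split=> //.
apply: contraNneq A0 => fA0; rewrite -subv0; apply/lie_prodP => x y xA yA.
have : lie (f x) (f y) \in lie_prod (f @: A) (f @: A).
  by apply: mem_lie_prod; apply: memv_img.
by rewrite fA0 !memv0 -flie -(linear0 f) => /eqP/finj->.
Qed.

Lemma cartan_img A h : cartan A h -> cartan (f @: A) (f @: h).
Proof.
case=> hA hh [k hk] hn; split.
- exact: limgS.
- apply/lie_prodP => _ _ /memv_imgP[x xh ->] /memv_imgP[y yh ->].
  by rewrite -flie memv_img //; move: x y xh yh; apply/lie_prodP.
- exists k; apply/eqP; rewrite -subv0.
  suff H j : (iter j (lie_prod (f @: h)) (f @: h) <= f @: iter j (lie_prod h) h)%VS.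
    by apply: subv_trans (H k) _; rewrite hk limg0 subvv.
  elim: j => [|j IH] /=; first exact: subvv.
  apply/lie_prodP => _ y /memv_imgP[x xh ->] /(subvP IH)/memv_imgP[z zh ->].
  by rewrite -flie memv_img // mem_lie_prod.
move=> _ /memv_imgP[x xA ->] xn; rewrite mem_img_inj //; apply: hn => // y yh.
by rewrite -(mem_img_inj _ _ finj) flie xn // memv_img.
Qed.

Lemma cartan_preim A (h : {vspace 'M[F]_N}) : cartan (f @: A) h ->
  cartan A (f @^-1: h) /\ h = (f @: (f @^-1: h))%VS.
Proof.
case=> hA hh [k hk] hn.
have hE : h = (f @: (f @^-1: h))%VS.
  apply/vspaceP => y; apply/idP/memv_imgP => [yW|[x]]; last by rewrite -memv_preim => xW ->.
  have /memv_imgP[x _ yE] := subvP hA _ yW.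
  by exists x => //; rewrite -memv_preim -yE.
split=> //; split.
- by apply/subvP => x; rewrite -memv_preim => /(subvP hA); rewrite mem_img_inj.
- apply/lie_prodP => x y; rewrite -!memv_preim flie => xh yh.
  by move/lie_prodP: hh; apply.
- exists k; apply/eqP; rewrite -subv0.
  suff H j : (iter j (lie_prod (f @^-1: h)) (f @^-1: h) <= f @^-1: iter j (lie_prod h) h)%VS.
    apply/subvP => x /(subvP (H k)); rewrite hk -memv_preim !memv0 -(linear0 f).
    by move=> /eqP/finj->.
  elim: j => [|j IH] /=; first exact: subvv.
  apply/lie_prodP => x y; rewrite -memv_preim => xh /(subvP IH); rewrite -!memv_preim => yh.
  by rewrite flie mem_lie_prod.
move=> x xA xn; rewrite -memv_preim; apply: hn; first exact: memv_img.
by move=> y; rewrite {1}hE => /memv_imgP[z zh ->]; rewrite -flie memv_preim xn.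
Qed.

End Transport.

(** * Simplicity of the skew matrices, irreducibility of the traceless symmetric ones *)

Lemma skew_simple (F : numFieldType) l : (0 < l)%N ->
  lie_simple (skew_matrices F (1 + (l + l))).
Proof.
move=> l0; pose n := (1 + (l + l))%N; have nodd : odd n by rewrite /n !oddD addbb.
have n3 : (2 < n)%N by rewrite /n addnn add1n ltnS -[2%N]/(1.*2)%N leq_double.
(* [l > 0] provides three indices, and the bracket of [skew_delta i j] with [skew_delta j k] has
   entry 1 at (i, k). *)
pose o k (lt : (k < 3)%N) : 'I_n := Ordinal (leq_trans lt n3).
pose i := o 0%N isT; pose j := o 1%N isT; pose k := o 2%N isT.
split.
- by apply/lie_prodP => x y; apply: lie_skew.
- apply/eqP => E; have : lie (skew_delta F i j) (skew_delta F j k) \in lie_prod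
    (skew_matrices F n) (skew_matrices F n).
    by apply: mem_lie_prod; exact: skew_delta_skew.
  rewrite E memv0 => /eqP/matrixP/(_ i k); rewrite /lie /skew_delta.
  rewrite !mulmxBl !mulmxBr !mul_delta_mx_cond /= !mulr0n !mulr1n !mxE /= => /eqP.
  by rewrite !subr0 oner_eq0.
move=> I IA AI; have [->|nz] := eqVneq I 0%VS; [by left|right].
apply/eqP; rewrite eqEsubv IA /=.
apply: (@skew_in_module _ _ I _ nodd (vpick I)); rewrite ?vpick0 ?memv_pick //.
- by move=> x z xS zI; move/lie_prodP: AI; apply.
- by apply: (subvP IA); exact: memv_pick.
Qed.

Lemma sym0_irreducible (F : numFieldType) l : (0 < l)%N ->
  lmod_irreducible (skew_matrices F (1 + (l + l))) (sym0_matrices F (1 + (l + l))).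
Proof.
move=> l0; pose n := (1 + (l + l))%N; have nodd : odd n by rewrite /n !oddD addbb.
split.
- apply/lie_prodP => x y /skew_matricesP xT /sym0_matricesP[yT _]; apply/sym0_matricesP.
  rewrite /lie; split; last by rewrite linearB /= mxtrace_mulC subrr.
  by rewrite [LHS]linearB /= !trmx_mul xT yT mulNmx mulmxN opprK addrC.
- apply/eqP => E; have := dim_sym0 F (l + l).
  rewrite -[(l + l).+1]/(1 + (l + l))%N E dimv0 double0 => /esym/eqP.
  rewrite subn_eq0 leqNgt (leq_trans _ (leq_pmulr _ _)) //.
  by rewrite addnn add1n ltnS -[2%N]/(1.*2)%N leq_double.
move=> W WS AW; have [->|nz] := eqVneq W 0%VS; [by left|right].
apply/eqP; rewrite eqEsubv WS /=; apply/subvP => y /sym0_matricesP[yT ytr].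
have /sym0_matricesP[zT ztr] := subvP WS _ (memv_pick W).
apply: (@sym_in_module _ _ W _ nodd (vpick W)); rewrite ?vpick0 ?memv_pick //.
by move=> x z xS zI; move/lie_prodP: AW; apply.
Qed.

(** * Weights and roots *)

Section Weights.
Variables (F : numFieldType) (l : nat).
Local Notation n := (1 + (l + l))%N.
Variables (Q P : 'M[F]_n) (h : {vspace 'M[F]_(n + n)}).
Hypotheses (QQ : Q *m Q = 1%:M) (QT : Q^T = Q) (Pu : P \in unitmx).

Definition torus_mx (d : 'rV[F]_l) : 'M[F]_n := invmx P *m diag_mx (weight_row d) *m P.

Hypothesis hE : forall y, y \in h <-> exists d, y = iota_mx Q (torus_mx d).
Hypothesis torus_skew : forall d, torus_mx d \in skew_matrices F n.

Lemma torus_mxE d : P *m torus_mx d = diag_mx (weight_row d) *m P.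
Proof. by rewrite /torus_mx -mulmxA mulKVmx. Qed.

(** The coordinates of a torus element, read from its upper left block in the basis of eigenvectors.
    Defined on all matrices, so that linearity does not involve [h]. *)
Definition torus_row (y : 'M[F]_(n + n)) : 'rV[F]_l :=
  \row_k (P *m ulsubmx y *m invmx P) (rshift 1 (lshift l k)) (rshift 1 (lshift l k)).

Lemma torus_rowK d : torus_row (iota_mx Q (torus_mx d)) = d.
Proof.
apply/rowP => k; rewrite mxE /iota_mx block_mxKul torus_mxE mulmxK // mxE eqxx mulr1n.
by rewrite /weight_row row_mxEr row_mxEl.
Qed.

Lemma torus_row_is_linear : linear torus_row.
Proof.
move=> c x y; apply/rowP => k; rewrite /torus_row.
have -> : ulsubmx (c *: x + y) = c *: ulsubmx x + ulsubmx y.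
  by apply/matrixP => i j; rewrite !mxE.
rewrite mulmxDr mulmxDl -scalemxAr -scalemxAl.
by move: (P *m _ *m _) (P *m _ *m _) => u v; rewrite !mxE.
Qed.
HB.instance Definition _ := GRing.isLinear.Build F _ _ _ torus_row torus_row_is_linear.

Definition row_torus (d : 'rV[F]_l) : subvs_of h := vsproj h (iota_mx Q (torus_mx d)).

Lemma vsval_row_torus d : vsval (row_torus d) = iota_mx Q (torus_mx d).
Proof. by rewrite vsprojK //; apply/hE; exists d. Qed.

Lemma row_torusK d : torus_row (vsval (row_torus d)) = d.
Proof. by rewrite vsval_row_torus torus_rowK. Qed.

Lemma vsval_torus (y : subvs_of h) : vsval y = iota_mx Q (torus_mx (torus_row (vsval y))).
Proof. by have /hE[d dE] := subvsP y; rewrite {1}dE {1}dE torus_rowK. Qed.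

Definition torus_coord (k : 'I_l) (y : subvs_of h) : F^o := torus_row (vsval y) 0 k.

Lemma torus_coord_is_linear k : linear (torus_coord k).
Proof. by move=> c x y; rewrite /torus_coord !linearP /= !mxE. Qed.
HB.instance Definition _ k :=
  GRing.isLinear.Build F _ _ _ (torus_coord k) (torus_coord_is_linear k).

Definition eform (k : 'I_l) : dual h := linfun (torus_coord k).

Lemma eformE k (y : subvs_of h) : eform k y = torus_row (vsval y) 0 k.
Proof. by rewrite lfunE. Qed.

Definition wform (i : 'I_n) : dual h :=
  match fintype.split i with
  | inl _ => 0
  | inr j => match fintype.split j with inl k => eform k | inr k => - eform k end
  end.

Lemma wformE i (y : subvs_of h) : wform i y = weight_row (torus_row (vsval y)) 0 i.
Proof.
rewrite /wform /weight_row; case: split_ordP => j ->.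
  by rewrite row_mxEl lfunE mxE.
rewrite row_mxEr; case: split_ordP => k ->; first by rewrite row_mxEl eformE.
by rewrite row_mxEr opp_lfunE eformE [RHS]mxE.
Qed.

Definition torus_iota d := iota_mx Q (torus_mx d).

Lemma torus_iota_is_linear : linear torus_iota.
Proof.
move=> c x y; have W : weight_row (c *: x + y) = c *: weight_row x + weight_row y.
  rewrite /weight_row scale_row_mx add_row_mx scaler0 add0r; congr row_mx.
  by rewrite scale_row_mx add_row_mx scalerN opprD.
rewrite /torus_iota /torus_mx W linearP /= mulmxDr mulmxDl -scalemxAr -scalemxAl.
by rewrite linearP.
Qed.
HB.instance Definition _ := GRing.isLinear.Build F _ _ _ torus_iota torus_iota_is_linear.

Lemma dual_eform (al : dual h) :
  al = \sum_k (al (row_torus (delta_mx 0 k)) : F) *: eform k.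
Proof.
apply/lfunP => y; rewrite sum_lfunE.
have {1}-> : y = \sum_k (torus_row (vsval y) 0 k) *: row_torus (delta_mx 0 k).
  apply: subvs_inj; rewrite linear_sum /= [LHS]vsval_torus.
  rewrite {1}[torus_row _]row_sum_delta -[iota_mx _ _]/(torus_iota _) linear_sum.
  by apply: eq_bigr => k _; rewrite !linearZ /= vsval_row_torus.
rewrite linear_sum; apply: eq_bigr => k _.
by rewrite linearZ /= scale_lfunE eformE; exact: mulrC.
Qed.

(** Skewness of [A] turns [P *m A = D *m P] into [A *m P^T = - P^T *m D]. Hence the bracket with [A]
    multiplies the entry (i, j) of [P *m S *m P^T] by the sum of the weights [i] and [j]. *)
Lemma kap_weightP p q S (y : subvs_of h) (c : F) :
  lie (vsval y) (kap Q p q S) = c *: kap Q p q S <->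
  forall i j, (P *m S *m P^T) i j != 0 -> c = wform i y + wform j y.
Proof.
have [A AdE] : exists A, A = torus_mx (torus_row (vsval y)) by eexists.
have PTu : P^T \in unitmx by rewrite unitmx_tr.
have [W WE] : exists W, W = weight_row (torus_row (vsval y)) by eexists.
have PA : P *m A = diag_mx W *m P by rewrite AdE WE torus_mxE.
have AP : A *m P^T = - (P^T *m diag_mx W).
  have /skew_matricesP AT : A \in skew_matrices F n by rewrite AdE torus_skew.
  by rewrite -[A]opprK -AT mulNmx -trmx_mul PA trmx_mul tr_diag_mx.
have zE : P *m lie A S *m P^T = \matrix_(i, j)
    ((wform i y + wform j y) * (P *m S *m P^T) i j).
  have -> : P *m lie A S *m P^T = diag_mx W *m (P *m S *m P^T) + (P *m S *m P^T) *m diag_mx W.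
    rewrite /lie mulmxBr mulmxBl !mulmxA PA; congr (_ + _).
    by rewrite -!mulmxA AP !mulmxN opprK.
  move: (P *m S *m P^T) => z; apply/matrixP => i j.
  by rewrite mul_diag_mx mul_mx_diag !mxE !wformE -WE mulrDl [z i j * _]mulrC.
rewrite [vsval y]vsval_torus lie_iota_kap // -AdE -linearZ /=.
split=> [/kap_inj E i j|H].
  have := congr1 (fun x => (P *m x *m P^T) i j) (E QQ).
  by rewrite /= zE mxE -scalemxAr -scalemxAl [RHS]mxE => E' nz; apply: (mulIf nz).
congr kap; apply: (can_inj (mulKmx Pu)); apply: (can_inj (mulmxK PTu)).
rewrite zE -scalemxAr -scalemxAl; apply/matrixP => i j; rewrite mxE [RHS]mxE.
have [->|/H->//] := eqVneq ((P *m S *m P^T) i j) 0; by rewrite !mulr0.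
Qed.

(** [P *m S *m P^T] has the symmetry type of [S]. Its diagonal entries, with weight twice that of a
    row, can be nonzero only in the symmetric case. *)
Lemma kap_weights p q (al : dual h) :
  (exists S, [/\ S != 0, S^T = sym_sign F p q *: S &
     forall y : subvs_of h, lie (vsval y) (kap Q p q S) = (al y : F) *: kap Q p q S]) <->
  exists i j, (p && ~~ q \/ i != j) /\ al = wform i + wform j.
Proof.
have PTu : P^T \in unitmx by rewrite unitmx_tr.
split=> [[S [nz ST Sw]]|[i [j [ij ->]]]].
  set z := P *m S *m P^T.
  have [i [j zij]] : exists i j, z i j != 0.
    apply: contrapT => H; case/eqP: nz.
    apply: (can_inj (mulKmx Pu)); apply: (can_inj (mulmxK PTu)).
    rewrite mulmx0 mul0mx; apply/matrixP => i j; rewrite [RHS]mxE.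
    by apply/eqP/negPn/negP => zij; apply: H; exists i, j.
  exists i, j; split.
    have [|pq] := boolP (p && ~~ q); first by left.
    right; apply: contraNneq zij => ij; have /matrixP/(_ i i) : z^T = - z.
      by rewrite /z !trmx_mul trmxK ST /sym_sign (negPf pq) scaleN1r mulNmx mulmxN mulmxA.
    rewrite mxE [RHS]mxE -ij => /eqP; rewrite -subr_eq0 opprK -mulr2n.
    by rewrite mulrn_eq0.
  by apply/lfunP => y; rewrite add_lfunE; apply: ((kap_weightP p q S y _).1 (Sw y)).
pose e := sym_sign F p q.
(* For [i = j] this is 2 times a unit in the symmetric case; it would be zero in the skew case. *)
pose z : 'M[F]_n := delta_mx i j + e *: delta_mx j i.
have ee : e * e = 1 by rewrite /e /sym_sign; case: ifP; rewrite ?mulrNN mulr1.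
have zT : z^T = e *: z.
  by rewrite /z [LHS]linearD linearZ /= !trmx_delta scalerDr scalerA ee scale1r addrC.
have zij a b : z a b != 0 -> (a = i /\ b = j) \/ (a = j /\ b = i).
  rewrite !mxE; have [->|ai] := eqVneq a i; have [->|bj] := eqVneq b j => /=; first by left.
  - have [<-|] := eqVneq i j; have [->|] := eqVneq b i; rewrite ?mulr0 ?addr0 ?eqxx //; by
      right.
  - have [->|] := eqVneq a j; have [->|] := eqVneq j i; rewrite ?mulr0 ?addr0 ?eqxx //=; by
      right.
  - have [->|] := eqVneq a j; have [->|] := eqVneq b i; rewrite /= ?mulr0 ?addr0 ?eqxx //;
      by right.
have SE : P *m (invmx P *m z *m invmx P^T) *m P^T = z.
  by rewrite !mulmxA mulmxV // mul1mx mulmxKV.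
exists (invmx P *m z *m invmx P^T); split.
- apply/eqP => S0; have : z = 0 by rewrite -SE S0 mulmx0 mul0mx.
  move/matrixP/(_ i j); rewrite !mxE !eqxx /= => /eqP.
  case: ij => [pq|/negPf ij]; last by rewrite ij /= mulr0 addr0 oner_eq0.
  rewrite /e /sym_sign pq mul1r; case: (eqVneq i j) => _ /=; last by rewrite addr0 oner_eq0.
  by rewrite -mulr2n pnatr_eq0.
- by rewrite !trmx_mul !trmx_inv trmxK zT -scalemxAl -scalemxAr mulmxA.
move=> y; apply/kap_weightP => a b; rewrite SE add_lfunE => /zij[[-> ->]|[-> ->]] //.
by rewrite addrC.
Qed.

End Weights.

(** * The root system of type B and the lengths of its roots *)

Section RootSystem.
Variables (F : numFieldType) (l : nat).
Local Notation n := (1 + (l + l))%N.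
Variables (Q P : 'M[F]_n) (h : {vspace 'M[F]_(n + n)}).
Hypotheses (QQ : Q *m Q = 1%:M) (QT : Q^T = Q) (Pu : P \in unitmx).
Hypothesis hE : forall y, y \in h <-> exists d, y = iota_mx Q (torus_mx P d).
Hypothesis torus_skew : forall d, torus_mx P d \in skew_matrices F n.

Let E : 'I_l -> dual h := eform P h.
Let w : 'I_n -> dual h := wform P h.
Let yv d : subvs_of h := row_torus Q P h d.
Let coef (al : dual h) k : F := al (yv (delta_mx 0 k)).

Lemma coefD al be k : coef (al + be) k = coef al k + coef be k.
Proof. by rewrite /coef add_lfunE. Qed.

Lemma coefZ c al k : coef (c *: al) k = c * coef al k.
Proof. by rewrite /coef scale_lfunE. Qed.

Lemma coef_eform i k : coef (E i) k = (i == k)%:R.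
Proof. by rewrite /coef /E eformE row_torusK // mxE eqxx eq_sym. Qed.

Lemma eform_basis : basis_of fullv [tuple E k | k < l].
Proof.
rewrite /basis_of; apply/andP; split.
  rewrite eqEsubv subvf /=; apply/subvP => al _.
  rewrite (dual_eform Pu hE al); apply: memv_suml => k _; apply: memvZ.
  apply: memv_span; have -> : eform P h k = tnth [tuple E k | k < l] k by rewrite tnth_mktuple.
  exact: mem_tnth.
apply/freeP => c c0 k; have := congr1 (fun al => coef al k) c0.
have -> : coef 0 k = 0 by rewrite /coef lfunE.
rewrite /coef sum_lfunE (bigD1 k) //= big1 => [|i ik].
  rewrite addr0 -[LHS]/(coef (c k *: _) k) coefZ.
  by rewrite (nth_mktuple E 0 k) coef_eform eqxx mulr1.
rewrite -[LHS]/(coef (c i *: _) k) coefZ.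
by rewrite (nth_mktuple E 0 i) coef_eform (negPf ik) mulr0.
Qed.

Definition root_B (al : dual h) : Prop :=
  (exists (i : 'I_l) (b : bool), al = (-1) ^+ b *: E i) \/
  (exists (i j : 'I_l) (b c : bool), (i < j)%N /\ al = (-1) ^+ b *: E i + (-1) ^+ c *: E j).

Lemma wform_cases i : (w i = 0 /\ i = lshift (l + l) 0) \/
  exists k (b : bool), w i = (-1) ^+ b *: E k /\
    i = rshift 1 (if b then rshift l k else lshift l k).
Proof.
rewrite /w /wform; case: split_ordP => j ->; first by left; rewrite ord1.
right; case: split_ordP => k ->; exists k.
  by exists false; rewrite expr0 scale1r.
by exists true; rewrite expr1 scaleN1r.
Qed.

Lemma wform_surj k (b : bool) :
  w (rshift 1 (if b then rshift l k else lshift l k)) = (-1) ^+ b *: E k.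
Proof.
have splitL m p (j : 'I_m) : fintype.split (lshift p j) = inl j by exact: (unsplitK (inl j)).
have splitR m p (j : 'I_p) : fintype.split (rshift m j) = inr j by exact: (unsplitK (inr j)).
by rewrite /w /wform splitR; case: b; rewrite ?splitR ?splitL ?expr1 ?expr0 ?scaleN1r ?scale1r.
Qed.

Lemma wform_zero : w (lshift (l + l) 0) = 0.
Proof.
have splitL m p (j : 'I_m) : fintype.split (lshift p j) = inl j by exact: (unsplitK (inl j)).
by rewrite /w /wform splitL.
Qed.

Lemma wform_sum_cases i j : w i + w j != 0 ->
  root_B (w i + w j) \/ (i = j /\ exists k (b : bool), w i + w j = (-1) ^+ b *: (2%:R *: E k)).
Proof.
have [[-> _]|[k [b [-> ->]]]] := wform_cases i;
  have [[-> _]|[m [c [-> ->]]]] := wform_cases j.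
- by rewrite addr0 eqxx.
- by rewrite add0r => _; left; left; exists m, c.
- by rewrite addr0 => _; left; left; exists k, b.
have [<-|km] := eqVneq k m.
  have [<-|bc] := eqVneq b c; last first.
    by case: b c bc => [] [] //; rewrite expr0 expr1 scaleN1r scale1r ?subrr ?addNr eqxx.
  move=> _; right; split=> //; exists k, b.
  by rewrite -scalerDr -mulr2n scaler_nat.
move=> _; left; right; have [lt|lt|/val_inj kmE] := ltngtP k m.
- by exists k, m, b, c.
- by exists m, k, c, b; rewrite addrC.
- by rewrite kmE eqxx in km.
Qed.

Lemma root_B_neq0 al : root_B al -> al != 0.
Proof.
have z k : coef 0 k = 0 by rewrite /coef lfunE.
case=> [[i [b ->]]|[i [j [b [c [lt ->]]]]]]; apply/eqP => /(congr1 (fun x => coef x i)).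
  by rewrite coefZ coef_eform eqxx mulr1 z => /eqP; rewrite signr_eq0.
rewrite coefD !coefZ !coef_eform eqxx mulr1 z.
have -> : (j == i) = false by apply: contraTF lt => /eqP->; rewrite ltnn.
by rewrite mulr0 addr0 => /eqP; rewrite signr_eq0.
Qed.

Lemma skew_weights al : al != 0 /\ (exists i j, i != j /\ al = w i + w j) <-> root_B al.
Proof.
split=> [[nz [i [j [ij E']]]]|aB].
  rewrite E' in nz *; have [//|[ijE _]] := wform_sum_cases nz.
  by rewrite ijE eqxx in ij.
split; first exact: root_B_neq0.
case: aB => [[k [b ->]]|[k [m [b [c [lt ->]]]]]].
  (* The short roots pair the zero weight with a weight e_k or -e_k. *)
  exists (lshift (l + l) 0), (rshift 1 (if b then rshift l k else lshift l k)).
  rewrite wform_surj wform_zero add0r; split=> //.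
exists (rshift 1 (if b then rshift l k else lshift l k)).
exists (rshift 1 (if c then rshift l m else lshift l m)).
rewrite !wform_surj; split=> //.
have km : k != m by apply: contraTneq lt => ->; rewrite ltnn.
rewrite (inj_eq (@rshift_inj _ _)).
by case: b c => [] []; rewrite ?eq_rlshift ?eq_lrshift // ?(inj_eq (@rshift_inj _ _)) //
    (inj_eq (@lshift_inj _ _)).
Qed.

Lemma sym_weights al : al != 0 /\ (exists i j, al = w i + w j) <->
  root_B al \/ exists k (b : bool), al = (-1) ^+ b *: (2%:R *: E k).
Proof.
split=> [[nz [i [j E']]]|[aB|[k [b ->]]]].
- rewrite E' in nz *; have [aB|[_ H]] := wform_sum_cases nz; [by left|by right].
- have [nz [i [j [_ alE]]]] := (skew_weights al).2 aB.
  by split=> //; exists i, j.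
split.
  apply/eqP => /(congr1 (fun x => coef x k)); rewrite !coefZ coef_eform eqxx mulr1.
  have -> : coef 0 k = 0 by rewrite /coef lfunE.
  by move/eqP; rewrite mulf_eq0 signr_eq0 pnatr_eq0.
exists (rshift 1 (if b then rshift l k else lshift l k)).
exists (rshift 1 (if b then rshift l k else lshift l k)).
by rewrite wform_surj -mulr2n scalerA mulrC -scalerA scaler_nat.
Qed.

Lemma root_type_B_root_B : root_type_B l [set al | root_B al]%classic.
Proof.
exists [tuple E k | k < l]; split; first exact: eform_basis.
apply/seteqP; split=> al /=; rewrite /root_B.
  case=> [[i [b ->]]|[i [j [b [c [lt ->]]]]]]; [left|right].
    by exists i, b; rewrite tnth_mktuple.
  by exists i, j, b, c; rewrite !tnth_mktuple.
case=> [[i [b]]|[i [j [b [c [lt]]]]]]; rewrite !tnth_mktuple => ->; [left|right].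
  by exists i, b.
by exists i, j, b, c.
Qed.

Let g := skew_matrices F (n + n).
(** The Killing form of so(4l+2) is 4l times the trace form; [iota_mx] doubles traces, and the
    eigenvalues [d] and [-d] double the sum of squares. *)
Let kappa : F := (16 * l)%:R.

Lemma killing_torus d d' :
  killing g (iota_mx Q (torus_mx P d)) (iota_mx Q (torus_mx P d')) =
    kappa * \sum_k d 0 k * d' 0 k.
Proof.
rewrite killing_skew ?iota_skew // mxtrace_iota //.
have -> : \tr (torus_mx P d *m torus_mx P d') = (\sum_k d 0 k * d' 0 k) *+ 2.
  have -> : torus_mx P d *m torus_mx P d' =
      invmx P *m (diag_mx (weight_row d) *m diag_mx (weight_row d') *m P).
    by rewrite /torus_mx !mulmxA mulmxK.
  rewrite mxtrace_mulC mulmxK // mulmx_diag mxtrace_diag.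
  rewrite big_split_ord big_ord1 big_split_ord /= mxE /weight_row !row_mxEl [X in X * _]mxE.
  rewrite mul0r add0r mulr2n; congr (_ + _); apply: eq_bigr => k _.
    by rewrite mxE !row_mxEr !row_mxEl.
  by rewrite mxE !row_mxEr !mxE mulrNN.
rewrite /kappa natrM; move: (\sum_k _) => s.
rewrite !natrD -[(s *+ 2) *+ 2]mulrnA -[s *+ _]mulr_natl.
by ring.
Qed.

Hypothesis l_gt0 : (0 < l)%N.

Let kappa_gt0 : 0 < kappa.
Proof. by rewrite ltr0n muln_gt0 l_gt0. Qed.
Let kappa_neq0 : kappa != 0. Proof. exact: lt0r_neq0. Qed.

(** [form_rep] is a choice with default 0, so its property requires a representing vector: the one
    whose coordinates are those of [al] divided by [kappa]. *)
Lemma form_repP (al : dual h) (y : subvs_of h) :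
  (al y : F) = killing g (vsval (form_rep g al)) (vsval y).
Proof.
move: y; rewrite /form_rep; set S := [set t | _]%classic.
suff : S (xget 0 S) by [].
apply: (@xgetPex _ 0 S); exists (yv (\row_k (coef al k / kappa))) => y.
rewrite vsval_row_torus // [vsval y](vsval_torus Pu hE) killing_torus.
rewrite {1}(dual_eform Pu hE al) sum_lfunE mulr_sumr; apply: eq_bigr => k _.
rewrite scale_lfunE eformE [X in _ = _ * (X * _)]mxE mulrA mulrC (mulrC kappa) divfK //.
exact: mulrC.
Qed.

Lemma dual_formE (al be : dual h) :
  dual_form g h al be = kappa^-1 * \sum_k coef al k * coef be k.
Proof.
have repE ga k : torus_row P (vsval (form_rep g ga)) 0 k = coef ga k / kappa.
  rewrite /coef form_repP vsval_row_torus // [vsval (form_rep g ga)](vsval_torus Pu hE).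
  rewrite killing_torus torus_rowK //; move: (torus_row P _) => r.
  rewrite (bigD1 k) //= mxE !eqxx mulr1 big1 => [|m mk]; last first.
    by rewrite mxE (negPf mk) andbF mulr0.
  by rewrite addr0 mulrC mulKf.
rewrite /dual_form [vsval (form_rep g al)](vsval_torus Pu hE).
rewrite [vsval (form_rep g be)](vsval_torus Pu hE) killing_torus.
rewrite !mulr_sumr; apply: eq_bigr => k _; rewrite !repE.
by move: (kappa) kappa_neq0 => c c0; field.
Qed.

Lemma coef_sign_eform (b : bool) c i k : coef ((-1) ^+ b *: (c *: E i)) k = (-1) ^+ b * c *
    (i == k)%:R.
Proof. by rewrite !coefZ coef_eform mulrA. Qed.

Lemma dual_form_short (b : bool) (c : F) i :
  dual_form g h ((-1) ^+ b *: (c *: E i)) ((-1) ^+ b *: (c *: E i)) = c ^+ 2 / kappa.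
Proof.
rewrite dual_formE (bigD1 i) //= big1 => [|k ki].
  by rewrite !coef_sign_eform eqxx addr0 mulr1 mulrACA -expr2 sqrr_sign mul1r mulrC.
by rewrite !coef_sign_eform eq_sym (negPf ki) !mulr0.
Qed.

Lemma dual_form_long (b c : bool) (i j : 'I_l) : (i < j)%N ->
  dual_form g h ((-1) ^+ b *: E i + (-1) ^+ c *: E j) ((-1) ^+ b *: E i + (-1) ^+ c *: E j) =
    2%:R / kappa.
Proof.
move=> lt; have ij : i != j by apply: contraTneq lt => ->; rewrite ltnn.
rewrite dual_formE (bigD1 i) //= (bigD1 j) 1?eq_sym //= big1 => [|k /andP[ki kj]].
  rewrite !coefD !coefZ !coef_eform !eqxx (negPf ij) eq_sym (negPf ij).
  by rewrite !mulr0 !mulr1 !addr0 !add0r -!expr2 !sqrr_sign mulrC.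
by rewrite !coefD !coefZ !coef_eform ![_ == k]eq_sym (negPf ki) (negPf kj) !mulr0 addr0 mulr0.
Qed.

Lemma root_B_short_or_long al : root_B al ->
  (exists (k : 'I_l) (b : bool), al = (-1) ^+ b *: (1 *: E k)) /\ dual_form g h al al =
      kappa^-1 \/
  dual_form g h al al = 2%:R / kappa.
Proof.
case=> [[i [b ->]]|[i [j [b [c [lt ->]]]]]]; last by right; apply: dual_form_long.
left; split; first by exists i, b; rewrite scale1r.
by have := dual_form_short b 1 i; rewrite expr1n mul1r scale1r.
Qed.

(** The two possible norms are [1 / kappa] and [2 / kappa], and a root of the smaller norm exists
    because [l > 0]. For [l = 1] there is no pair [i < j], so every root is short, in accordance
    with the convention for B_1. *)
Lemma short_root_B al :
  root_B al /\ (forall be, root_B be -> dual_form g h al al <= dual_form g h be be) <->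
  exists (k : 'I_l) (b : bool), al = (-1) ^+ b *: E k.
Proof.
split=> [[aB min]|[k [b alE]]].
  have [[[k [b alE]] _]|E2] := root_B_short_or_long aB.
    by exists k, b; rewrite alE scale1r.
  pose k0 : 'I_l := Ordinal l_gt0.
  have /min : root_B (E k0) by left; exists k0, false; rewrite expr0 scale1r.
  have := dual_form_short false 1 k0; rewrite expr0 !scale1r expr1n mul1r => ->.
  rewrite E2 -[leRHS]mul1r ler_pM2r ?invr_gt0 // lern1 //.
have aB : root_B al by left; exists k, b.
split=> // be /root_B_short_or_long[[_ ->]|->].
  by rewrite alE -[E k]scale1r dual_form_short expr1n mul1r.
rewrite alE -[E k]scale1r dual_form_short expr1n ler_pM2r ?invr_gt0 //.
by rewrite ler1n.
Qed.

Lemma dual_form_root_B_neq0 al : root_B al -> dual_form g h al al != 0.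
Proof.
case/root_B_short_or_long => [[_ ->]|->]; first by rewrite invr_eq0.
by rewrite mulf_neq0 ?invr_eq0 // pnatr_eq0.
Qed.

Lemma dual_form0 : dual_form g h 0 0 = 0.
Proof.
rewrite dual_formE big1 ?mulr0 // => k _.
by rewrite {1}/coef lfunE mul0r.
Qed.

End RootSystem.

(** * The toroidal Lie algebra *)

Section ToroidalBracket.
Variables (F : fieldType) (N : nat) (g : {vspace 'M[F]_N}).

Lemma killing0l (y : 'M[F]_N) : killing g 0 y = 0.
Proof.
rewrite /killing big1 // => i _.
by rewrite [X in coord _ _ X](_ : _ = 0) ?linear0 // /lie mul0mx mulmx0 subr0.
Qed.

(** The sum over all degrees is meaningful only through finite support, here inherited from [x]. *)
Lemma coef_fsum_monoL (V : lmodType F) (f : Z2 -> V) (x : laurent V) r :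
  (forall q, x q = 0 -> f q = 0) ->
  (\sum_(q \in [set: Z2]) monoL q (f q)) r = f r.
Proof.
move=> fx; pose A := [set q : Z2 | x q != 0]%classic.
have Af : finite_set A by case: x @A {fx} => c /= /fin_suppP.
have fA q : ~ A q -> f q = 0 by move=> /negP/negPn/eqP/fx.
rewrite -(fsbig_widen A) => [|//|q [_ /= /fA->]]; last first.
  by apply/val_inj/funext => s /=; case: ifP.
rewrite (fsbig_finite _ _ Af) /= -[LHS]/(val _ r) raddf_sum fct_sumE /=.
have [Ar|nAr] := pselect (A r); last first.
  rewrite (fA _ nAr) big_seq big1 // => q; rewrite in_fset_set // inE => Aq.
  by case: eqP => // rq; rewrite -rq in Aq.
rewrite (bigD1_seq r) ?finmap.fset_uniq //=; last by rewrite in_fset_set // inE.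
rewrite eqxx big1 ?addr0 // => q qr.
by rewrite eq_sym (negPf qr).
Qed.

Lemma fsum_monoL0 (V W : lmodType F) (v : V) (f : Z2 -> V -> W) :
  (forall p, f p 0 = 0) -> \sum_(p \in [set: Z2]) f p (monoL 0 v p) = f 0 v.
Proof.
move=> f0; rewrite -(fsbig_widen [set (0 : Z2)]%classic) => [|//|p [_ /= p0]].
  by rewrite fsbig_set1.
by case: eqP => // _; rewrite f0.
Qed.

Lemma class0 : Defs.class (0 : Omega F) = 0.
Proof. by apply: (addrI (Defs.class 0)); rewrite -classD !addr0. Qed.

(** An element of the full Cartan subalgebra sits in degree 0, so only [p = 0] survives in the
    double sums. The central term vanishes because the logarithmic differential of t^0 is zero. *)
Lemma tbracket_cartan (v : 'M[F]_N) (k : F2 F) (c d : F) (x z : toroidal F N) :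
  tbracket g (monoL 0 v, Defs.class (monoL 0 k), (c, d)) x = z ->
  [/\ forall r, z.1.1 r = lie v (x.1.1 r) + (c * r.1%:~R + d * r.2%:~R) *: x.1.1 r,
      z.1.2 = c *: degK false x.1.2 + d *: degK true x.1.2 & z.2 = 0].
Proof.
move=> <-; case: x => [[x1 xk] [a0 a1]] /=; split=> // [r|].
  rewrite (@fsum_monoL0 _ _ v (fun p u =>
     \sum_(q \in [set: Z2]) monoL (p + q) (lie u (x1 q)))); last first.
    move=> p; apply: fsbig1 => q _; apply/val_inj/funext => s /=.
    by rewrite /lie mul0mx mulmx0 subr0; case: ifP.
  under eq_fsbigr do rewrite add0r.
  have z1 : r.1%:~R *: (if r == 0 then v else 0) = 0.
    by case: eqP => [->|_]; rewrite ?scaler0 // scale0r.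
  have z2 : r.2%:~R *: (if r == 0 then v else 0) = 0.
    by case: eqP => [->|_]; rewrite ?scaler0 // scale0r.
  rewrite !fctE /= z1 z2 !scaler0 addr0 subr0.
  rewrite (@coef_fsum_monoL _ (fun q => lie v (x1 q)) x1); last first.
    by move=> q ->; rewrite /lie mul0mx mulmx0 subr0.
  by rewrite scalerDl !scalerA.
rewrite (@fsum_monoL0 _ _ v (fun p u => \sum_(q \in [set: Z2])
   killing g u (x1 q) *: Defs.class (monoL (p + q) (dlog F p)))); last first.
  by move=> p; apply: fsbig1 => q _; rewrite killing0l scale0r.
rewrite fsbig1 => [|q _].
  have d0 j : degK j (Defs.class (monoL (0 : Z2) k)) = 0.
    rewrite degK_class; have -> : degL j (monoL 0 k) = 0 :> Omega F; last exact: class0.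
    apply/val_inj/funext => s /=; case: eqP => [->|_]; last by rewrite scaler0.
    by case: j; rewrite scale0r.
  by rewrite !d0 !scaler0 add0r addr0 subr0.
have -> : monoL (0 + q) (dlog F 0) = 0 :> Omega F.
  by apply/val_inj/funext => s /=; case: ifP.
by rewrite class0 scaler0.
Qed.

End ToroidalBracket.

Section TwistedRoots.
Variables (R : realType) (N : nat) (g : {vspace 'M[R[i]]_N}).
Variables (s0 s1 : 'End('M[R[i]]_N)) (h : {vspace 'M[R[i]]_N}).

Lemma twisted_toroidal_weight (al : dual h) (a b : R[i]) : al != 0 ->
  (exists x, [/\ twisted_toroidal g s0 s1 x, x != 0 &
     forall y, tbracket g (full_cartan_val y) x = Veval (al, (a, b)) y *: x]) <->
  exists m n : int, [/\ a = m%:~R, b = n%:~R & exists X, [/\ X \in component g s0 s1 m n,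
    X != 0 & forall y : subvs_of h, lie (vsval y) X = (al y : R[i]) *: X]].
Proof.
move=> alnz; split=> [[x [[xc xk] xnz xw]]|[m [n [aE bE [X [Xc Xnz Xw]]]]]].
  have xwE (y : subvs_of h) c d : [/\ forall r, lie (vsval y) (x.1.1 r) +
       (c * r.1%:~R + d * r.2%:~R) *: x.1.1 r = ((al y : R[i]) + a * c + b * d) *: x.1.1 r,
      c *: degK false x.1.2 + d *: degK true x.1.2 = ((al y : R[i]) + a * c + b * d) *: x.1.2 &
      0 = ((al y : R[i]) + a * c + b * d) *: x.2].
    have [E1 E2 E3] := tbracket_cartan (xw (y, 0, (c, d))).
    by split=> [r||]; [exact: esym (E1 r)|exact: esym E2|exact: esym E3].
  have [y0 y0nz] : exists y0, (al y0 : R[i]) != 0.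
    apply: contrapT => H; case/eqP: alnz; apply/lfunP => y; rewrite lfunE /=.
    by apply/eqP/negPn/negP => nz; apply: H; exists y.
  (* Bracketing with an element of [h] yields nothing in [K] or in the derivations, while the
     eigenvalue [al y0] is nonzero; so both parts of [x] vanish. *)
  have [_ k0 d0] := xwE y0 0 0.
  rewrite !mulr0 !addr0 !scale0r addr0 in k0 d0.
  have xk0 : x.1.2 = 0.
    by apply/eqP; move/esym/eqP: k0; rewrite scaler_eq0 (negPf y0nz).
  have xd0 : x.2 = 0.
    by apply/eqP; move/esym/eqP: d0; rewrite scaler_eq0 (negPf y0nz).
  have [r rnz] : exists r, x.1.1 r != 0.
    apply: contrapT => H; case/eqP: xnz.
    rewrite [x]surjective_pairing [x.1]surjective_pairing xk0 xd0.
    have -> : x.1.1 = 0; last by [].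
    apply/val_inj/funext => r; apply/eqP/negPn/negP => nz; apply: H; by exists r.
  have canc c d : c *: x.1.1 r = d *: x.1.1 r -> c = d.
    move=> /eqP; rewrite -subr_eq0 -scalerBl scaler_eq0 (negPf rnz) orbF subr_eq0.
    by move/eqP.
  have al0 : al 0 = 0 by rewrite linear0.
  have lie0 (z : 'M[R[i]]_N) : lie (vsval (0 : subvs_of h)) z = 0.
    by rewrite /lie linear0 mul0mx mulmx0 subr0.
  (* Evaluating at d_0 and d_1 identifies [a] and [b] with the exponents of a nonzero coefficient of
     [x]. *)
  exists r.1, r.2; split.
  - have [/(_ r) E _ _] := xwE 0 1 0; move: E.
    by rewrite al0 lie0 !add0r mul0r mul1r mulr0 mulr1 !addr0 => /canc.
  - have [/(_ r) E _ _] := xwE 0 0 1; move: E.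
    by rewrite al0 lie0 !add0r mul0r mul1r mulr0 mulr1 !add0r => /canc.
  exists (x.1.1 r); split=> // [|y]; first by case: (r) => p q; apply: xc.
  have [/(_ r) E _ _] := xwE y 0 0; move: E.
  by rewrite !mul0r !mulr0 !addr0 scale0r addr0.
exists (monoL (m, n) X, 0, 0); split.
- split=> [p q|].
    change ((if (p, q) == (m, n) then X else 0) \in component g s0 s1 p q).
    by have [[-> ->]|_] := eqVneq (p, q) (m, n); [exact: Xc|exact: mem0v].
  by exists 0%N, (fun=> 0), (fun=> 0); split=> [[]//|]; rewrite big_ord0.
- apply/eqP => /(congr1 (fun x : toroidal R[i] N => x.1.1 (m, n))) E.
  have : (if (m, n) == (m, n) then X else 0) = 0 by exact: E.
  by rewrite eqxx; exact/eqP.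
move=> y'; move zE: (tbracket g (full_cartan_val y') _) => z.
case: y' zE => [[y k] [c d]] zE; have [E1 E2 E3] := tbracket_cartan zE.
have z12 : z.1.2 = 0.
  have d0 j : degK j (0 : Kahler R[i]) = 0.
    rewrite -[in LHS]class0 degK_class; have -> : degL j 0 = 0 :> Omega R[i]; last exact:
        class0.
    by apply/val_inj/funext => s /=; rewrite scaler0.
  by rewrite E2 /= !d0 !scaler0 addr0.
rewrite [z]surjective_pairing [z.1]surjective_pairing E3 z12.
have -> : z.1.1 = Veval (al, (a, b)) (y, k, (c, d)) *: monoL (m, n) X; last first.
  by rewrite -[RHS]/(_ *: monoL (m, n) X, _ *: (0 : Kahler R[i]), _ *: (0 : F2 R[i])) !scaler0.
apply/val_inj/funext => r; rewrite [LHS]E1.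
pose v := if r == (m, n) then X else 0.
change (lie (vsval y) v + (c * r.1%:~R + d * r.2%:~R) *: v =
  ((al y : R[i]) + a * c + b * d) *: v).
rewrite /v; have [->|_] := eqVneq r (m, n); last by rewrite /lie mul0mx mulmx0 subr0
    !scaler0 addr0.
by rewrite Xw aE bE -scalerDl; congr (_ *: _); ring.
Qed.

End TwistedRoots.

(** * The matrices of the two automorphisms *)

Definition antidiag (F : fieldType) n : 'M[F]_n :=
  \matrix_(i, j) ((-1) ^+ i.+1 *+ (j == rev_ord i)).

(** For odd [n] reversal preserves the parity of the index; this makes the alternating antidiagonal
    matrix symmetric with square 1. *)
Lemma sign_rev_ord (F : fieldType) n (i : 'I_n) : odd n -> (-1) ^+ rev_ord i = (-1) ^+ i :> F.
Proof.
move=> on; rewrite -signr_odd -[in RHS]signr_odd /= oddB // on /=.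
by rewrite negbK.
Qed.

Lemma antidiag_sqr (F : fieldType) n : odd n -> antidiag F n *m antidiag F n = 1%:M.
Proof.
move=> on; apply/matrixP => i k; rewrite mxE (bigD1 (rev_ord i)) //= big1 ?addr0 => [|j ji].
  rewrite !mxE eqxx rev_ordK !exprS sign_rev_ord // eq_sym.
  case: eqP => _ /=; last by rewrite mulr0.
  by rewrite mulrACA -!expr2 sqrr_sign sqrrN expr1n mulr1.
by rewrite !mxE (negPf ji) mulr0n mul0r.
Qed.

Lemma trmx_antidiag (F : fieldType) n : odd n -> (antidiag F n)^T = antidiag F n.
Proof.
move=> on; apply/matrixP => i j; rewrite !mxE.
have [->|ij] := eqVneq j (rev_ord i).
  by rewrite rev_ordK eqxx !exprS sign_rev_ord.
case: eqP => // ij'; case/eqP: ij; by rewrite ij' rev_ordK.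
Qed.

Lemma sigma0_matrix (F : numFieldType) n :
  \sum_(1 <= i < n.+1) (munit F (n + n) i i - munit F (n + n) (n + i) (n + i)) = blockD F n.
Proof.
rewrite big_add1 /= big_mkord; apply/matrixP => r c.
have dE (x : nat) (y : nat) : (x < n)%N ->
    \sum_(i < n) ((x == i :> nat) && (y == i :> nat))%:R = (x == y)%:R :> F.
  move=> xn; rewrite (bigD1 (Ordinal xn)) //= eqxx big1 ?addr0 1?eq_sym // => i ix.
  by case: eqP => // xi; case/eqP: ix; apply: val_inj.
have dz (x : nat) (y : nat) : (n <= x)%N ->
    \sum_(i < n) ((x == i :> nat) && (y == i :> nat))%:R = 0 :> F.
  by move=> xn; rewrite big1 // => i _; case: eqP => // xi; have := ltn_ord i; rewrite -xi
      ltnNge xn.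
rewrite summxE; under eq_bigr do rewrite !mxE !addnS !eqSS.
rewrite sumrB /blockD.
case: (split_ordP r) => i ->; case: (split_ordP c) => j ->;
  rewrite ?block_mxEul ?block_mxEur ?block_mxEdl ?block_mxEdr /=.
- rewrite dE // big1 ?subr0 ?mxE // => k _.
  by rewrite eqn_leq [(n + k <= _)%N]leqNgt (leq_trans (ltn_ord i) (leq_addr _ _)) andbF.
- rewrite dE // big1 ?subr0 ?mxE // => [|k _].
    by rewrite eqn_leq [(n + j <= _)%N]leqNgt (leq_trans (ltn_ord i) (leq_addr _ _)) andbF.
  by rewrite eqn_leq [(n + k <= _)%N]leqNgt (leq_trans (ltn_ord i) (leq_addr _ _)) andbF.
- rewrite dz ?leq_addr // big1 ?subr0 ?mxE // => k _.
  by rewrite [X in _ && X]eqn_leq [(n + k <= _)%N]leqNgt (leq_trans (ltn_ord j) (leq_addr _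
      _)) !andbF.
rewrite dz ?leq_addr //; under eq_bigr do rewrite !eqn_add2l.
by rewrite dE // !mxE sub0r.
Qed.

(** Rows of the lower half are shifted by the odd number [n], which changes the alternating sign and
    produces the block [- Q]. *)
Lemma sigma1_matrix (F : numFieldType) n : odd n ->
  \sum_(1 <= i < (n + n).+1) (-1) ^+ i *: munit F (n + n) i ((n + n).+1 - i) =
    blockJ (antidiag F n).
Proof.
move=> on; rewrite big_add1 /= big_mkord; apply/matrixP => r c; rewrite summxE.
rewrite (bigD1 r) //= big1 ?addr0 => [|i ir]; last first.
  by rewrite !mxE eqSS eq_sym (_ : (i == r :> nat) = false) ?mulr0 //; apply: contraNF ir
      => /eqP/val_inj->.
rewrite [LHS]mxE [X in _ * X]mxE eqxx /= subSS /blockJ.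
case: (split_ordP r) => i ->; case: (split_ordP c) => j ->;
  rewrite ?block_mxEul ?block_mxEur ?block_mxEdl ?block_mxEdr /=.
- have -> : (j.+1 == n + n - i)%N = false; last by rewrite mulr0 mxE.
  by apply/negbTE/eqP => E; have := ltn_ord i; have := ltn_ord j; lia.
- rewrite !mxE mulr_natr; congr (_ *+ _); congr nat_of_bool.
  by rewrite -val_eqE /=; have := ltn_ord i; lia.
- rewrite !mxE mulr_natr -mulNrn.
  have -> : (-1) ^+ (n + i).+1 = - (-1) ^+ i.+1 :> F.
    by rewrite !exprS exprD -[(-1) ^+ n]signr_odd on expr1; ring.
  congr (_ *+ _); congr nat_of_bool; rewrite -val_eqE /=.
  by have := ltn_ord i; lia.
have -> : ((n + j).+1 == n + n - (n + i))%N = false; last by rewrite mulr0 mxE.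
by apply/negbTE/eqP => E; have := ltn_ord i; have := ltn_ord j; lia.
Qed.

Lemma invmx_uniq (F : fieldType) n (A B : 'M[F]_n) : A *m B = 1%:M -> invmx A = B.
Proof.
by move=> AB; have [Au _] := mulmx1_unit AB; rewrite -[LHS]mulmx1 -AB mulKmx.
Qed.

Lemma blockD_sqr (F : numFieldType) n : blockD F n *m blockD F n = 1%:M.
Proof.
rewrite /blockD mulmx_block !mulmx0 !mul0mx !mulmx1 !addr0 add0r.
by rewrite mulmxN mulmx1 opprK -scalar_mx_block.
Qed.

Lemma blockJ_sqr (F : numFieldType) n (Q : 'M[F]_n) : Q *m Q = 1%:M ->
  blockJ Q *m blockJ Q = - 1%:M.
Proof.
move=> QQ; rewrite /blockJ mulmx_block !mulmx0 !mul0mx !addr0 !add0r mulNmx mulmxN QQ.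
by rewrite [in RHS]scalar_mx_block opp_block_mx !oppr0.
Qed.

Lemma invmx_blockD (F : numFieldType) n : invmx (blockD F n) = blockD F n.
Proof. exact/invmx_uniq/blockD_sqr. Qed.

Lemma invmx_blockJ (F : numFieldType) n (Q : 'M[F]_n) : Q *m Q = 1%:M ->
  invmx (blockJ Q) = - blockJ Q.
Proof. by move=> QQ; apply: invmx_uniq; rewrite mulmxN blockJ_sqr // opprK. Qed.

(** * Existence of a Cartan subalgebra *)

Section StandardCartan.
Variables (F : numClosedFieldType) (l : nat).
Local Notation n := (1 + (l + l))%N.

Let G : 'M[F]_n := block_mx 1%:M 0 0 (block_mx 0 1%:M 1%:M 0).

(* The rows of this matrix form a hyperbolic basis of the standard quadratic form. *)
Definition hyperbolic_mx : 'M[F]_n :=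
  block_mx 1%:M 0 0
    (block_mx (2%:R^-1)%:M ('i / 2%:R)%:M 1%:M (- 'i)%:M).

Lemma hyperbolic_gram : hyperbolic_mx *m hyperbolic_mx^T = G.
Proof.
have nz2 : 2%:R != 0 :> F by rewrite pnatr_eq0.
rewrite /hyperbolic_mx !tr_block_mx !trmx0 !tr_scalar_mx !mulmx_block.
rewrite !mulmx0 !mul0mx !mul1mx !mulmx1 !addr0 !add0r /G.
rewrite -!scalar_mxM -!raddfD /=.
have ii : 'i * 'i = -1 :> F by rewrite -expr2 sqrCi.
have -> : 2%:R^-1 * 2%:R^-1 + 'i / 2%:R * ('i / 2%:R) = 0 :> F.
  by rewrite mulrACA ii; field.
have -> : 2%:R^-1 + 'i / 2%:R * - 'i = 1 :> F.
  by rewrite mulrAC mulrN ii; field.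
have -> : 2%:R^-1 + - 'i * ('i / 2%:R) = 1 :> F.
  by rewrite mulrA mulNr ii; field.
have -> : 1 + - 'i * - 'i = 0 :> F by rewrite mulrNN ii subrr.
by rewrite raddf0.
Qed.

Lemma hyperbolic_unit : hyperbolic_mx \in unitmx.
Proof.
have GG : G *m G = 1%:M.
  rewrite /G !mulmx_block !mulmx0 !mul0mx !mul1mx !addr0 !add0r.
  by rewrite -!scalar_mx_block.
have := @mulmx1_unit _ _ hyperbolic_mx (hyperbolic_mx^T *m G).
by rewrite mulmxA hyperbolic_gram GG => /(_ erefl)[].
Qed.

(** In a basis with Gram matrix [G], skewness of a diagonal operator is this anticommutation. [G]
    fixes the isolated vector and exchanges the two blocks, whence [c0 = 0] and [c2 = - c1]. *)
Lemma gram_anticomm (c0 : 'rV[F]_1) (c1 c2 : 'rV[F]_l) :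
  let c := row_mx c0 (row_mx c1 c2) in
  G *m diag_mx c = - (diag_mx c *m G) <-> c = weight_row c1.
Proof.
move=> c; rewrite /c /G !diag_mx_row !mulmx_block !mulmx0 !mul0mx !mul1mx !mulmx1.
rewrite !addr0 !add0r !opp_block_mx !oppr0; split=> [|E].
  case/eq_block_mx => E0 _ _ /eq_block_mx[_ E2 _ _].
  rewrite /weight_row; congr (row_mx _ (row_mx _ _)).
    apply/rowP => i; have /matrixP/(_ i i)/eqP := E0.
    rewrite !mxE eqxx mulr1n -subr_eq0 opprK -mulr2n mulrn_eq0 /=.
    by move/eqP; rewrite ord1.
  apply/rowP => i; have /matrixP/(_ i i) := E2.
  by rewrite !mxE eqxx !mulr1n.
have [-> /eq_row_mx[_ ->]] := eq_row_mx E.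
have dN : diag_mx (- c1) = - diag_mx c1 by exact: raddfN.
have d0 : diag_mx (0 : 'rV[F]_1) = 0 by exact: raddf0.
by rewrite dN d0 opprK oppr0.
Qed.

Lemma exists_cartan : exists h, cartan (skew_matrices F n) h.
Proof.
pose P := hyperbolic_mx; have Pu : P \in unitmx := hyperbolic_unit.
have PTu : P^T \in unitmx by rewrite unitmx_tr.
have PG : P *m P^T = G := hyperbolic_gram.
have GT : G^T = G by rewrite -PG trmx_mul trmxK.
have diag_skew y c : P *m y = diag_mx c *m P ->
    (y \in skew_matrices F n <-> G *m diag_mx c = - (diag_mx c *m G)).
  move=> yE; have yG : P *m y *m P^T = diag_mx c *m G by rewrite yE -mulmxA PG.
  have yTG : P *m y^T *m P^T = G *m diag_mx c.
    by have := congr1 trmx yG; rewrite !trmx_mul trmxK GT tr_diag_mx mulmxA.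
  split=> [/skew_matricesP yT|E]; first by rewrite -yTG yT mulmxN mulNmx yG.
  apply/skew_matricesP; apply: (can_inj (mulKmx Pu)); apply: (can_inj (mulmxK PTu)).
  by rewrite yTG mulmxN mulNmx yG.
have tS d : torus_mx P d \in skew_matrices F n.
  apply/(diag_skew _ (weight_row d)); first exact: torus_mxE.
  exact/gram_anticomm.
have tlin : linear (torus_mx P).
  move=> c x y; have W : weight_row (c *: x + y) = c *: weight_row x + weight_row y.
    rewrite /weight_row scale_row_mx add_row_mx scaler0 add0r; congr row_mx.
    by rewrite scale_row_mx add_row_mx scalerN opprD.
  by rewrite /torus_mx W linearP /= mulmxDr mulmxDl -scalemxAr -scalemxAl.
pose tM := GRing.isLinear.Build _ _ _ _ _ tlin.
pose tl : {linear 'rV[F]_l -> 'M[F]_n} := HB.pack (torus_mx P) tM.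
pose h := limg (linfun tl).
have hE y : y \in h <-> exists d, y = torus_mx P d.
  split=> [/memv_imgP[d _ ->]|[d ->]]; first by exists d; rewrite lfunE.
  have -> : torus_mx P d = linfun tl d by rewrite lfunE.
  by rewrite memv_img ?memvf.
have comm d d' : lie (torus_mx P d) (torus_mx P d') = 0.
  apply: (can_inj (mulKmx Pu)).
  apply: (can_inj (mulmxK (_ : invmx P \in unitmx))); first by rewrite unitmx_inv.
  rewrite (lie_conj _ Pu (torus_mxE Pu d)) torus_mxE // mulmxK // mulmx0 mul0mx.
  by rewrite /lie diag_mxC subrr.
have hh0 : lie_prod h h = 0%VS.
  apply/eqP; rewrite -subv0; apply/lie_prodP => _ _ /hE[d ->] /hE[d' ->].
  by rewrite comm mem0v.
exists h; split.
- by apply/subvP => _ /hE[d ->].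
- by rewrite hh0 sub0v.
- by exists 1%N.
move=> x xS xn; pose x' := P *m x *m invmx P.
(* A regular element: its eigenvalues 0, 1, ..., l, -1, ..., -l are distinct. Its bracket with a
   normalizing [x] is diagonal in the basis of eigenvectors, which forces [x] to be diagonal
   there. *)
pose d0 : 'rV[F]_l := \row_k k.+1%:R.
have w0_inj (i j : 'I_n) : weight_row d0 0 i = weight_row d0 0 j -> i = j.
  have neg_pos (a b : nat) : (a.+1%:R == - b.+1%:R :> F) = false.
    by rewrite -subr_eq0 opprK -natrD pnatr_eq0.
  rewrite /weight_row; case: (split_ordP i) => i1 ->; case: (split_ordP j) => j1 ->;
    rewrite ?row_mxEl ?row_mxEr ?mxE.
  - by rewrite !ord1.
  - case: (split_ordP j1) => k ->; rewrite ?row_mxEl ?row_mxEr !mxE => /eqP.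
      by rewrite eq_sym pnatr_eq0.
    by rewrite eq_sym oppr_eq0 pnatr_eq0.
  - case: (split_ordP i1) => k ->; rewrite ?row_mxEl ?row_mxEr !mxE => /eqP.
      by rewrite pnatr_eq0.
    by rewrite oppr_eq0 pnatr_eq0.
  case: (split_ordP i1) => k ->; case: (split_ordP j1) => m ->;
    rewrite ?row_mxEl ?row_mxEr !mxE => /eqP.
  - by rewrite eqr_nat eqSS => /eqP/val_inj->.
  - by rewrite neg_pos.
  - by rewrite eq_sym neg_pos.
  - by rewrite eqr_opp eqr_nat eqSS => /eqP/val_inj->.
have xd i j : i != j -> x' i j = 0.
  move=> ij; have /hE[d dE] : lie (torus_mx P d0) x \in h.
    by rewrite lieC memvN xn //; apply/hE; exists d0.
  have := lie_conj x Pu (torus_mxE Pu d0); rewrite dE torus_mxE // mulmxK // -/x'.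
  move/matrixP/(_ i j)/eqP; rewrite lie_diagE mxE (negPf ij) mulr0n eq_sym mulf_eq0.
  rewrite subr_eq0; case/orP=> [/eqP/w0_inj ijE|/eqP//].
  by rewrite ijE eqxx in ij.
pose c : 'rV[F]_n := \row_i x' i i.
have xE : P *m x = diag_mx c *m P.
  apply: (canRL (mulmxKV Pu)); rewrite -/x'; apply/matrixP => i j.
  rewrite [RHS]mxE [X in X *+ _]mxE; case: eqVneq => [->//|/xd->//].
have cE : c = row_mx (lsubmx c) (row_mx (lsubmx (rsubmx c)) (rsubmx (rsubmx c))).
  by rewrite !hsubmxK.
have /(diag_skew _ _ xE) := xS; rewrite cE => /gram_anticomm cw.
apply/hE; exists (lsubmx (rsubmx c)).
by apply: (can_inj (mulKmx Pu)); rewrite torus_mxE // -cw -cE.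
Qed.

End StandardCartan.

(** * The root system of the twisted algebra *)

Lemma linfun_iota_inj (F : numFieldType) n (Q : 'M[F]_n) :
  Q *m Q = 1%:M -> injective (linfun (iota_mx Q)).
Proof. by move=> QQ x y; rewrite !lfunE => /(iota_inj QQ). Qed.

Lemma linfun_iota_lie (F : numFieldType) n (Q : 'M[F]_n) : Q *m Q = 1%:M ->
  forall x y, linfun (iota_mx Q) (lie x y) = lie (linfun (iota_mx Q) x) (linfun (iota_mx Q) y).
Proof.
move=> QQ x y; have fE z : linfun (iota_mx Q) z = iota_mx Q z by rewrite lfunE.
by rewrite !fE -[LHS]kap00 -lie_iota_kap // kap00.
Qed.

Lemma cartan_torus (F : numClosedFieldType) l (Q : 'M[F]_(1 + (l + l)))
    (h : {vspace 'M[F]_((1 + (l + l)) + (1 + (l + l)))}) :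
  Q *m Q = 1%:M ->
  cartan (linfun (iota_mx Q) @: skew_matrices F (1 + (l + l)))%VS h ->
  exists P, [/\ P \in unitmx,
    forall y, y \in h <-> exists d, y = iota_mx Q (torus_mx P d) &
    forall d, torus_mx P d \in skew_matrices F (1 + (l + l))].
Proof.
move=> QQ; have fE x : linfun (iota_mx Q) x = iota_mx Q x by rewrite lfunE.
have finj := linfun_iota_inj QQ; have flie := linfun_iota_lie QQ.
case/(cartan_preim finj flie) => h'C hE.
have [P Pu PE] := skew_cartan_diag h'C.
have tE d : torus_mx P d \in (linfun (iota_mx Q) @^-1: h)%VS.
  by apply/PE; exists d; rewrite torus_mxE.
exists P; split=> // [y|d]; last by case: h'C => /subvP sub _ _ _; apply: sub.
split=> [|[d ->]]; last by rewrite -fE memv_preim.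
rewrite {1}hE => /memv_imgP[x /PE[d xE] ->]; exists d; rewrite fE; congr iota_mx.
by apply: (can_inj (mulKmx Pu)); rewrite torus_mxE.
Qed.

Lemma mem_cap_leigenspace (F : fieldType) (V : vectType F) (U : {vspace V})
    (s t : 'End(V)) c d X :
  (X \in (U :&: passmx.leigenspace s c :&: passmx.leigenspace t d)%VS) =
  [&& X \in U, s X == c *: X & t X == d *: X].
Proof.
have mE (f : 'End(V)) e : (X \in passmx.leigenspace f e) = (f X == e *: X).
  by rewrite memv_ker add_lfunE opp_lfunE scale_lfunE id_lfunE subr_eq0.
by rewrite 2!memv_cap !mE andbA.
Qed.

Lemma lie_rootsP (F : fieldType) N (b h : {vspace 'M[F]_N}) (al : dual h) :
  lie_roots b h al <-> al != 0 /\ exists x, [/\ x \in b, x != 0 &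
     forall y : subvs_of h, lie (vsval y) x = (al y : F) *: x].
Proof.
(* In [lie_roots] the roots are compared with 0 as functions. *)
split=> -[nz H]; split=> //; apply: contra_neq nz => al0.
  by rewrite al0; apply/funext => y; rewrite lfunE.
by apply/lfunP => y; rewrite al0 lfunE.
Qed.

(** * The graded components and the non-isotropic roots in block form *)

Section MainTheorem.
Variables (R : realType) (l : nat).
Hypothesis l_gt0 : (0 < l)%N.
Local Notation n := (1 + (l + l))%N.
Local Notation C := R[i].
Variables (Q : 'M[C]_n) (s0 s1 : 'End('M[C]_(n + n))).
Hypotheses (QQ : Q *m Q = 1%:M) (QT : Q^T = Q).
Hypothesis AdD_E : forall X, s0 X = blockD C n *m X *m blockD C n.
Hypothesis AdJ_E : forall X, s1 X = blockJ Q *m X *m - blockJ Q.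
Let g := skew_matrices C (n + n).

Lemma kap_skew (p q : bool) S : S^T = sym_sign C p q *: S ->
  [/\ kap Q p q S \in g, s0 (kap Q p q S) = (-1) ^+ p *: kap Q p q S &
      s1 (kap Q p q S) = (-1) ^+ q *: kap Q p q S].
Proof.
move=> ST; have [|XT XD XJ] := (component_kap QQ QT p q (kap Q p q S)).2.
  by exists S.
by split; [exact/skew_matricesP|rewrite AdD_E|rewrite AdJ_E].
Qed.

Lemma aut_order2 (s : 'End('M[C]_(n + n))) :
  {in g, forall X, s (s X) = X} -> (exists2 X, X \in g & s X != X) ->
  aut_order g s = 2%N.
Proof.
move=> s2 [X Xg sX].
have H2 : is_aut_order g s 2.
  split=> // -[|[|m]] // _ H; case/eqP: sX; exact: H.
have [a0 aE amin] : is_aut_order g s (aut_order g s).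
  by apply: (@xgetPex _ 0%N (is_aut_order g s)); exists 2%N.
apply/eqP; rewrite eqn_leq amin //=.
by case: H2 => _ _; apply.
Qed.

Lemma sign_neq1 (X : 'M[C]_(n + n)) : X != 0 -> - X != X.
Proof.
by apply: contraNneq => /eqP; rewrite eq_sym -addr_eq0 -mulr2n -scaler_nat scaler_eq0 pnatr_eq0.
Qed.

Lemma aut_order_s0 : aut_order g s0 = 2%N.
Proof.
apply: aut_order2 => [X _|].
  by rewrite !AdD_E !mulmxA blockD_sqr mul1mx -mulmxA blockD_sqr mulmx1.
have T1 : 1%:M^T = sym_sign C true false *: (1%:M : 'M[C]_n).
  by rewrite trmx1 /sym_sign /= scale1r.
have [Xg sX _] := kap_skew T1.
exists (kap Q true false 1%:M); first exact: Xg.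
rewrite sX expr1 scaleN1r; apply: sign_neq1; apply/eqP => E.
have := @kap_inj _ _ _ QQ true false 1%:M 0.
rewrite E linear0 => /(_ erefl)/matrixP/(_ 0 0)/eqP.
by rewrite !mxE eqxx oner_eq0.
Qed.

Lemma aut_order_s1 : aut_order g s1 = 2%N.
Proof.
apply: aut_order2 => [X _|].
  rewrite !AdJ_E ?(mulmxN, mulNmx) ?opprK !mulmxA blockJ_sqr // -mulmxA.
  by rewrite blockJ_sqr // mulNmx mul1mx mulmxN mulmx1 opprK.
pose i : 'I_n := 0; pose j : 'I_n := rshift 1 (lshift l (Ordinal l_gt0)).
have FT : (skew_delta C i j)^T = sym_sign C false true *: skew_delta C i j.
  by rewrite /sym_sign /= scaleN1r; apply/skew_matricesP/skew_delta_skew.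
have [Xg _ sX] := kap_skew FT.
exists (kap Q false true (skew_delta C i j)); first exact: Xg.
rewrite sX expr1 scaleN1r.
apply: sign_neq1; apply/eqP => E.
have := @kap_inj _ _ _ QQ false true (skew_delta C i j) 0.
rewrite E linear0 => /(_ erefl)/matrixP/(_ i j)/eqP.
by rewrite /skew_delta !mxE !eqxx /= subr0 oner_eq0.
Qed.

Lemma eps2 : eps R 2 = -1.
Proof.
rewrite /eps [2 * pi / 2%:R](_ : _ = pi); last by field.
by rewrite cospi sinpi; apply/eqP; rewrite eq_complex /= oppr0 !eqxx.
Qed.

Definition parity (p : int) : bool := odd `|p|%N.

Lemma parity_odd p : parity p -> exists m, p = 2 * m + 1.
Proof.
rewrite /parity => pp; have := odd_double_half `|p|; rewrite pp -mul2n.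
move: (`|p|./2) => k E; case: (intP p) E => [|m|m] E.
- by [].
- by exists k%:Z; lia.
- by exists (- k%:Z - 1); lia.
Qed.

Lemma parity_even p : ~~ parity p -> exists m, p = 2 * m.
Proof.
rewrite /parity => /negbTE pp; have := odd_double_half `|p|; rewrite pp -mul2n.
move: (`|p|./2) => k E; case: (intP p) E => [|m|m] E.
- by exists 0.
- by exists k%:Z; lia.
- by exists (- k%:Z); lia.
Qed.

Lemma parity_2m m : parity (2 * m) = false.
Proof. by rewrite /parity abszM oddM. Qed.

Lemma parity_2m1 m : parity (2 * m + 1).
Proof.
by apply/negPn/negP => /parity_even[k]; lia.
Qed.

Lemma expN1z (p : int) : (-1) ^ p = (-1) ^+ parity p :> C.
Proof.
rewrite /parity signr_odd; case: p => m //.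
by rewrite -[LHS]/(((-1) ^+ m.+1)^-1) -exprVn invrN1.
Qed.

Lemma mem_component (p q : int) X : X \in component g s0 s1 p q <->
  exists S, S^T = sym_sign C (parity p) (parity q) *: S /\ X = kap Q (parity p) (parity q) S.
Proof.
rewrite -(component_kap QQ QT).
have -> : (X \in component g s0 s1 p q) =
    [&& X \in g, s0 X == (-1) ^+ parity p *: X & s1 X == (-1) ^+ parity q *: X].
  have := mem_cap_leigenspace g s0 s1 (eps R (aut_order g s0) ^ p) (eps R (aut_order g s1)
      ^ q) X.
  by rewrite aut_order_s0 aut_order_s1 eps2 !expN1z => <-; rewrite /component aut_order_s0
      aut_order_s1 eps2 !expN1z.
rewrite AdD_E AdJ_E.
split=> [/and3P[/skew_matricesP XT /eqP XD /eqP XJ]|[XT XD XJ]]; first by split.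
by rewrite XD XJ !eqxx !andbT; apply/skew_matricesP.
Qed.

Lemma component_img (p q : int) : ~~ (parity p && ~~ parity q) ->
  component g s0 s1 p q =
    (linfun (kap Q (parity p) (parity q)) @: skew_matrices C n)%VS.
Proof.
move=> pq; apply/vspaceP => X; apply/idP/memv_imgP => [/mem_component[S [ST ->]]|[S SS ->]].
  exists S; last by rewrite lfunE.
  by apply/skew_matricesP; rewrite ST /sym_sign (negPf pq) scaleN1r.
apply/mem_component; exists S; rewrite lfunE /sym_sign (negPf pq) scaleN1r; split=> //.
exact/skew_matricesP.
Qed.

Lemma component00 : component g s0 s1 0 0 = (linfun (iota_mx Q) @: skew_matrices C n)%VS.
Proof.
rewrite component_img //; congr (_ @: _)%VS; apply/lfunP => S.
by rewrite !lfunE /= kap00.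
Qed.

Let a := component g s0 s1 0 0.

Lemma mem_a X : X \in a <-> exists2 S, S \in skew_matrices C n & X = iota_mx Q S.
Proof.
rewrite /a component00; split=> [/memv_imgP[S SS ->]|[S SS ->]].
  by exists S; rewrite ?lfunE.
by rewrite -[iota_mx Q S](lfunE (iota_mx Q)) memv_img.
Qed.

(** Right multiplication by the twist is the intertwiner, because the twist commutes with the image
    of [iota_mx]. *)
Lemma component_iso (q p : bool) : ~~ (p && ~~ q) ->
  lmod_iso a a (linfun (kap Q p q) @: skew_matrices C n)%VS.
Proof.
move=> pq; exists (linfun (mulmxr (twist_mx Q p q))).
have fE S : linfun (mulmxr (twist_mx Q p q)) (iota_mx Q S) = kap Q p q S by rewrite lfunE.
split.
- move=> _ _ /mem_a[S SS ->] /mem_a[T TT ->].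
  have -> : lie (iota_mx Q S) (iota_mx Q T) = iota_mx Q (lie S T).
    by rewrite -[iota_mx Q T]kap00 (lie_iota_kap QQ) kap00.
  transitivity (kap Q p q (lie S T)); first exact: fE.
  rewrite -(lie_iota_kap QQ); congr lie; exact: (esym (fE T)).
- apply/eqP; rewrite -subv0; apply/subvP => X; rewrite memv_cap memv_ker.
  case/andP=> /mem_a[S _ ->]; rewrite fE => /eqP E.
  have -> : S = 0 by apply: (kap_inj QQ (p := p) (q := q)); rewrite E linear0.
  by rewrite linear0 mem0v.
apply/vspaceP => X; apply/memv_imgP/memv_imgP => [[Y /mem_a[S SS ->] ->]|[S SS ->]].
  by exists S; rewrite ?fE ?lfunE.
by exists (iota_mx Q S); rewrite ?fE ?lfunE //; apply/mem_a; exists S.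
Qed.

(** Symmetric matrices are traceless ones plus scalars, and scalars commute with everything. For
    [n = 2l + 1], the dimension [n (n + 1) / 2 - 1] is [2 l^2 + 3 l]. *)
Lemma component10_decomposition :
  exists W1 W2 : {vspace 'M[C]_(n + n)},
    [/\ (W1 + W2)%VS = component g s0 s1 1 0 /\ (W1 :&: W2)%VS = 0%VS,
        lmod_irreducible a W1 /\ \dim W1 = (2 * l ^ 2 + 3 * l)%N &
        (lie_prod a W2 <= W2)%VS /\ \dim W2 = 1%N].
Proof.
pose k := linfun (kap Q true false).
have kE S : k S = kap Q true false S by rewrite lfunE.
have kinj : injective k by move=> x y; rewrite !kE => /(kap_inj QQ).
have n0 : n%:R != 0 :> C by rewrite pnatr_eq0.
have one_nz : 1%:M != 0 :> 'M[C]_n.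
  by apply/eqP => /matrixP/(_ 0 0)/eqP; rewrite !mxE eqxx oner_eq0.
have kD S c : k (S + c%:M) = k S + c *: k 1%:M.
  by rewrite linearD; congr (_ + _); rewrite -[c%:M]scalemx1; exact: linearZ.
exists (k @: sym0_matrices C n)%VS, <[k 1%:M]>%VS; split; split.
- apply/vspaceP => X; apply/idP/idP => [/memv_addP[_ /memv_imgP[S /sym0_matricesP[ST _] ->]]|].
    case=> _ /vlineP[c ->] ->; apply/mem_component; exists (S + c%:M).
    rewrite /sym_sign /= scale1r linearD /= ST tr_scalar_mx; split=> //.
    by rewrite -kD kE.
  case/mem_component=> S []; rewrite /sym_sign /= scale1r => ST ->.
  have -> : kap Q true false S = k (S - (\tr S / n%:R)%:M) + (\tr S / n%:R) *: k 1%:M.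
    by rewrite -kD subrK kE.
  apply: memv_add; last by apply/vlineP; exists (\tr S / n%:R).
  apply: memv_img; apply/sym0_matricesP; split.
    by rewrite linearB /= ST tr_scalar_mx.
  by rewrite linearB /= mxtrace_scalar -(mulr_natr (_ / _)) divfK // subrr.
- apply/eqP; rewrite -subv0; apply/subvP => X; rewrite memv_cap => /andP[].
  case/memv_imgP=> S /sym0_matricesP[_ Str] -> /vlineP[c]; rewrite -linearZ /= => /kinj SE.
  move: Str; rewrite SE scalemx1 mxtrace_scalar -(mulr_natr c) => /eqP.
  by rewrite mulf_eq0 (negPf n0) orbF => /eqP->; rewrite raddf0 linear0 mem0v.
- rewrite /a component00; apply: lmod_irreducible_img => //; last exact: sym0_irreducible.
  by move=> x y; rewrite lfunE !kE; exact: (lie_iota_kap QQ).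
- rewrite limg_dim_eq; last first.
    apply/eqP; rewrite -subv0; apply/subvP => x; rewrite memv_cap memv_ker => /andP[_].
    by rewrite -(linear0 k) => /eqP/kinj->; rewrite mem0v.
  have := dim_sym0 C (l + l); rewrite -[(l + l).+1]/n => dE.
  by apply: double_inj; rewrite dE; lia.
- apply/lie_prodP => _ _ /mem_a[S SS ->] /vlineP[c ->].
  rewrite linearZ /= kE (lie_iota_kap QQ) /lie mulmx1 mul1mx subrr linear0 scaler0.
  exact: mem0v.
by rewrite dim_vline -(linear0 k) (inj_eq kinj) one_nz.
Qed.

Section CartanRoots.
Variable h : {vspace 'M[C]_(n + n)}.
Hypothesis hC : cartan a h.

Lemma lie_roots_root_B P :
  P \in unitmx -> (forall y, y \in h <-> exists d, y = iota_mx Q (torus_mx P d)) ->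
  (forall d, torus_mx P d \in skew_matrices C n) ->
  lie_roots a h = [set al | root_B P al]%classic.
Proof.
move=> Pu hE tS; apply/seteqP; split=> al.
  case/lie_rootsP => nz [X [/mem_a[S SS ->] Snz Xw]].
  apply/(skew_weights Pu hE); split; first exact: nz.
  have [i [j [ij alE]]] : exists i j, (false && ~~ false \/ i != j) /\ al = wform P h i +
      wform P h j.
    apply/(kap_weights QQ Pu hE tS); exists S; split.
    - by apply: contraNneq Snz => ->; rewrite linear0.
    - by rewrite /sym_sign /= scaleN1r; apply/skew_matricesP.
    - by move=> y; rewrite kap00.
  by exists i, j; split=> //; case: ij.
case/((skew_weights Pu hE al).2) => nz [i [j [ij alE]]].
apply/lie_rootsP; split; first exact: nz.
have [S [Snz ST Sw]] : exists S, [/\ S != 0, S^T = sym_sign C false false *: S &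
    forall y : subvs_of h, lie (vsval y) (kap Q false false S) = (al y : C) *: kap Q false
        false S].
  by apply/(kap_weights QQ Pu hE tS); exists i, j; split=> //; right.
exists (iota_mx Q S); split.
- apply/mem_a; exists S => //; apply/skew_matricesP.
  by rewrite ST /sym_sign /= scaleN1r.
- by apply: contraNneq Snz => E; apply/eqP/(iota_inj QQ); rewrite E linear0.
by move=> y; rewrite -kap00 Sw.
Qed.

Lemma nonisotropic_rootsE : nonisotropic_roots g s0 s1 h = BC22_1 g h a.
Proof.
have [P [Pu hE tS]] := cartan_torus QQ (eq_ind _ (fun b => cartan b h) hC _ component00).
have rE := lie_roots_root_B Pu hE tS.
have shortE al : short_roots g a h al <->
    exists (k : 'I_l) (b : bool), al = (-1) ^+ b *: eform P h k.
  rewrite -(short_root_B QQ QT Pu hE tS l_gt0) /short_roots /= rE; exact: iff_refl.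
have VE (al : dual h) (m k : int) :
    Vemb al + m%:~R *: delta0 h + k%:~R *: delta1 h = (al, (m%:~R, k%:~R)).
  transitivity ((al + m%:~R *: (0 : dual h) + k%:~R *: (0 : dual h),
    (0 + m%:~R * 1 + k%:~R * 0, 0 + m%:~R * 0 + k%:~R * 1)) : Vspace h); first by [].
  by rewrite !scaler0 !mulr0 !mulr1 !addr0 !add0r.
have compE (al : dual h) (m k : int) :
    (exists X, [/\ X \in component g s0 s1 m k, X != 0 &
       forall y : subvs_of h, lie (vsval y) X = (al y : C) *: X]) <->
    exists i j, (parity m && ~~ parity k \/ i != j) /\ al = wform P h i + wform P h j.
  rewrite -(kap_weights QQ Pu hE tS).
  split=> [[X [/mem_component[S [ST ->]] nz Xw]]|[S [nz ST Sw]]].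
    by exists S; split=> //; apply: contraNneq nz => ->; rewrite linear0.
  exists (kap Q (parity m) (parity k) S); split=> //; first by apply/mem_component; exists S.
  by apply: contraNneq nz => E; apply/eqP/(kap_inj QQ (p := parity m) (q := parity k));
      rewrite E linear0.
apply/seteqP; split=> [[al [u v]] [/= fnz]|x].
  have alnz : al != 0.
    apply: contraNneq fnz => al0.
    by rewrite /Vform al0 (dual_form0 QQ QT Pu hE tS l_gt0).
  case/(twisted_toroidal_weight _ _ _ _ _ alnz) => m [k [-> -> /compE[i [j [ij alE]]]]].
  have left_root : root_B P al -> BC22_1 g h a (al, (m%:~R, k%:~R)).
    by move=> aB; left; exists al, m, k; rewrite rE VE.
  (* Only in degree (odd, even) may the two indices coincide, and this is the source of the second
     family. With distinct indices the weight is a root of type B. *)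
  case: ij => [/andP[pm pk]|ij]; last first.
    by apply/left_root/(skew_weights Pu hE); split; [exact: alnz|exists i, j].
  have [|//|[t [b alt]]] := (sym_weights Pu hE al).1 _; first by split; [exact: alnz|exists
      i, j].
  have [m' mE] := parity_odd pm; have [k' kE] := parity_even pk.
  right; exists al, m', k'; rewrite VE -mE -kE; split=> //.
  exists ((-1) ^+ b *: eform P h t); first by apply/shortE; exists t, b.
  by rewrite alt !scalerA mulrC.
have weightI (al : dual h) (m k : int) : dual_form g h al al != 0 ->
    (exists i j, (parity m && ~~ parity k \/ i != j) /\ al = wform P h i + wform P h j) ->
    nonisotropic_roots g s0 s1 h (al, (m%:~R, k%:~R)).
  move=> fnz /compE H; split; first exact: fnz.
  have alnz : al != 0.
    by apply: contraNneq fnz => ->; rewrite (dual_form0 QQ QT Pu hE tS l_gt0).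
  by apply/(twisted_toroidal_weight _ _ _ _ _ alnz); exists m, k; split.
case=> [[be [m [k [beR ->]]]]|[be [m [k [[ga /shortE[t [b ->]] <-] ->]]]]]; rewrite VE.
  rewrite rE in beR; apply: weightI; first exact: (dual_form_root_B_neq0 QQ QT Pu hE tS l_gt0).
  have [_ [i [j [ij beE]]]] := (skew_weights Pu hE be).2 beR.
  by exists i, j; split=> //; right.
apply: weightI.
  rewrite scalerA mulrC -scalerA (dual_form_short QQ QT Pu hE tS l_gt0).
  by rewrite mulf_neq0 ?expf_neq0 ?invr_eq0 ?pnatr_eq0 // muln_eq0 negb_or -!lt0n l_gt0.
(* The repeated index realizes twice a short root; it is admissible because the degree
   [(2 * m + 1, 2 * k)] is (odd, even). *)
exists (rshift 1 (if b then rshift l t else lshift l t)).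
exists (rshift 1 (if b then rshift l t else lshift l t)).
rewrite wform_surj; split; first by left; rewrite parity_2m1 parity_2m.
by rewrite scaler_nat mulr2n.
Qed.

End CartanRoots.

Lemma bc22_block_model :
  [/\ lie_type_B l a,
      lmod_iso a a (component g s0 s1 0 1) /\ lmod_iso a a (component g s0 s1 1 1),
      exists W1 W2 : {vspace 'M[C]_(n + n)},
        [/\ (W1 + W2)%VS = component g s0 s1 1 0 /\ (W1 :&: W2)%VS = 0%VS,
            lmod_irreducible a W1 /\ \dim W1 = (2 * l ^ 2 + 3 * l)%N &
            (lie_prod a W2 <= W2)%VS /\ \dim W2 = 1%N] &
      forall h : {vspace 'M[C]_(n + n)}, cartan a h ->
        nonisotropic_roots g s0 s1 h = BC22_1 g h a].
Proof.
have finj := linfun_iota_inj QQ; have flie := linfun_iota_lie QQ.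
split; last 1 first.
- by move=> h; apply: nonisotropic_rootsE.
- split.
  + rewrite /a component00; apply: lie_simple_img => //; exact: skew_simple.
  + have [h hC] := exists_cartan C l.
    by exists (linfun (iota_mx Q) @: h)%VS; rewrite /a component00; apply: cartan_img.
  move=> h hC; have := hC; rewrite {1}/a component00 => /(cartan_torus QQ)[P [Pu hE tS]].
  by rewrite (lie_roots_root_B Pu hE tS); exact: root_type_B_root_B Pu hE.
- by split; rewrite component_img //; apply: component_iso.
exact: component10_decomposition.
Qed.

End MainTheorem.

(** [4 * l + 2] is not convertible to a sum of two copies of [1 + (l + l)]. Keeping the dimensions
    as variables with equations lets them be substituted, so that no matrix has to be cast. *)
Lemma bc22_of_dim (R : realType) l N m (s0 s1 : 'End('M[R[i]]_N)) : (0 < l)%N ->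
  m = (1 + (l + l))%N -> N = (m + m)%N ->
  s0 = Ad (\sum_(1 <= i < m.+1) (munit R[i] N i i - munit R[i] N (m + i) (m + i))) ->
  s1 = Ad (\sum_(1 <= i < N.+1) (-1) ^+ i *: munit R[i] N i (N.+1 - i)) ->
  let g := skew_matrices R[i] N in
  let g_ := component g s0 s1 in
  let a := g_ 0 0 in
  [/\ lie_type_B l a,
      lmod_iso a a (g_ 0 1) /\ lmod_iso a a (g_ 1 1),
      exists W1 W2 : {vspace 'M[R[i]]_N},
        [/\ (W1 + W2)%VS = g_ 1 0 /\ (W1 :&: W2)%VS = 0%VS,
            lmod_irreducible a W1 /\ \dim W1 = (2 * l ^ 2 + 3 * l)%N &
            (lie_prod a W2 <= W2)%VS /\ \dim W2 = 1%N] &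
      forall h : {vspace 'M[R[i]]_N}, cartan a h ->
        nonisotropic_roots g s0 s1 h = BC22_1 g h a].
Proof.
move=> l_gt0 mE NE; subst m N => s0E s1E.
have n_odd : odd (1 + (l + l)) by rewrite !oddD addbb.
have QQ := antidiag_sqr R[i] n_odd.
apply: (bc22_block_model l_gt0 QQ (trmx_antidiag R[i] n_odd)) => X.
  by rewrite s0E sigma0_matrix AdE invmx_blockD.
by rewrite s1E (sigma1_matrix R[i] n_odd) AdE invmx_blockJ.
Qed.

Theorem mainTheorem12 (R : realType) (l : nat) (hl : (1 <= l)%N) :
  let g := skew_matrices R[i] (4 * l + 2) in
  let s0 := sigma0 R[i] l in
  let s1 := sigma1 R[i] l in
  let g_ := component g s0 s1 in
  let a := g_ 0 0 in
  [/\ lie_type_B l a,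
      lmod_iso a a (g_ 0 1) /\ lmod_iso a a (g_ 1 1),
      exists W1 W2 : {vspace 'M[R[i]]_(4 * l + 2)},
        [/\ (W1 + W2)%VS = g_ 1 0 /\ (W1 :&: W2)%VS = 0%VS,
            lmod_irreducible a W1 /\ \dim W1 = (2 * l ^ 2 + 3 * l)%N &
            (lie_prod a W2 <= W2)%VS /\ \dim W2 = 1%N] &
      forall h : {vspace 'M[R[i]]_(4 * l + 2)}, cartan a h ->
        nonisotropic_roots g s0 s1 h = BC22_1 g h a].
Proof.
have mE : (2 * l + 1 = 1 + (l + l))%N by lia.
have NE : (4 * l + 2 = (2 * l + 1) + (2 * l + 1))%N by lia.
have E3 : (4 * l + 3 = (4 * l + 2).+1)%N by rewrite addnS.
have s1E : sigma1 R[i] l = Ad (\sum_(1 <= i < (4 * l + 2).+1)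
    (-1) ^+ i *: munit R[i] (4 * l + 2) i ((4 * l + 2).+1 - i)).
  by rewrite /sigma1 E3.
exact: (bc22_of_dim hl mE NE (erefl (sigma0 R[i] l)) s1E).
Qed.
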